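(* Let $n\geq 2$ and let $f\in R=\mathbb{C}[x_1,\dots,x_n]$ be homogeneous of degree $d$, with $\dim\operatorname{Sing} f^{-1}(0)\leq 1$ and $f$ not a polynomial of $n-1$ variables. Then for all $k\in\mathbb{Z}$ $$\mu''_k+\nu_{nd-k}=\tau_Z,\qquad \delta''_k=\delta''_{(n-1)d-k},$$ where $\delta''_k:=\mu''_k-\nu_{k+d}$.
   Context: $R=\mathbb{C}[x_1,\dots,x_n]$ is graded by $\deg x_i=1$. $\Omega^j$ is the graded free $R$-module of algebraic differential $j$-forms on $\mathbb{C}^n$, with $\deg x_i=\deg dx_i=1$. $\operatorname{Sing} f^{-1}(0)\subset\mathbb{C}^n$ is the common zero set of the partial derivatives of $f$. ''$f$ is not a polynomial of $n-1$ variables'' means that no linear change of coordinates makes $f$ depend on only $n-1$ variables. $M:=\Omega^n/df\wedge\Omega^{n-1}$ and $N:=\operatorname{Ker}(df\wedge:\Omega^{n-1}\to\Omega^n)/df\wedge\Omega^{n-2}$, graded so that $M_k$ consists of classes of $n$-forms of degree $k$ and $N_k$ of classes of $(n-1)$-forms of degree $k-d$. With $\mathfrak{m}=(x_1,\dots,x_n)$, $M':=\{a\in M\mid \mathfrak{m}^ja=0 \text{ for } j\gg 0\}$ and $M'':=M/M'$. Set $\mu''_k:=\dim_{\mathbb{C}}M''_k$, $\nu_k:=\dim_{\mathbb{C}}N_k$. $Z:=\{f=0\}\subset Y:=\mathbb{P}^{n-1}$, $\Sigma:=\operatorname{Sing}Z$ is the (finite) image in $\mathbb{P}^{n-1}$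 of $\operatorname{Sing}f^{-1}(0)\setminus\{0\}$, and the total Tjurina number is $\tau_Z:=\sum_{z\in\Sigma}\dim_{\mathbb{C}}\mathcal{O}_{Y,z}/(h_z,\partial h_z)$, where $h_z$ is a local defining equation of $Z$ at $z$ ($h_z$ being $f$ divided by the $d$-th power of a linear form not vanishing at $z$) and $(\partial h_z)$ is the ideal generated by its partial derivatives. *)

(* Defs.v *)
From HB Require Import structures.
From mathcomp Require Import all_boot all_order all_algebra.
From mathcomp Require Import complex mpoly.
From mathcomp Require Import boolp classical_sets fsbigop reals.

Set Implicit Arguments.
Unset Strict Implicit.
Unset Printing Implicit Defensive.

Import GRing.Theory.

Local Open Scope classical_set_scope.
Local Open Scope ring_scope.

Section QuotientDimension.
Variables (K : fieldType) (V : lmodType K).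

(* The b i lie in U and their classes form a K-basis of U / (U `&` W), i.e. of
   the image of U in V / W. *)
Definition quot_basis (U W : set V) (m : nat) (b : 'I_m -> V) : Prop :=
  (forall i, U (b i)) /\
  forall u, U u ->
    exists! c : {ffun 'I_m -> K}, W (u - \sum_(i < m) c i *: b i).

(* The K-dimension of that image, with the convention that it is 0 when the
   image is not finite-dimensional. *)
Definition quot_dim (U W : set V) : nat :=
  xget 0%N [set m | exists b : 'I_m -> V, quot_basis U W b].

End QuotientDimension.

Section Ideals.
Variable A : comNzRingType.

Definition ideal_span (G : set A) : set A :=
  [set a | exists s : seq (A * A),
     (forall x, x \in s -> G x.2) /\ a = \sum_(x <- s) x.1 * x.2].

Definition ideal_pow (I : set A) (j : nat) : set A :=
  ideal_span [set a | exists t : 'I_j -> A,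
                (forall i, I (t i)) /\ a = \prod_(i < j) t i].

End Ideals.

Section AffineSpace.
Variables (K : fieldType) (n : nat).

Definition zariski_closed (X : set 'rV[K]_n) : Prop :=
  exists S : set {mpoly K[n]},
    X = [set v | forall p, S p -> p.@[v ord0] = 0].

Definition zariski_irreducible (X : set 'rV[K]_n) : Prop :=
  [/\ zariski_closed X, X !=set0 &
      forall Y Z, zariski_closed Y -> zariski_closed Z ->
        X `<=` Y `|` Z -> X `<=` Y \/ X `<=` Z].

(* Krull dimension at most e: there is no strictly increasing chain
   Z 0 < ... < Z (e + 1) of irreducible closed subsets of X.  The empty set has
   dimension at most e for every e. *)
Definition zariski_dim_le (X : set 'rV[K]_n) (e : nat) : Prop :=
  ~ exists Z : nat -> set 'rV[K]_n,
      (forall i, (i <= e.+1)%N -> zariski_irreducible (Z i) /\ Z i `<=` X) /\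
      (forall i, (i <= e)%N -> Z i `<` Z i.+1).

Definition sing_locus (f : {mpoly K[n]}) : set 'rV[K]_n :=
  [set v | forall i, (f^`M(i)).@[v ord0] = 0].

Definition linear_change (A : 'M[K]_n) (f : {mpoly K[n]}) : {mpoly K[n]} :=
  f \mPo [tuple \sum_(j < n) A i j *: 'X_j | i < n].

Definition poly_of_fewer_variables (f : {mpoly K[n]}) : Prop :=
  exists (A : 'M[K]_n) (i : 'I_n), A \in unitmx /\
    forall m, m \in msupp (linear_change A f) -> m i = 0%N.

End AffineSpace.

(* The form \sum_I w_I dx_I, where dx_I is the wedge product of the dx_i, i \in I,
   taken in increasing order, is encoded as the function I |-> w_I.  This is the
   whole exterior algebra; [is_form j] cuts out the j-forms. *)
Notation forms K n := {ffun {set 'I_n} -> {mpoly K[n]}}.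

Section Forms.
Variables (K : fieldType) (n : nat).
Implicit Types (f p : {mpoly K[n]}) (w : forms K n).

Definition is_form (j : nat) w : Prop := forall I, w I != 0 -> #|I| = j.

(* Each dx_i has degree 1, so x^m dx_I has degree |m| + |I|. *)
Definition form_degree (k : int) w : Prop :=
  forall I m, m \in msupp (w I) -> (mdeg m + #|I|)%:Z = k.

Definition inversions (I J : {set 'I_n}) : nat :=
  #|[pred ij : 'I_n * 'I_n | [&& ij.1 \in I, ij.2 \in J & (ij.2 < ij.1)%N]]|.

Definition wedge w1 w2 : forms K n :=
  [ffun D : {set 'I_n} => \sum_(I : {set 'I_n} | I \subset D)
     (-1) ^+ inversions I (D :\: I) * w1 I * w2 (D :\: I)].

Definition differential f : forms K n :=
  [ffun I : {set 'I_n} => \sum_(i | I == [set i]%SET) f^`M(i)].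

Definition form_scale p w : forms K n := [ffun I => p * w I].

(* df /\ Omega^j *)
Definition df_image f (j : nat) : set (forms K n) :=
  [set w | exists2 e, is_form j e & w = wedge (differential f) e].

Definition irrelevant_ideal : set {mpoly K[n]} :=
  ideal_span [set p | exists i, p = 'X_i].

(* The preimage in Omega^n of M', so that M'' is the quotient of Omega^n by it. *)
Definition torsion_forms f : set (forms K n) :=
  [set w | is_form n w /\
     exists j0 : nat, forall j, (j0 <= j)%N ->
       forall p, ideal_pow irrelevant_ideal j p ->
         df_image f n.-1 (form_scale p w)].

Definition mu'' f (k : int) : nat :=
  quot_dim [set w | is_form n w /\ form_degree k w] (torsion_forms f).

(* The grading of N is shifted by d: N_k consists of classes of forms of
   degree k - d. *)
Definition nu f (d : nat) (k : int) : nat :=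
  quot_dim
    [set w | [/\ is_form n.-1 w, wedge (differential f) w = 0 &
                 form_degree (k - d%:Z) w]]
    (df_image f n.-2).

Definition delta'' f (d : nat) (k : int) : int :=
  (mu'' f k)%:Z - (nu f d (k + d%:Z))%:Z.

End Forms.

(* Rational functions, as a vector space over the constants. *)
Definition ratfun (K : fieldType) (m : nat) : Type := {fraction {mpoly K[m]}}.

Section RatFun.
Variables (K : fieldType) (m : nat).

HB.instance Definition _ := GRing.Field.on (ratfun K m).

Definition rat_of_poly (p : {mpoly K[m]}) : ratfun K m := tofrac p.

Definition ratfun_scale (c : K) (x : ratfun K m) : ratfun K m :=
  rat_of_poly c%:MP * x.

Fact ratfun_scaleA a b x :
  ratfun_scale a (ratfun_scale b x) = ratfun_scale (a * b) x.
Proof. by rewrite /ratfun_scale /rat_of_poly mpolyCM rmorphM mulrA. Qed.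

Fact ratfun_scale1 : left_id 1 ratfun_scale.
Proof. by move=> x; rewrite /ratfun_scale /rat_of_poly rmorph1 mul1r. Qed.

Fact ratfun_scaleDr : right_distributive ratfun_scale +%R.
Proof. by move=> c x y; rewrite /ratfun_scale mulrDr. Qed.

Fact ratfun_scaleDl x : {morph ratfun_scale^~ x : a b / a + b}.
Proof.
by move=> a b; rewrite /ratfun_scale /rat_of_poly mpolyCD rmorphD mulrDl.
Qed.

HB.instance Definition _ := GRing.Zmodule_isLmodule.Build K (ratfun K m)
  ratfun_scaleA ratfun_scale1 ratfun_scaleDr ratfun_scaleDl.

(* The local ring of affine m-space at the point q. *)
Definition local_ring (q : 'I_m -> K) : set (ratfun K m) :=
  [set x | exists a b : {mpoly K[m]},
     b.@[q] <> 0 /\ x = rat_of_poly a / rat_of_poly b].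

(* The ideal (h, dh) of the local ring at q. *)
Definition tjurina_ideal (h : {mpoly K[m]}) (q : 'I_m -> K) :
    set (ratfun K m) :=
  [set x | exists (g0 : ratfun K m) (g : 'I_m -> ratfun K m),
     [/\ local_ring q g0, (forall j, local_ring q (g j)) &
         x = g0 * rat_of_poly h + \sum_(j < m) g j * rat_of_poly h^`M(j)]].

Definition tjurina_number (h : {mpoly K[m]}) (q : 'I_m -> K) : nat :=
  quot_dim (local_ring q) (tjurina_ideal h q).

End RatFun.

Section Projective.
Variables (K : fieldType) (n : nat).

(* For f homogeneous of degree d, this is f / x_i^d written in the coordinates
   x_j / x_i, j != i, of the chart x_i != 0 of P^(n-1). *)
Definition dehomogenize (i : 'I_n) (f : {mpoly K[n]}) : {mpoly K[n.-1]} :=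
  f \mPo [tuple if unlift i j is Some k then 'X_k else 1 | j < n].

Definition chart_point (i : 'I_n) (v : 'rV[K]_n) : 'I_n.-1 -> K :=
  fun k => v ord0 (lift i k) / v ord0 i.

(* Points of P^(n-1) are lines in K^n. *)
Definition proj_sing (f : {mpoly K[n]}) : set {vspace 'rV[K]_n} :=
  [set <[v]>%VS | v in [set v | sing_locus f v /\ v <> 0]].

(* Computed in a standard chart containing z; the default value is never used
   when z is a line. *)
Definition local_tjurina (f : {mpoly K[n]}) (z : {vspace 'rV[K]_n}) : nat :=
  let v := vpick z in
  if [pick i | v ord0 i != 0] is Some i
  then tjurina_number (dehomogenize i f) (chart_point i v) else 0%N.

(* The sum over a set is 0 by convention if infinitely many terms are nonzero. *)
Definition total_tjurina (f : {mpoly K[n]}) : nat :=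
  (\sum_(z \in proj_sing f) local_tjurina f z)%N.

End Projective.

(* Main.v *)
Require Import Defs.
From HB Require Import structures.
From mathcomp Require Import all_boot all_order all_algebra.
From mathcomp Require Import complex ssrcomplements mpoly.
From mathcomp Require Import boolp classical_sets functions cardinality.
From mathcomp Require Import fsbigop filter reals.
From mathcomp Require Import zify ring lra.
From mathcomp Require Import ssrAC.

(** Let J be the ideal of the partial derivatives f_1, ..., f_n of f.  The plan
    is to count dimensions in R/(J, l^s) for a linear form l and a large s.

    The singular locus is a cone of dimension at most 1, hence a finite union of
    lines (finite_proj_sing): from infinitely many lines an ultrafilter would
    produce a prime ideal whose zero set is a larger irreducible cone.  So there
    is a linear form l that vanishes on none of them, and by the Nullstellensatz
    R/(J, l^s) is finite-dimensional for every s.  Consequently multiplication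
    by l is bijective on R/J in high degrees (lin_eventually_bij); these graded
    pieces have a common dimension tau, and the torsion of R/J consists of the
    elements killed by a power of l.

    Count in degree t = s + c with s large.  The kernel of the projection of
    (R/J)_t onto (R/(J, l^s))_t is the image of (R/J)_c under l^s, that is, the
    torsion-free quotient M'' in the corresponding degree.  Hence tau is the sum
    of mu'' and the dimension of (R/(J, l^s))_t.  The latter equals nu in the
    complementary degree, by duality.  To see this let the polynomial ring act on
    functions on Z^n, viewed as Laurent series, and consider the Koszul complex
    of f_1, ..., f_n, l^s with such coefficients.  Some power of each x_i lies in
    (J, l^s), hence acts by zero on Koszul cohomology, whereas x_i is invertible
    on series with unrestricted i-th exponents; so that complex is contractible,
    by an explicit homotopy (chom_homotopy).  The sequence that relates
    nonnegative, arbitrary and negative i-th exponents then shifts the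
    cohomological degree by one (shift_step).  After n steps the n-th cohomology
    over power series has become the degree zero cohomology over series with
    negative exponents only, which is the dual of R/(J, l^s) by Macaulay's
    inverse system (inverse_system_dim).  In the degrees at hand the generator
    attached to l^s must occur, because the other components have negative
    degree, and the n-th cohomology is the graded piece of N (forms_dim).  This
    is mu_nu_sum.

    It remains to see that tau is the total Tjurina number (hilbert_tjurina).
    By Euler's formula the ideal (h, dh) in the local ring at a singular point
    is generated by the dehomogenized partial derivatives, so a form of degree t
    maps into it exactly if some form not vanishing at the point multiplies it
    into J (tjurina_germ).  For large t a form with this property at every
    singular point lies in J, and a Chinese remainder argument shows that the
    forms of degree t map onto the product of the local Tjurina algebras.

    The second identity follows formally from the first (delta_symmetric). *)

Set Implicit Arguments.
Unset Strict Implicit.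
Unset Printing Implicit Defensive.

Import Order.TTheory GRing.Theory Num.Theory.

Local Open Scope classical_set_scope.
Local Open Scope ring_scope.

(** * Dimensions of quotients of subspaces *)

Lemma subr_subl (V : zmodType) (u x y : V) : (u - y) - (u - x) = x - y.
Proof. by rewrite opprB addrC addrA subrK. Qed.

Section QuotientDimension.
Variable K : fieldType.

Definition subspace (V : lmodType K) (U : set V) : Prop :=
  U 0 /\ forall a u v, U u -> U v -> U (a *: u + v).

Definition has_quot_dim (V : lmodType K) (U W : set V) (m : nat) : Prop :=
  exists b : 'I_m -> V, quot_basis U W b.

Definition spans_mod (V : lmodType K) (U W : set V) m (g : 'I_m -> V) : Prop :=
  forall u, U u -> exists c : 'I_m -> K, W (u - \sum_i c i *: g i).

Definition free_mod (V : lmodType K) (W : set V) m (g : 'I_m -> V) : Prop :=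
  forall c : 'I_m -> K, W (\sum_i c i *: g i) -> forall i, c i = 0.

Section Subspace.
Variables (V : lmodType K) (U : set V).
Hypothesis Usub : subspace U.

Lemma subspace0 : U 0. Proof. by case: Usub. Qed.

Lemma subspaceD u v : U u -> U v -> U (u + v).
Proof. by case: Usub => _ h Uu Uv; rewrite -[u]scale1r; apply: h. Qed.

Lemma subspaceZ a u : U u -> U (a *: u).
Proof. by case: Usub => U0 h Uu; rewrite -[_ *: _]addr0; apply: h. Qed.

Lemma subspaceN u : U u -> U (- u).
Proof. by rewrite -scaleN1r; apply: subspaceZ. Qed.

Lemma subspaceB u v : U u -> U v -> U (u - v).
Proof. by move=> Uu Uv; apply: subspaceD => //; apply: subspaceN. Qed.

Lemma subspace_sum (I : Type) (r : seq I) (P : pred I) (F : I -> V) :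
  (forall i, P i -> U (F i)) -> U (\sum_(i <- r | P i) F i).
Proof. by move=> h; elim/big_ind: _ => //; [exact: subspace0|exact: subspaceD]. Qed.

Lemma subspace_lin m (g : 'I_m -> V) (c : 'I_m -> K) :
  (forall i, U (g i)) -> U (\sum_i c i *: g i).
Proof. by move=> h; apply: subspace_sum => i _; apply: subspaceZ. Qed.

Lemma subspace_mod u v : U (u - v) -> U v -> U u.
Proof. by move=> h Uv; rewrite -(subrK v u); apply: subspaceD. Qed.

End Subspace.

Lemma subspaceI (V : lmodType K) (U W : set V) :
  subspace U -> subspace W -> subspace (U `&` W).
Proof.
move=> [U0 hU] [W0 hW]; split=> [|a u v [? ?] [? ?]]; split=> //.
  exact: hU.
exact: hW.
Qed.

Section Basis.
Variables (V : lmodType K) (U W : set V).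
Hypotheses (Usub : subspace U) (Wsub : subspace W).

(** Uniqueness of coefficients is freeness modulo W: two expansions of the same
    vector differ by a relation modulo W. *)
Lemma quot_basisP m (b : 'I_m -> V) :
  quot_basis U W b <->
  [/\ forall i, U (b i), spans_mod U W b & free_mod W b].
Proof.
split=> [[Ub hb]|[Ub sp fr]].
  split=> // [u Uu|c Wc i].
    by have [c [Wc _]] := hb u Uu; exists c.
  have [c0 [_ uc]] := hb _ (subspace0 Usub).
  have e0 : c0 = [ffun=> 0].
    apply: uc; rewrite big1 ?subr0; first exact: subspace0.
    by move=> j _; rewrite ffunE scale0r.
  have : c0 = [ffun i => - c i].
    apply: uc; rewrite sub0r -sumrN (eq_bigr (fun i => c i *: b i)) // => j _.
    by rewrite ffunE scaleNr opprK.
  rewrite e0 => /ffunP/(_ i); rewrite !ffunE => /esym/eqP.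
  by rewrite oppr_eq0 => /eqP.
split=> // u Uu; have [c Wc] := sp u Uu; exists [ffun i => c i]; split.
  by rewrite (eq_bigr (fun i => c i *: b i)) // => i _; rewrite ffunE.
move=> c' Wc'; apply/ffunP => i; rewrite ffunE; apply/eqP; rewrite -subr_eq0.
apply/eqP; apply: (fr (fun i => c i - c' i)).
under eq_bigr do rewrite scalerBl.
rewrite sumrB; set x := \sum_i _; set y := \sum_i _.
rewrite -(subr_subl u); exact: subspaceB.
Qed.

End Basis.

(** Exchange: more vectors than spanning ones have a vanishing combination,
    read off from the kernel of the matrix of their coordinates. *)
Lemma free_le_span (V : lmodType K) (U W : set V) m r (g : 'I_m -> V)
    (b : 'I_r -> V) :
  subspace W -> spans_mod U W g -> (forall i, U (b i)) -> free_mod W b ->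
  (r <= m)%N.
Proof.
move=> Wsub sp Ub fr.
have /choice[A hA] : forall i, exists c : 'I_m -> K,
    W (b i - \sum_j c j *: g j) by move=> i; apply: sp.
pose M := \matrix_(i, j) A i j.
have /eqP kM : kermx M == 0.
  apply/rowV0P => u /sub_kermxP uM; apply/rowP => i; rewrite mxE.
  apply: (fr (fun i => u 0 i)).
  have -> : \sum_i u 0 i *: b i
          = \sum_i u 0 i *: (b i - \sum_j A i j *: g j).
    under [RHS]eq_bigr do rewrite scalerBr.
    rewrite sumrB [X in _ - X](_ : _ = 0) ?subr0 //.
    under eq_bigr do rewrite scaler_sumr.
    rewrite exchange_big big1 // => j _.
    under eq_bigr do rewrite scalerA.
    rewrite -scaler_suml; have /rowP/(_ j) := uM; rewrite !mxE.
    by under eq_bigr do rewrite mxE; move=> ->; rewrite scale0r.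
  exact: subspace_lin.
move/eqP: kM; rewrite kermx_eq0 => /eqP <-; exact: rank_leq_col.
Qed.

Lemma has_quot_dim_unique (V : lmodType K) (U W : set V) m m' :
  subspace U -> subspace W ->
  has_quot_dim U W m -> has_quot_dim U W m' -> m = m'.
Proof.
move=> Us Ws [b /(quot_basisP Us Ws)[Ub bs bf]].
move=> [c /(quot_basisP Us Ws)[Uc cs cf]].
by apply/eqP; rewrite eqn_leq (free_le_span Ws cs Ub) // (free_le_span Ws bs Uc).
Qed.

Lemma quot_dimE (V : lmodType K) (U W : set V) m :
  subspace U -> subspace W -> has_quot_dim U W m -> quot_dim U W = m.
Proof.
move=> Us Ws h; rewrite /quot_dim; case: xgetP => [m' _ h'|/(_ m)//].
exact: (has_quot_dim_unique Us Ws h' h).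
Qed.

(** A free family in U of maximal length spans U: adding any further vector
    creates a relation, which can be solved for that vector. *)
Lemma has_quot_dim_sub (V : lmodType K) (X U W : set V) m (g : 'I_m -> V) :
  subspace U -> subspace W -> U `<=` X -> spans_mod X W g ->
  exists r, has_quot_dim U W r.
Proof.
move=> Us Ws UX sp.
pose P r := `[< exists b : 'I_r -> V, (forall i, U (b i)) /\ free_mod W b >].
have P0 : exists r, P r.
  by exists 0%N; apply/asboolP; exists (fun=> 0); split=> [[]//|c _ []].
have Pm r : P r -> (r <= m)%N.
  move=> /asboolP[b [Ub fb]]; apply: (free_le_span Ws sp _ fb) => i.
  exact: UX.
case: (ex_maxnP P0 Pm) => r /asboolP[b [Ub fb]] max; exists r, b.
apply/(quot_basisP Us Ws); split=> // u Uu.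
pose b' (i : 'I_r.+1) := if unlift ord_max i is Some j then b j else u.
have nfb : ~ free_mod W b'.
  move=> fb'; have : P r.+1.
    apply/asboolP; exists b'; split=> // i.
    by rewrite /b'; case: unlift => //.
  by move/max; rewrite ltnn.
have [c [Wc [i0 ci0]]] : exists c : 'I_r.+1 -> K,
    W (\sum_i c i *: b' i) /\ exists i, c i <> 0.
  apply: contrapT => h; apply: nfb => c Wc i; apply: contrapT => ci.
  by apply: h; exists c; split=> //; exists i.
have e : \sum_i c i *: b' i
       = \sum_i c (lift ord_max i) *: b i + c ord_max *: u.
  rewrite big_ord_recr /= /b' unlift_none; congr (_ + _).
  apply: eq_bigr => i _; have -> : widen_ord (leqnSn r) i = lift ord_max i.
    by apply: val_inj; rewrite /= /bump leqNgt ltn_ord.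
  by rewrite liftK.
case: (eqVneq (c ord_max) 0) => cm.
  case: ci0; case: (unliftP ord_max i0) => [j ->|-> //].
  move: Wc; rewrite e cm scale0r addr0 => /fb; exact.
exists (fun i => - ((c ord_max)^-1 * c (lift ord_max i))).
have -> : u - \sum_i - ((c ord_max)^-1 * c (lift ord_max i)) *: b i
        = (c ord_max)^-1 *: (\sum_i c i *: b' i).
  rewrite e scalerDr scalerA mulVf // scale1r addrC -sumrN scaler_sumr.
  by congr (_ + _); apply: eq_bigr => i _; rewrite scaleNr opprK scalerA.
exact: subspaceZ.
Qed.

(** Here phi induces an isomorphism of U/W onto U'/W', along which bases are
    carried in both directions. *)
Section Transfer.
Variables (V V' : lmodType K) (phi : V -> V').
Variables (U W : set V) (U' W' : set V').
Hypotheses (Us : subspace U) (Ws : subspace W).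
Hypotheses (Us' : subspace U') (Ws' : subspace W').
Hypothesis phi_lin : linear phi.
Hypothesis phiU : forall u, U u -> U' (phi u).
Hypothesis phiW : forall u, U u -> W u <-> W' (phi u).
Hypothesis phi_surj : forall u', U' u' -> exists2 u, U u & W' (u' - phi u).

Lemma linear_fun0 : phi 0 = 0.
Proof.
have /eqP := phi_lin 1 0 0; rewrite !scale1r addr0 -{1}[phi 0]addr0.
by move/eqP/addrI => <-.
Qed.

Lemma linear_fun_comb m (c : 'I_m -> K) (b : 'I_m -> V) :
  phi (\sum_i c i *: b i) = \sum_i c i *: phi (b i).
Proof.
elim: m c b => [|m IH] c b; first by rewrite !big_ord0 linear_fun0.
by rewrite !big_ord_recl phi_lin IH.
Qed.

Lemma linear_funB u v : phi (u - v) = phi u - phi v.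
Proof. by rewrite addrC -scaleN1r phi_lin scaleN1r addrC. Qed.

Lemma has_quot_dim_image m : has_quot_dim U W m -> has_quot_dim U' W' m.
Proof.
move=> [b /(quot_basisP Us Ws)[Ub bs bf]]; exists (phi \o b).
apply/(quot_basisP Us' Ws'); split=> [i|u' Uu'|c].
- exact: phiU.
- have [u Uu Wu] := phi_surj Uu'; have [c Wc] := bs u Uu; exists c.
  rewrite -linear_fun_comb -(subrK (phi u) u') -addrA.
  apply: subspaceD => //; rewrite -linear_funB; apply/phiW => //.
  by apply: subspaceB => //; apply: subspace_lin.
- rewrite -linear_fun_comb => Wc; apply: bf; apply/phiW => //.
  exact: subspace_lin.
Qed.

Lemma has_quot_dim_preimage m : has_quot_dim U' W' m -> has_quot_dim U W m.
Proof.
move=> [b' /(quot_basisP Us' Ws')[Ub bs bf]].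
have /choice[b hb] : forall i, exists u, U u /\ W' (b' i - phi u).
  by move=> i; have [u ? ?] := phi_surj (Ub i); exists u.
exists b; apply/(quot_basisP Us Ws).
have comb (c : 'I_m -> K) :
    W' (\sum_i c i *: b' i - phi (\sum_i c i *: b i)).
  rewrite linear_fun_comb -sumrB.
  under eq_bigr do rewrite -scalerBr.
  by apply: subspace_lin => // i; case: (hb i).
have Uc (c : 'I_m -> K) : U (\sum_i c i *: b i).
  by apply: subspace_lin => // i; case: (hb i).
split=> [i|u Uu|c].
- by case: (hb i).
- have [c Wc] := bs _ (phiU Uu); exists c; apply/phiW; first exact: subspaceB.
  rewrite linear_funB -(subrK (\sum_i c i *: b' i) (phi u)) -addrA.
  exact: subspaceD.
- move=> /(phiW (Uc c)) Wc; apply: bf.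
  exact: (subspace_mod Ws' (comb c)).
Qed.

End Transfer.

Lemma has_quot_dim_add (V : lmodType K) (U X W : set V) a b :
  subspace U -> subspace X -> subspace W -> W `<=` X -> X `<=` U ->
  has_quot_dim U X a -> has_quot_dim X W b -> has_quot_dim U W (a + b).
Proof.
move=> Us Xs Ws WX XU [g /(quot_basisP Us Xs)[Ug gs gf]].
move=> [h /(quot_basisP Xs Ws)[Xh hs hf]].
pose k (i : 'I_(a + b)) := match fintype.split i with inl j => g j | inr j => h j end.
have kl j : k (lshift b j) = g j.
  by rewrite /k -[lshift b j]/(unsplit (inl j)) unsplitK.
have kr j : k (rshift a j) = h j.
  by rewrite /k -[rshift a j]/(unsplit (inr j)) unsplitK.
have ksum (c : 'I_(a + b) -> K) : \sum_i c i *: k i =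
    \sum_j c (lshift b j) *: g j + \sum_j c (rshift a j) *: h j.
  rewrite big_split_ord /=; congr (_ + _); apply: eq_bigr => j _.
    by rewrite kl.
  by rewrite kr.
exists k; apply/(quot_basisP Us Ws); split=> [i|u Uu|c].
- by rewrite /k; case: fintype.split => j //; apply: XU.
- have [c Xc] := gs u Uu; have [d Wd] := hs _ Xc.
  exists (fun i => match fintype.split i with inl j => c j | inr j => d j end).
  rewrite ksum opprD addrA; move: Wd; congr (W (_ - _ - _)).
    by apply: eq_bigr => j _; rewrite -[lshift b j]/(unsplit (inl j)) unsplitK.
  by apply: eq_bigr => j _; rewrite -[rshift a j]/(unsplit (inr j)) unsplitK.
- rewrite ksum => Wc.
  have cl : forall j, c (lshift b j) = 0.
    apply: gf.
    have := subspaceB Xs (WX _ Wc) (subspace_lin Xs (fun j => c (rshift a j)) Xh).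
    by rewrite addrK.
  have cr : forall j, c (rshift a j) = 0.
    apply: hf; move: Wc; rewrite big1 ?add0r // => j _.
    by rewrite cl scale0r.
  by move=> i; case: (split_ordP i) => j ->.
Qed.

Lemma has_quot_dim0 (V : lmodType K) (U W : set V) :
  subspace U -> subspace W -> U `<=` W -> has_quot_dim U W 0.
Proof.
move=> Us Ws UW; exists (fun=> 0); apply/(quot_basisP Us Ws).
split=> [[]//|u Uu|c _ []//]; exists (fun=> 0).
by rewrite big_ord0 subr0; apply: UW.
Qed.

Lemma has_quot_dim0_sub (V : lmodType K) (U W : set V) :
  subspace U -> subspace W -> has_quot_dim U W 0 -> U `<=` W.
Proof.
move=> Us Ws [b /(quot_basisP Us Ws)[_ sp _]] u /sp[c].
by rewrite big_ord0 subr0.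
Qed.

(** A pairing that identifies U'/W' with the dual of U/W: the dual basis
    provides the basis of U'/W'. *)
Lemma has_quot_dim_dual (V V' : lmodType K) (B : V' -> V -> K)
    (U W : set V) (U' W' : set V') m :
  subspace U -> subspace W -> subspace U' -> subspace W' ->
  (forall u', linear_for *%R (B u')) ->
  (forall u, linear_for *%R (B^~ u)) ->
  (forall u' w, U' u' -> U w -> W w -> B u' w = 0) ->
  (forall u', U' u' -> (forall u, U u -> B u' u = 0) <-> W' u') ->
  (forall l : V -> K,
     (forall a u v, U u -> U v -> l (a *: u + v) = a * l u + l v) ->
     (forall u, U u -> W u -> l u = 0) ->
     exists2 u', U' u' & forall u, U u -> B u' u = l u) ->
  has_quot_dim U W m -> has_quot_dim U' W' m.
Proof.
move=> Us Ws Us' Ws' Br Bl Bann Bnull Brep [b /(quot_basisP Us Ws)[Ub bs bf]].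
have B0 u' : B u' 0 = 0.
  have := Br u' 1 0 0; rewrite scale1r addr0 mul1r -{1}[B u' 0]addr0.
  by move/addrI.
have B0l u : B 0 u = 0.
  have := Bl u 1 0 0; rewrite scale1r addr0 mul1r -{1}[B 0 u]addr0.
  by move/addrI.
have Bsum u' k (e : 'I_k -> V) (d : 'I_k -> K) :
    B u' (\sum_i d i *: e i) = \sum_i d i * B u' (e i).
  elim: k e d => [|k IH] e d; first by rewrite !big_ord0.
  by rewrite !big_ord_recl Br IH.
have Bsuml u k (e : 'I_k -> V') (d : 'I_k -> K) :
    B (\sum_i d i *: e i) u = \sum_i d i * B (e i) u.
  elim: k e d => [|k IH] e d; first by rewrite !big_ord0.
  by rewrite !big_ord_recl Bl IH.
have BB u' u v : B u' (u - v) = B u' u - B u' v.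
  by rewrite addrC -scaleN1r Br mulN1r addrC.
have coord : forall u, exists c : {ffun 'I_m -> K},
    U u -> W (u - \sum_i c i *: b i).
  move=> u; have [Uu|nUu] := pselect (U u); last by exists [ffun=> 0].
  have [c Wc] := bs u Uu; exists [ffun i => c i] => _.
  by under eq_bigr do rewrite ffunE.
have [x hx] := choice coord.
have coordE u (c : 'I_m -> K) : U u -> W (u - \sum_i c i *: b i) ->
    forall i, x u i = c i.
  move=> Uu Wc i; apply/eqP; rewrite -subr_eq0; apply/eqP.
  apply: (bf (fun i => x u i - c i)).
  under eq_bigr do rewrite scalerBl.
  by rewrite sumrB -(subr_subl u); apply: subspaceB => //; apply: hx.
have xlin i a u v : U u -> U v -> x (a *: u + v) i = a * x u i + x v i.
  move=> Uu Uv; apply: (coordE _ (fun i => a * x u i + x v i)).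
    by apply: subspaceD => //; apply: subspaceZ.
  under eq_bigr do rewrite scalerDl -scalerA.
  rewrite big_split -scaler_sumr /= opprD addrACA -scalerBr.
  by apply: subspaceD => //; [apply: subspaceZ => //|]; apply: hx.
have xW i u : U u -> W u -> x u i = 0.
  move=> Uu Wu; apply: (coordE _ (fun=> 0)) => //.
  by rewrite big1 ?subr0 // => j _; rewrite scale0r.
have xb i j : x (b j) i = (i == j)%:R.
  apply: (coordE _ (fun i => (i == j)%:R)) => //.
  rewrite (bigD1 j) //= eqxx scale1r big1 ?addr0 ?subrr.
    exact: subspace0.
  by move=> k /negPf->; rewrite scale0r.
have /choice[b' hb'] : forall i, exists u', U' u' /\
    forall u, U u -> B u' u = x u i.
  move=> i; have [|u Uu Wu|u' Uu' hu'] := Brep (fun u => x u i).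
  - by move=> a u v Uu Uv; apply: xlin.
  - exact: xW.
  - by exists u'.
exists b'; apply/(quot_basisP Us' Ws'); split=> [i|u' Uu'|c Wc i].
- by case: (hb' i).
- exists (fun i => B u' (b i)); apply/Bnull.
    apply: subspaceB => //; apply: subspace_lin => // i.
    by case: (hb' i).
  move=> u Uu; rewrite addrC -scaleN1r Bl Bsuml mulN1r.
  have <- : B u' (\sum_i x u i *: b i) = B u' u.
    apply/eqP; rewrite eq_sym -subr_eq0 -BB; apply/eqP/Bann => //.
      by apply: subspaceB => //; apply: subspace_lin.
    exact: hx.
  rewrite Bsum; apply/eqP; rewrite addrC subr_eq0; apply/eqP; apply: eq_bigr => i _.
  by rewrite mulrC; case: (hb' i) => _ ->.
- have Uc : U' (\sum_i c i *: b' i).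
    by apply: subspace_lin => // j; case: (hb' j).
  have := (Bnull _ Uc).2 Wc (b i) (Ub i).
  rewrite Bsuml (bigD1 i) //= (hb' i).2 // xb eqxx mulr1 big1 ?addr0 //.
  by move=> j /negPf ji; rewrite (hb' j).2 // xb ji mulr0.
Qed.

End QuotientDimension.

(** * Hilbert's Nullstellensatz over an uncountable field *)

(** Uncountability in the form that the Nullstellensatz uses: a function to nat
    takes some value infinitely often. *)
Definition infinite_fiber (K : choiceType) : Prop :=
  forall N : K -> nat, exists k, forall m, exists s : m.-tuple K,
    uniq s /\ forall x, x \in s -> N x = k.

Section Ideals.
Variable A : comNzRingType.

Definition is_ideal (I : set A) : Prop :=
  [/\ I 0, forall p q, I p -> I q -> I (p + q) & forall a p, I p -> I (a * p)].

Section Closure.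
Variable I : set A.
Hypothesis Iid : is_ideal I.

Lemma ideal0 : I 0. Proof. by case: Iid. Qed.
Lemma idealD p q : I p -> I q -> I (p + q). Proof. by case: Iid => _ h _; apply: h. Qed.
Lemma idealM a p : I p -> I (a * p). Proof. by case: Iid => _ _; apply. Qed.
Lemma idealMr a p : I p -> I (p * a). Proof. by rewrite mulrC; apply: idealM. Qed.
Lemma idealN p : I p -> I (- p). Proof. by rewrite -mulN1r; apply: idealM. Qed.
Lemma idealB p q : I p -> I q -> I (p - q).
Proof. by move=> ? ?; apply: idealD => //; apply: idealN. Qed.
Lemma ideal_sum (T : Type) (r : seq T) (P : pred T) (F : T -> A) :
  (forall i, P i -> I (F i)) -> I (\sum_(i <- r | P i) F i).
Proof. by move=> h; elim/big_ind: _ => //; [exact: ideal0|exact: idealD]. Qed.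
Lemma ideal_mod p q : I (p - q) -> I q -> I p.
Proof. by move=> h Iq; rewrite -(subrK q p); apply: idealD. Qed.

Lemma ideal_congrM p p' q q' : I (p - p') -> I (q - q') -> I (p * q - p' * q').
Proof.
move=> hp hq; have -> : p * q - p' * q' = q * (p - p') + p' * (q - q') by ring.
by apply: idealD; apply: idealM.
Qed.

Lemma ideal_exp_le p k l : (k <= l)%N -> I (p ^+ k) -> I (p ^+ l).
Proof. by move=> /subnK <- h; rewrite exprD; apply: idealM. Qed.

End Closure.

(** Zorn's lemma for ideals that contain no power of g; the last clause is
    maximality, as Q + (p) must contain such a power. *)
Lemma maximal_avoiding (I : set A) (g : A) :
  is_ideal I -> (forall N, ~ I (g ^+ N)) ->
  exists Q : set A, [/\ is_ideal Q, I `<=` Q, forall N, ~ Q (g ^+ N) &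
    forall p, ~ Q p -> exists N q, Q (q * p - g ^+ N)].
Proof.
move=> Iid nI.
pose P := [set B : set A | is_ideal (B `|` I) /\ forall N, ~ (B `|` I) (g ^+ N)].
have [F FP Ftot|B [[Bid Bg] Bmax]] := @Zorn_bigcup A P.
  split; last first.
    by move=> N [[X FX XN]|/nI//]; case: (FP X FX) => _ /(_ N); apply; left.
  split=> [|p q|a p].
  - by right; apply: ideal0.
  - move=> [[X FX Xp]|Ip] [[Y FY Yq]|Iq].
    + have [XY|YX] := Ftot X Y FX FY.
        have [idY _] := FP Y FY.
        case: (idealD idY (or_introl (XY _ Xp)) (or_introl Yq)) => h;
          [by left; exists Y|by right].
      have [idX _] := FP X FX.
      case: (idealD idX (or_introl Xp) (or_introl (YX _ Yq))) => h;
        [by left; exists X|by right].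
    + have [idX _] := FP X FX.
      by case: (idealD idX (or_introl Xp) (or_intror Iq)) => h;
        [left; exists X|right].
    + have [idY _] := FP Y FY.
      by case: (idealD idY (or_intror Ip) (or_introl Yq)) => h;
        [left; exists Y|right].
    + by right; apply: idealD.
  - move=> [[X FX Xp]|Ip]; last by right; apply: idealM.
    have [idX _] := FP X FX.
    by case: (idealM idX a (or_introl Xp)) => h; [left; exists X|right].
exists (B `|` I); split=> // p nQp.
apply: contrapT => h.
pose C := [set x : A | exists q, (B `|` I) (x - q * p)].
have Cid : is_ideal C.
  split=> [|x y [q hq] [r hr]|a x [q hq]].
  - by exists 0; rewrite mul0r subr0; apply: ideal0.
  - exists (q + r); have -> : x + y - (q + r) * p = (x - q * p) + (y - r * p) by ring.
    exact: idealD.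
  - exists (a * q); rewrite -mulrA -mulrBr; exact: idealM.
have BC : B `|` I `<=` C.
  by move=> x Bx; exists 0; rewrite mul0r subr0.
have CI : C `|` I = C.
  by apply/seteqP; split=> x; [case=> // Ix; apply: BC; right|left].
apply: (Bmax C).
  split=> [x Bx|CB]; first by apply: BC; left.
  apply: nQp; left; apply: CB; exists 1; rewrite mul1r subrr; exact: ideal0.
split; rewrite CI // => N [q hq]; apply: h; exists N, q.
by rewrite -opprB; apply: idealN.
Qed.

End Ideals.

Definition msize_le (K : fieldType) n D : set {mpoly K[n]} := [set p | (msize p <= D)%N].

Lemma msize_le_span (K : fieldType) n D : exists m (e : 'I_m -> {mpoly K[n]}),
  spans_mod (@msize_le K n D) [set 0] e.
Proof.
pose m (i : 'I_#|{: 'X_{1..n < D}}|) : 'X_{1..n} :=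
  (enum_val i : 'X_{1..n < D}).
exists #|{: 'X_{1..n < D}}|, (fun i => 'X_[m i]) => p hp.
exists (fun i => p@_(m i)) => /=.
by rewrite {1}(mpolywE hp) (reindex _ (onW_bij _ (enum_val_bij _))) /= subrr.
Qed.

Section Nullstellensatz.
Variable K : closedFieldType.
Hypothesis Kunc : infinite_fiber K.
Variable n : nat.
Implicit Types (p g : {mpoly K[n]}).

Variables (g : {mpoly K[n]}) (Q : set {mpoly K[n]}).
Hypotheses (Qid : is_ideal Q) (Qg : forall N, ~ Q (g ^+ N)).
Hypothesis Qmax : forall p, ~ Q p -> exists N q, Q (q * p - g ^+ N).

(** Divisors of powers of g modulo Q are closed under products. *)
Lemma avoiding_prime p q : Q (p * q) -> Q p \/ Q q.
Proof.
move=> Qpq; apply: contrapT => /not_orP[/Qmax[N [a ha]] /Qmax[M [b hb]]].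
apply: (@Qg (N + M)); have := ideal_congrM Qid ha hb.
rewrite -exprD => h; rewrite -[_ ^+ _]opprK; apply: (idealN Qid).
apply: (ideal_mod Qid (q := - (a * p * (b * q)))).
  by rewrite opprK addrC.
apply: (idealN Qid); have -> : a * p * (b * q) = a * b * (p * q) by ring.
exact: idealM.
Qed.

Lemma avoiding_nonzero (c : K) : c != 0 -> ~ Q c%:MP.
Proof.
move=> c0 Qc; apply: (@Qg 0); rewrite expr0.
have -> : 1 = c^-1%:MP * c%:MP :> {mpoly K[n]} by rewrite -mpolyCM mulVf.
exact: idealM.
Qed.

(** A polynomial in p that lies in Q splits into linear factors p - b, one of
    which lies in the prime Q. *)
Lemma avoiding_root p (h : {poly K}) :
  h != 0 -> Q (map_poly (mpolyC n (R := K)) h).[p] -> exists b, Q (p - b%:MP).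
Proof.
move=> h0; have [r {1}->] := closed_field_poly_normal h.
rewrite map_polyZ hornerZ /= => /avoiding_prime[/avoiding_nonzero[]|].
  by rewrite lead_coef_eq0.
elim: r => [|b r IH].
  by rewrite big_nil rmorph1 hornerC => /(@avoiding_nonzero 1 (oner_neq0 _))[].
rewrite big_cons rmorphM hornerM => /avoiding_prime[] // Qb; exists b.
by move: Qb; rewrite rmorphB /= map_polyX map_polyC hornerXsubC.
Qed.

(** Were no p - a in Q, each would divide a power of g modulo Q.  Infinitely
    many of the quotients q_a share the exponent and a degree bound, hence are
    linearly dependent; clearing denominators in such a relation gives a nonzero
    polynomial in p that lies in Q. *)
Lemma avoiding_scalar p : exists a : K, Q (p - a%:MP).
Proof.
apply: contrapT => nex.
have /choice[w hw] : forall a : K, exists w : nat * {mpoly K[n]},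
    Q (w.2 * (p - a%:MP) - g ^+ w.1).
  move=> a; have [|N [q h]] := @Qmax (p - a%:MP); last by exists (N, q).
  by move=> h; apply: nex; exists a.
have [k hk] := Kunc (fun a => pickle ((w a).1, msize (w a).2)).
have [s1 [_ s1k]] := hk 1%N.
pose N := (w (tnth s1 ord0)).1; pose D := msize (w (tnth s1 ord0)).2.
have wND m (s : m.-tuple K) : (forall x, x \in s -> pickle ((w x).1, msize (w x).2) = k) ->
    forall i, (w (tnth s i)).1 = N /\ msize (w (tnth s i)).2 = D.
  move=> hs i; have := hs _ (mem_tnth i s); rewrite -(s1k _ (mem_tnth ord0 s1)).
  by move/(pcan_inj pickleK) => [-> ->].
have [m [e he]] := @msize_le_span K n D.
have [s [su sk]] := hk m.+1; have {}wND := wND _ _ sk.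
pose a := tnth s; pose q i := (w (a i)).2.
have ainj i j : a i = a j -> i = j.
  by move/eqP; rewrite /a !(tnth_nth 0) nth_uniq ?size_tuple // => /eqP/val_inj.
have [c [c0 [i0 ci0]]] : exists c : 'I_m.+1 -> K,
    \sum_i c i *: q i = 0 /\ exists i, c i <> 0.
  apply: contrapT => hc.
  have : (m.+1 <= m)%N.
    apply: (@free_le_span _ _ (@msize_le K n D) [set 0] _ _ e q) => //.
    - by split=> //= b u v -> ->; rewrite scaler0 addr0.
    - by move=> i; rewrite /msize_le /= (wND i).2.
    - move=> c c0 i; apply: contrapT => ci; apply: hc; exists c; split=> //.
      by exists i.
  by rewrite ltnn.
pose h : {poly K} := \sum_i c i *: \prod_(j | j != i) ('X - (a j)%:P).
have h0 : h != 0.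
  apply/eqP => /(congr1 (fun u => u.[a i0])); rewrite horner0 /h horner_sum.
  rewrite (bigD1 i0) //= [X in _ + X]big1 ?addr0 => [|i ii0].
    rewrite hornerZ horner_prod => /eqP; rewrite mulf_eq0; case/orP => [/eqP//|].
    rewrite prodf_seq_eq0 => /hasP[j _ /andP[ji]].
    by rewrite hornerXsubC subr_eq0 => /eqP/ainj/esym/eqP; rewrite (negPf ji).
  by rewrite hornerZ horner_prod (bigD1 i0) 1?eq_sym //= hornerXsubC subrr mul0r mulr0.
have hp : (map_poly (mpolyC n (R := K)) h).[p]
        = \sum_i c i *: \prod_(j | j != i) (p - (a j)%:MP).
  rewrite rmorph_sum /= horner_sum; apply: eq_bigr => i _.
  rewrite map_polyZ hornerZ /= mul_mpolyC; congr (_ *: _).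
  rewrite rmorph_prod /= horner_prod; apply: eq_bigr => j _.
  by rewrite rmorphB /= map_polyX map_polyC hornerXsubC.
have : Q ((map_poly (mpolyC n (R := K)) h).[p] * g ^+ N).
  have -> : (map_poly (mpolyC n (R := K)) h).[p] * g ^+ N =
      - \sum_i c i *: ((\prod_(j | j != i) (p - (a j)%:MP)) *
          (q i * (p - (a i)%:MP) - g ^+ N)).
    have z : \sum_i c i *: (\prod_(j | j != i) (p - (a j)%:MP) *
        (q i * (p - (a i)%:MP))) = 0.
      transitivity ((\prod_j (p - (a j)%:MP)) * \sum_i c i *: q i); last first.
        by rewrite c0 mulr0.
      rewrite mulr_sumr; apply: eq_bigr => i _.
      rewrite -scalerAr [in RHS](bigD1 i) //=; congr (_ *: _).
      by ring.
    under eq_bigr do rewrite mulrBr scalerBr.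
    rewrite sumrB z sub0r opprK hp mulr_suml.
    by apply: eq_bigr => i _; rewrite scalerAl.
  apply: (idealN Qid); apply: (ideal_sum Qid) => i _; rewrite -mul_mpolyC.
  by do 2!apply: (idealM Qid); rewrite -(wND i).1; apply: hw.
move/avoiding_prime => [|/Qg//] /(avoiding_root h0)[b Qb].
by apply: nex; exists b.
Qed.

(** Every coordinate is congruent to a scalar, so Q is the kernel of the
    evaluation at the point with these coordinates. *)
Lemma avoiding_point : exists v : 'I_n -> K, forall p, Q (p - (p.@[v])%:MP).
Proof.
have /choice[v hv] : forall i : 'I_n, exists a : K, Q ('X_i - a%:MP).
  by move=> i; apply: avoiding_scalar.
exists v; elim/mpolyind => [|c m p _ _ IH].
  by rewrite meval0 subrr; apply: ideal0.
rewrite mevalD mevalZ mpolyCD mpolyCM opprD addrACA -mul_mpolyC -mulrBr.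
apply: (idealD Qid) => //; apply: (idealM Qid).
rewrite mevalX mpolyXE_id rmorph_prod /=.
elim/big_ind2: _ => [|x x' y y'|i _].
- by rewrite subrr; apply: ideal0.
- exact: ideal_congrM.
- rewrite rmorphXn /=; elim: (m i) => [|k IHk].
    by rewrite !expr0 subrr; apply: ideal0.
  by rewrite !exprS; apply: ideal_congrM.
Qed.

End Nullstellensatz.

(** Otherwise an ideal maximal among those containing I but no power of g is the
    kernel of the evaluation at a zero of I, where g vanishes too. *)
Theorem nullstellensatz (K : closedFieldType) n (I : set {mpoly K[n]})
    (g : {mpoly K[n]}) :
  infinite_fiber K -> is_ideal I ->
  (forall v : 'I_n -> K, (forall p, I p -> p.@[v] = 0) -> g.@[v] = 0) ->
  exists N, I (g ^+ N).
Proof.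
move=> Kunc Iid gv; apply: contrapT => nI.
have [|Q [Qid IQ Qg Qmax]] := @maximal_avoiding _ _ g Iid.
  by move=> N IN; apply: nI; exists N.
have [v hv] := avoiding_point Kunc Qid Qg Qmax.
apply: (Qg 1%N); rewrite expr1 -[g]subr0 -[0]/(0%:MP) -(gv v) // => p Ip.
apply/eqP/negPn/negP => /(avoiding_nonzero Qid Qg); apply.
rewrite -[_%:MP]opprK -[X in - X](addKr p); apply/(idealN Qid)/(idealD Qid).
  by apply/(idealN Qid)/IQ.
exact: hv.
Qed.

(** Nested intervals avoiding the fibres one after the other. *)
Section Uncountable.
Variable R : realType.

Lemma avoid_finite (s : seq R) (a b : R) : a < b ->
  exists c : R * R, [/\ a <= c.1, c.1 < c.2, c.2 <= b &
    forall x, x \in s -> ~ (c.1 <= x <= c.2)].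
Proof.
elim: s a b => [|y s IH] a b ab; first by exists (a, b).
have [[c1 c2] /= [ac cc cb hc]] := IH _ _ ab.
have [yl|yl] := ltrP y ((c1 + c2) / 2).
  exists ((c1 + c2) / 2, c2) => /=; split=> //; try lra.
  move=> x; rewrite inE => /orP[/eqP->|/hc h]; first by lra.
  by move=> hx; apply: h; lra.
exists (c1, (c1 + c1 + c2) / 3) => /=; split=> //; try lra.
move=> x; rewrite inE => /orP[/eqP->|/hc h]; first by lra.
by move=> hx; apply: h; lra.
Qed.

Lemma finite_fibers_real (N : R -> nat) (s : nat -> seq R) :
  ~ forall x, x \in s (N x).
Proof.
move=> hs.
have /choice[c hc] : forall kab : nat * (R * R), exists c : R * R,
    kab.2.1 < kab.2.2 -> [/\ kab.2.1 <= c.1, c.1 < c.2, c.2 <= kab.2.2 &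
    forall x, x \in s kab.1 -> ~ (c.1 <= x <= c.2)].
  move=> [k [a b]] /=; have [ab|nab] := pselect (a < b); last by exists (a, b).
  by have [c h] := avoid_finite (s k) ab; exists c.
pose u := fix u k := if k is k'.+1 then c (k', u k') else (0, 1).
have ult k : (u k).1 < (u k).2.
  by elim: k => [|k IH] /=; [lra|case: (hc (k, u k) IH)].
have uS k : (u k).1 <= (u k.+1).1 /\ (u k.+1).2 <= (u k).2.
  by case: (hc (k, u k) (ult k)).
have um k l : (k <= l)%N -> (u k).1 <= (u l).1 /\ (u l).2 <= (u k).2.
  elim: l => [|l IH]; first by rewrite leqn0 => /eqP->; rewrite !lexx.
  rewrite leq_eqVlt => /orP[/eqP->|/IH]; first by rewrite !lexx.
  by have := uS l; lra.
pose E : set R := [set (u k).1 | k in setT].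
have ub k : forall x, E x -> x <= (u k).2.
  move=> _ [l _ <-]; case/orP: (leq_total k l) => /um; have := ult k; have := ult l; lra.
have supE : has_sup E.
  by split; [exists (u 0%N).1; exists 0%N|exists (u 0%N).2 => x; apply: ub].
pose x := sup E.
have [_ _ _ /(_ x (hs x))] := hc (N x, u (N x)) (ult (N x)); apply.
rewrite -[c _]/(u (N x).+1); apply/andP; split.
  by apply: (sup_ubound supE.2); exists (N x).+1.
by apply: ge_sup => [|y]; [case: supE|apply: ub].
Qed.

Lemma infinite_fiber_complex : infinite_fiber R[i].
Proof.
move=> N; apply: contrapT => h.
have /choice[s hs] : forall k, exists s : seq R, forall x : R, N x%:C%C = k -> x \in s.
  move=> k; apply: contrapT => hk; apply: h; exists k => m.
  have [s [su ss sk]] : exists s : seq R, [/\ uniq s, size s = m &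
      forall x, x \in s -> N x%:C%C = k].
    elim: m => [|m [s [su ss sk]]]; first by exists [::].
    have [x [xk xs]] : exists x, N x%:C%C = k /\ x \notin s.
      apply: contrapT => hx; apply: hk; exists s => x xk.
      by apply: contrapT => /negP xs; apply: hx; exists x.
    exists (x :: s); split=> /=; rewrite ?xs ?ss // => y.
    by rewrite inE => /orP[/eqP->|/sk].
  have sz : size [seq x%:C%C | x <- s] == m by rewrite size_map ss.
  exists (Tuple sz); split=> /=.
    by rewrite map_inj_uniq // => x y [].
  by move=> x /mapP[y ys ->]; apply: sk.
by apply: (@finite_fibers_real (fun x => N x%:C%C) s) => x; apply: hs.
Qed.

End Uncountable.

(** * Homogeneous polynomials and lines *)

Section Homogeneous.
Variables (K : fieldType) (n : nat).
Implicit Types (p : {mpoly K[n]}) (v : 'I_n -> K).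

Lemma meval_homog e p v t :
  p \is e.-homog -> p.@[fun i => t * v i] = t ^+ e * p.@[v].
Proof.
move=> /dhomogP hp; rewrite !mevalE mulr_sumr !big_seq; apply: eq_bigr => m mp.
rewrite mulrCA; congr (_ * _); under eq_bigr do rewrite exprMn.
rewrite big_split /=; congr (_ * _).
by rewrite prodrXr -mdegE (hp m mp).
Qed.

Lemma dhomog_mderiv e p i : p \is e.-homog -> p^`M(i) \is e.-1.-homog.
Proof.
move=> /dhomogP hp; apply/dhomogP => m; rewrite mcoeff_msupp mcoeff_deriv => h.
have mi : (m + U_(i))%MM \in msupp p.
  by rewrite mcoeff_msupp; apply: contraNneq h => ->; rewrite mul0rn.
have : mdeg (m + U_(i)) = e by apply: hp.
by rewrite mdegD mdeg1 addn1 => <-.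
Qed.

Lemma line_poly p v : exists P : {poly K}, forall t, P.[t] = p.@[fun i => t * v i].
Proof.
exists (mmap polyC (fun i => v i *: 'X) p) => t.
rewrite /mmap horner_sum mevalE; apply: eq_bigr => m _.
rewrite hornerM hornerC horner_prod; congr (_ * _); apply: eq_bigr => i _.
by rewrite horner_exp hornerZ hornerX mulrC.
Qed.

(** The 2x2 minors of (v, x), whose common zeros are the multiples of v. *)
Definition minor2 v (i j : 'I_n) : {mpoly K[n]} := v i *: 'X_j - v j *: 'X_i.

Lemma minor2_homog v i j : minor2 v i j \is 1.-homog.
Proof.
by apply: rpredB; apply: rpredZ; rewrite dhomogX; apply/eqP/mdeg1.
Qed.

Lemma minor2E v i j w : (minor2 v i j).@[w] = v i * w j - v j * w i.
Proof. by rewrite mevalB !mevalZ !mevalXU. Qed.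

Lemma minor2_line v i j t : (minor2 v i j).@[fun k => t * v k] = 0.
Proof. by rewrite minor2E; ring. Qed.

Lemma rV_neq0 (v : 'rV[K]_n) : v != 0 -> exists i, v ord0 i != 0.
Proof.
move=> v0; apply/existsP; apply: contraNT v0 => /existsPn h.
by apply/eqP/rowP => i; rewrite mxE; apply/eqP; have := h i; rewrite negbK.
Qed.

Lemma minor2_zero (v w : 'rV[K]_n) : v != 0 ->
  (forall i j, (minor2 (v ord0) i j).@[w ord0] = 0) -> exists t, w = t *: v.
Proof.
move=> /rV_neq0[i vi] h; exists (w ord0 i / v ord0 i); apply/rowP => j.
have /eqP := h i j; rewrite minor2E subr_eq0 !mxE => /eqP e.
by apply: (mulfI vi); rewrite e; field.
Qed.

Lemma row_scale (v : 'rV[K]_n) t : (t *: v) ord0 =1 (fun i => t * v ord0 i).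
Proof. by move=> i; rewrite mxE. Qed.

End Homogeneous.

Section SingularLines.
Variable K : closedFieldType.
Hypothesis Kunc : infinite_fiber K.
Variable n : nat.
Implicit Types (p q : {mpoly K[n]}) (v w : 'rV[K]_n).

Lemma field_infinite m : exists s : m.-tuple K, uniq s.
Proof. by have [k hk] := Kunc (fun=> 0%N); have [s [us _]] := hk m; exists s. Qed.

Lemma poly_fun_eq0 (P : {poly K}) : (forall t, P.[t] = 0) -> P = 0.
Proof.
move=> h; apply/eqP/negPn/negP => P0; have [s us] := field_infinite (size P).
have := max_poly_roots P0 (introT allP _) us; rewrite size_tuple ltnn.
by move=> f; apply: notF; apply: f => x _; apply/rootP.
Qed.

Definition vanish_on_line p v : Prop := forall t, p.@[(t *: v) ord0] = 0.

(** On a line polynomials restrict to univariate ones, over an infinite field. *)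
Lemma line_irreducible p q v :
  vanish_on_line (p * q) v -> vanish_on_line p v \/ vanish_on_line q v.
Proof.
move=> h; have [P hP] := line_poly p (v ord0); have [Q hQ] := line_poly q (v ord0).
have /eqP : P * Q = 0.
  apply: poly_fun_eq0 => t; rewrite hornerM hP hQ -mevalM.
  by rewrite -(h t); apply: meval_eq => i; rewrite mxE.
rewrite mulf_eq0 => /orP[/eqP z|/eqP z]; [left|right] => t.
  by rewrite (meval_eq _ (row_scale v t)) -hP z horner0.
by rewrite (meval_eq _ (row_scale v t)) -hQ z horner0.
Qed.

Lemma zariski_irreducible_point0 : zariski_irreducible [set (0 : 'rV[K]_n)].
Proof.
split; last first.
- move=> Y Z _ _ h; have [Y0|Z0] := h 0 erefl; [left|right]; by move=> _ ->.
- by exists 0.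
exists [set p | exists i, p = 'X_i]; apply/seteqP; split=> v /=.
  by move=> -> _ [i ->]; rewrite mevalXU mxE.
move=> h; apply/rowP => i; rewrite mxE; have := h 'X_i (ex_intro _ i erefl).
by rewrite mevalXU.
Qed.

Lemma closed_notin (Y : set 'rV[K]_n) v : zariski_closed Y -> ~ Y v ->
  exists2 p : {mpoly K[n]}, p.@[v ord0] <> 0 & forall w, Y w -> p.@[w ord0] = 0.
Proof.
move=> [S ->] /= h; apply: contrapT => h'; apply: h => p Sp.
by apply: contrapT => pv; apply: h'; exists p => // w; apply.
Qed.

Lemma zariski_irreducible_line v : v != 0 ->
  zariski_irreducible [set w | exists t, w = t *: v].
Proof.
move=> v0; split.
- exists [set p | exists i j, p = minor2 (v ord0) i j]; apply/seteqP; split=> w /=.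
    move=> [t ->] _ [i [j ->]]; rewrite (meval_eq _ (row_scale v t)).
    exact: minor2_line.
  by move=> h; apply: minor2_zero => // i j; apply: h; exists i, j.
- by exists 0, 0; rewrite scale0r.
move=> Y Z Yc Zc h; apply: contrapT => /not_orP[/existsNP[w /not_implyP[]]].
move=> [t ->] nY /existsNP[_ /not_implyP[[u ->] nZ]].
have [p pv pY] := closed_notin Yc nY; have [q qv qZ] := closed_notin Zc nZ.
have [s|/(_ t)//|/(_ u)//] := @line_irreducible p q v.
rewrite mevalM; case: (h (s *: v)); first by exists s.
  by move/pY => ->; rewrite mul0r.
by move/qZ => ->; rewrite mulr0.
Qed.

Variables (f : {mpoly K[n]}) (d : nat).
Hypothesis fhom : f \is d.-homog.

Lemma sing_locus_scale v t : sing_locus f v -> sing_locus f (t *: v).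
Proof.
move=> fv i; rewrite (meval_eq _ (row_scale v t)).
by rewrite (meval_homog _ _ (dhomog_mderiv i fhom)) fv mulr0.
Qed.

(** Otherwise fix an ultrafilter on the singular lines containing no single
    line.  The polynomials vanishing on almost all lines form a prime ideal,
    whose zero set is an irreducible cone in the singular locus that is not
    contained in a line, so that 0 < line < cone is too long a chain. *)
Theorem finite_proj_sing :
  zariski_dim_le (sing_locus f) 1 -> finite_set (proj_sing f).
Proof.
move=> dim1; apply: contrapT => Sinf; set S := proj_sing f in Sinf.
pose F : set_system {vspace 'rV[K]_n} := [set A | finite_set (S `\` A)].
have FF : ProperFilter F.
  apply: Build_ProperFilter_ex.
    move=> A FA; apply: contrapT => nA; apply: Sinf.
    apply: sub_finite_set FA => z Sz; split=> // Az; apply: nA; by exists z.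
  split.
  - by rewrite /F /= setDT.
  - move=> A B; rewrite /F /= => FA FB; rewrite setDIr.
    by rewrite finite_setU.
  - by move=> A B AB FA; apply: sub_finite_set FA => z [Sz nB]; split=> // /AB.
have [G [GU FG]] := ultraFilterLemma FF.
pose P : set {mpoly K[n]} :=
  [set p | G [set z : {vspace 'rV[K]_n} | forall v, v \in z -> p.@[v ord0] = 0]].
have GS : G S by apply: FG; rewrite /F /= setDv.
have Pid : is_ideal P.
  split.
  - by apply: filterE => z v _; rewrite meval0.
  - move=> p q; apply: filterS2 => z hp hq v vz.
    by rewrite mevalD hp // hq // addr0.
  - by move=> a p; apply: filterS => z hp v vz; rewrite mevalM hp // mulr0.
have Pprime p q : P (p * q) -> P p \/ P q.
  move=> Ppq; have [|nPp] := in_ultra_setVsetC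
    [set z : {vspace 'rV[K]_n} | forall v, v \in z -> p.@[v ord0] = 0] GU.
    by left.
  right; apply: filterS3 GS Ppq nPp => z [w [_ w0] <-] pq np v.
  have [h|h|] := @line_irreducible p q w.
  - by apply: pq; apply/vlineP; exists h.
  - by case: np => u /vlineP[t ->]; apply: h.
  - by move=> h /vlineP[t ->]; apply: h.
have PprimeX p N : P (p ^+ N) -> P p.
  elim: N => [|N IH]; last by rewrite exprS => /Pprime[].
  rewrite expr0 => P1; rewrite -[p]mulr1; exact: (idealM Pid).
pose V : set 'rV[K]_n := [set v | forall p, P p -> p.@[v ord0] = 0].
have Pnull p : (forall v, V v -> p.@[v ord0] = 0) -> P p.
  move=> h; have [|N /PprimeX//] := nullstellensatz (g := p) Kunc Pid.
  move=> v hv; have e : v =1 (\row_i v i) ord0 by move=> i; rewrite mxE.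
  by rewrite (meval_eq _ e); apply: h => q Pq; rewrite -(meval_eq _ e); apply: hv.
have Vcone v t : V v -> V (t *: v).
  move=> Vv p Pp; pose pt := p \mPo [tuple t *: 'X_i | i < n].
  have ptE w : pt.@[w ord0] = p.@[(t *: w) ord0].
    rewrite comp_mpoly_meval; apply: meval_eq => i.
    by rewrite tnth_mktuple mevalZ mevalXU mxE.
  rewrite -ptE; apply: Vv; apply: filterS Pp => z hp w wz; rewrite ptE; apply: hp.
  exact: memvZ.
have V0 : V 0.
  move=> p Pp; have [z hz] := filter_ex Pp; apply: hz; exact: mem0v.
have VX : V `<=` sing_locus f.
  move=> v Vv i; apply: Vv; apply: filterS GS => z [w [fw _] <-] u /vlineP[t ->].
  exact: sing_locus_scale.
have Vbig v : v != 0 -> exists2 w, V w & ~ exists t, w = t *: v.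
  move=> v0; apply: contrapT => h.
  have Pm i j : P (minor2 (v ord0) i j).
    apply: Pnull => w Vw; have [t ->] : exists t, w = t *: v.
      by apply: contrapT => nw; apply: h; exists w.
    by rewrite (meval_eq _ (row_scale v t)) minor2_line.
  have GP : G [set z : {vspace 'rV[K]_n} |
      forall i j w, w \in z -> (minor2 (v ord0) i j).@[w ord0] = 0].
    by apply: filter_forall => i; apply: filter_forall => j; apply: Pm.
  have : G (S `\ <[v]>%VS).
    apply: FG; rewrite /F /= setDD.
    by apply: sub_finite_set (finite_set1 <[v]>%VS) => z [].
  move=> GD; have [z [hz [[w [_ w0] wz] nz]]] := filter_ex (filterI GP GD).
  apply: nz => /=; rewrite -wz; have [t wt] : exists t, w = t *: v.
    by apply: minor2_zero => // i j; apply: hz; rewrite -wz memv_line.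
  have t0 : t != 0 by apply/eqP => t0; apply: w0; rewrite wt t0 scale0r.
  apply/eqP; rewrite eqEsubv -!memvE; apply/andP; split; apply/vlineP.
    by exists t.
  by exists t^-1; rewrite wt scalerA mulVf // scale1r.
have [v Vv v0] : exists2 v, V v & v != 0.
  apply: contrapT => h; have PX i : P 'X_i.
    apply: Pnull => v Vv; rewrite mevalXU.
    have -> : v = 0 by apply: contrapT => /eqP v0; apply: h; exists v.
    by rewrite mxE.
  have GP : G [set z : {vspace 'rV[K]_n} |
      forall i w, w \in z -> ('X_i : {mpoly K[n]}).@[w ord0] = 0].
    by apply: filter_forall => i; apply: PX.
  have [z [hz [w [_ w0] wz]]] := filter_ex (filterI GP GS).
  apply: w0; apply/rowP => i; rewrite mxE; have := hz i w.
  by rewrite mevalXU -wz memv_line; apply.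
have [w Vw nw] := Vbig v v0.
apply: dim1; exists (fun i => match i with
  | 0%N => [set 0] | 1%N => [set w | exists t, w = t *: v] | _ => V end).
split=> [[|[|i]] //= _|[|[|i]] //= _].
- split; first exact: zariski_irreducible_point0.
  by move=> _ ->; apply: VX.
- split; first exact: zariski_irreducible_line.
  by move=> _ [t ->]; apply/VX/Vcone.
- split=> //; split; first by exists P.
    by exists 0.
  move=> Y Z Yc Zc h; apply: contrapT => /not_orP[/existsNP[u /not_implyP[Vu nY]]].
  move=> /existsNP[u' /not_implyP[Vu' nZ]].
  have [p pu pY] := closed_notin Yc nY; have [q qu qZ] := closed_notin Zc nZ.
  have [|Pp|Pq] := Pprime p q.
  + apply: Pnull => x /h[/pY|/qZ] e; rewrite mevalM e ?mul0r ?mulr0 //.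
  + exact/pu/Vu.
  + exact/qu/Vu'.
- split=> [_ ->|h]; first by exists 0; rewrite scale0r.
  by move/eqP: v0; apply; apply: h; exists 1; rewrite scale1r.
- split=> [_ [t ->]|h]; first exact: Vcone.
  by apply: nw; apply: h.
Qed.

End SingularLines.

(** * Homogeneous ideals and a general linear form *)

Section HomogeneousComponents.
Variables (K : fieldType) (n : nat).
Implicit Types (p q : {mpoly K[n]}).

Notation pih k := (pihomog (@mdeg n) k).

Lemma pihomog_homogM k e p q : q \is e.-homog -> pih (k + e)%N (p * q) = pih k p * q.
Proof.
move=> qe; rewrite [in LHS](pihomog_partitionE (k := maxn (msize p) k.+1) (mf := @mdeg n)
  (p := p)); last exact: leq_maxl.
rewrite mulr_suml raddf_sum /= (bigD1 (Ordinal (leq_maxr (msize p) k.+1))) //=.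
rewrite big1 ?addr0 => [|i ik].
  by rewrite pihomog_dE // dhomogM // pihomogP.
apply: (@pihomog_ne0 _ _ _ (i + e)%N); last by rewrite dhomogM // pihomogP.
by rewrite eqn_add2r.
Qed.

Lemma pihomog_homogM_lt k e p q : (k < e)%N -> q \is e.-homog -> pih k (p * q) = 0.
Proof.
move=> ke qe; rewrite [in LHS](pihomog_partitionE (k := msize p) (mf := @mdeg n)
  (p := p)) //.
rewrite mulr_suml raddf_sum /= big1 // => i _.
apply: (@pihomog_ne0 _ _ _ (i + e)%N); last by rewrite dhomogM // pihomogP.
by rewrite neq_ltn (leq_trans ke) ?leq_addl ?orbT.
Qed.

Definition homog_part k : set {mpoly K[n]} := [set p | p \is k.-homog].

Lemma homog_part_subspace k : subspace (homog_part k).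
Proof.
by split=> [|a u v hu hv]; [exact: rpred0|apply: rpredD => //; apply: rpredZ].
Qed.

Lemma ideal_subspace (I : set {mpoly K[n]}) : is_ideal I -> subspace I.
Proof.
move=> Iid; split=> [|a u v Iu Iv]; first exact: ideal0.
by apply: idealD => //; rewrite -mul_mpolyC; apply: idealM.
Qed.

Lemma homog_quot_dim k (U W : set {mpoly K[n]}) :
  subspace U -> subspace W -> U `<=` homog_part k -> exists r, has_quot_dim U W r.
Proof.
move=> Us Ws Uk; have [m [e he]] := @msize_le_span K n k.+1.
apply: (has_quot_dim_sub Us Ws (X := @msize_le K n k.+1) _ (g := e)).
  move=> p /Uk /dhomogP hp; rewrite /msize_le /= msizeE big_seq.
  by elim/big_ind: _ => // [x y hx hy|m' /hp /= ->//]; rewrite geq_max hx.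
by move=> p /he[c /= hc]; exists c; rewrite hc; apply: subspace0.
Qed.

Lemma has_quot_dim_ext (V : lmodType K) (U W W' : set V) m :
  subspace U -> subspace W -> subspace W' -> (forall u, U u -> W u <-> W' u) ->
  has_quot_dim U W m -> has_quot_dim U W' m.
Proof.
move=> Us Ws Ws' h; apply: (has_quot_dim_image (phi := id)) => // u Uu.
by exists u => //; rewrite subrr; apply: subspace0.
Qed.

End HomogeneousComponents.

Section GeneratedIdeal.
Variables (A : comNzRingType) (r : nat) (g : 'I_r -> A).

Definition gen_ideal : set A := [set p | exists h, p = \sum_i h i * g i].

Lemma gen_ideal_ideal : is_ideal gen_ideal.
Proof.
split=> [|_ _ [h ->] [h' ->]|a _ [h ->]].
- by exists (fun=> 0); rewrite big1 // => i _; rewrite mul0r.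
- exists (fun i => h i + h' i); rewrite -big_split; apply: eq_bigr => i _.
  by rewrite mulrDl.
- exists (fun i => a * h i); rewrite mulr_sumr; apply: eq_bigr => i _.
  by rewrite mulrA.
Qed.

Lemma gen_ideal_gen i : gen_ideal (g i).
Proof.
exists (fun j => (j == i)%:R); rewrite (bigD1 i) //= eqxx mul1r big1 ?addr0 // => j.
by move=> /negPf->; rewrite mul0r.
Qed.

End GeneratedIdeal.

Section GeneralLinearForm.
Variable K : closedFieldType.
Hypothesis Kunc : infinite_fiber K.
Variable n : nat.
Implicit Types (p q : {mpoly K[n]}) (v w : 'rV[K]_n).

(** The form with coefficients 1, t, t^2, ... takes at v a value polynomial in t,
    so that all but finitely many t will do. *)
Lemma avoiding_linear_form (s : seq 'rV[K]_n) : (forall v, v \in s -> v != 0) ->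
  exists2 l : {mpoly K[n]}, l \is 1.-homog & forall v, v \in s -> l.@[v ord0] != 0.
Proof.
move=> s0; pose P v : {poly K} := \poly_(i < n) (if insub i is Some j then v ord0 j else 0).
have PE v t : (P v).[t] = \sum_(i < n) v ord0 i * t ^+ i.
  rewrite horner_poly; apply: eq_bigr => i _.
  by rewrite insubT //= => lt; congr (v _ _ * _); apply: val_inj.
have Pn0 v : v != 0 -> P v != 0.
  move=> /rV_neq0[i vi]; apply: contraNneq vi => /polyP/(_ i).
  rewrite coef_poly ltn_ord coef0 insubT //= => lt <-; apply/eqP.
  by congr (v _ _); apply: val_inj.
have [t ht] : exists t, (\prod_(v <- s) P v).[t] != 0.
  apply: contrapT => h; have : \prod_(v <- s) P v = 0.
    apply: (poly_fun_eq0 Kunc) => t; apply/eqP/negPn/negP => ht.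
    by apply: h; exists t.
  by move/eqP; rewrite prodf_seq_eq0 => /hasP[v vs /=]; apply/negP/Pn0/s0.
exists (\sum_(i < n) t ^+ i *: 'X_i).
  by apply: rpred_sum => i _; apply: rpredZ; rewrite dhomogX; apply/eqP/mdeg1.
move=> v vs; apply: contraNneq ht => lv; rewrite horner_prod.
rewrite prodf_seq_eq0; apply/hasP; exists v => //=; apply/eqP.
rewrite PE -[RHS]lv raddf_sum; apply: eq_bigr => i _.
by rewrite /= mevalZ mevalXU mulrC.
Qed.

Variables (g : 'I_n -> {mpoly K[n]}) (e : nat).
Hypothesis ghom : forall i, g i \is e.-homog.

Local Notation J := (gen_ideal g).
Local Notation Jid := (gen_ideal_ideal g).
Local Notation pih k := (pihomog (@mdeg n) k).
Local Notation R := (@homog_part K n).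

Lemma gen_ideal_pihomog p k : J p -> J (pih k p).
Proof.
move=> [h ->]; rewrite raddf_sum /=; apply: (ideal_sum Jid) => i _.
have [ke|ek] := ltnP k e.
  by rewrite (pihomog_homogM_lt _ ke (ghom i)); apply: (ideal0 Jid).
rewrite -(subnK ek) (pihomog_homogM _ _ (ghom i)).
exact/(idealM Jid)/gen_ideal_gen.
Qed.

Variable l : {mpoly K[n]}.
Hypothesis lhom : l \is 1.-homog.
Hypothesis lJ : forall v, (forall i, (g i).@[v ord0] = 0) -> l.@[v ord0] = 0 -> v = 0.

Lemma lin_exp_homog s : l ^+ s \is s.-homog.
Proof. by have := dhomogMn s lhom; rewrite mul1n. Qed.

(** The ideal (g, l^s), described modulo (g) so that the coefficient of l^s is
    at hand. *)
Definition slice_ideal s : set {mpoly K[n]} := [set p | exists h, J (p - h * l ^+ s)].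

Lemma slice_ideal_ideal s : is_ideal (slice_ideal s).
Proof.
split=> [|p q [h hp] [h' hq]|a p [h hp]].
- by exists 0; rewrite mul0r subr0; apply: (ideal0 Jid).
- exists (h + h'); have -> : p + q - (h + h') * l ^+ s
      = (p - h * l ^+ s) + (q - h' * l ^+ s) by ring.
  exact: (idealD Jid).
- by exists (a * h); rewrite -mulrA -mulrBr; apply: (idealM Jid).
Qed.

Lemma slice_ideal_sub s : J `<=` slice_ideal s.
Proof. by move=> p Jp; exists 0; rewrite mul0r subr0. Qed.

Lemma slice_ideal_exp s p : slice_ideal s (p * l ^+ s).
Proof. by exists p; rewrite subrr; apply: (ideal0 Jid). Qed.

(** Each coordinate vanishes at the only possible zero of the ideal. *)
Lemma primary_exp (I : set {mpoly K[n]}) : is_ideal I ->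
  (forall v : 'rV[K]_n, (forall p, I p -> p.@[v ord0] = 0) -> v = 0) ->
  exists N, forall i, I ('X_i ^+ N).
Proof.
move=> Iid I0; have /choice[N hN] : forall i : 'I_n, exists N, I ('X_i ^+ N).
  move=> i; apply: nullstellensatz => // v hv; rewrite mevalXU.
  have ev : v =1 (\row_i v i) ord0 by move=> j; rewrite mxE.
  have z : \row_i v i = 0 :> 'rV[K]_n.
    by apply: I0 => p Ip; rewrite -(meval_eq _ ev); apply: hv.
  by have /rowP/(_ i) := z; rewrite !mxE.
exists (\sum_i N i)%N => i; apply: (ideal_exp_le Iid _ (hN i)).
by rewrite (bigD1 i) //= leq_addr.
Qed.

Lemma slice_primary s : exists N, forall i, slice_ideal s ('X_i ^+ N).
Proof.
apply: primary_exp => [|v hv]; first exact: slice_ideal_ideal.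
apply: lJ => [i|]; first by apply/hv/slice_ideal_sub/gen_ideal_gen.
have := hv _ (slice_ideal_exp s 1); rewrite mul1r rmorphXn /= => /eqP.
by rewrite expf_eq0 => /andP[_ /eqP].
Qed.

(** A monomial of degree at least n N is divisible by some x_i^N. *)
Lemma primary_homog (I : set {mpoly K[n]}) N : is_ideal I ->
  (forall i, I ('X_i ^+ N)) -> forall p,
  (forall m, m \in msupp p -> (n * N <= mdeg m)%N) -> (0 < n)%N -> I p.
Proof.
move=> Iid IN p hp n0; rewrite (mpolyE p) big_seq; apply: (ideal_sum Iid) => m mp.
have [i Ni] : exists i, (N <= m i)%N.
  apply: contrapT => h; have := hp m mp; apply/negP; rewrite -ltnNge mdegE.
  have lt i : (m i < N)%N.
    by rewrite ltnNge; apply/negP => Ni; apply: h; exists i.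
  case: N lt {IN hp h} => [|N] lt; first by have := lt (Ordinal n0).
  apply: (@leq_ltn_trans (n * N)%N); last by rewrite ltn_pmul2l.
  have -> : (n * N = \sum_(i < n) N)%N by rewrite sum_nat_const card_ord.
  by apply: leq_sum => i _; apply: lt.
rewrite -mul_mpolyC; apply: (idealM Iid).
rewrite -(submK (m := (U_(i) *+ N)%MM) (m' := m)); last first.
  apply/mnm_lepP => j; rewrite mulmnE mnm1E; case: eqP => [<-|]; by rewrite ?mul1n.
by rewrite mpolyXD -mpolyXn; apply: (idealM Iid).
Qed.

Lemma slice_bound s : (0 < n)%N ->
  exists D, forall k p, (D <= k)%N -> p \is k.-homog -> slice_ideal s p.
Proof.
move=> n0; have [N hN] := slice_primary s; exists (n * N)%N => k p Dk /dhomogP pk.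
by apply: (primary_homog (slice_ideal_ideal s) hN) => // m /pk /= ->.
Qed.

Lemma lin_surj : (0 < n)%N -> exists D, forall k, (D <= k)%N ->
  forall p, R k.+1 p -> exists2 q, R k q & J (p - q * l).
Proof.
move=> n0; have [D hD] := slice_bound 1 n0; exists D => k Dk p pk.
have [h /(gen_ideal_pihomog k.+1)] := hD _ _ (leqW Dk) pk.
rewrite raddfB /= pihomog_dE // expr1 -[k.+1 in X in _ - X]addn1 pihomog_homogM //.
by move=> Jp; exists (pih k h) => //; apply: pihomogP.
Qed.

Definition colon_lin s : set {mpoly K[n]} := [set p | J (p * l ^+ s)].

Lemma colon_lin_ideal s : is_ideal (colon_lin s).
Proof.
split=> [|p q hp hq|a p hp]; rewrite /colon_lin /=.
- by rewrite mul0r; apply: (ideal0 Jid).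
- by rewrite mulrDl; apply: (idealD Jid).
- by rewrite -mulrA; apply: (idealM Jid).
Qed.

(** Multiplication by l is eventually surjective on R/J; the dimensions of the
    graded pieces then decrease, hence are eventually constant, and
    multiplication by l is eventually injective too. *)
Theorem lin_eventually_bij : (0 < n)%N -> exists k0 tau,
  (forall k, (k0 <= k)%N -> has_quot_dim (R k) J tau) /\
  (forall k s p, (k0 <= k)%N -> R k p -> J (p * l ^+ s) -> J p) /\
  (forall k s p, (k0 <= k)%N -> R (k + s) p -> exists2 q, R k q & J (p - q * l ^+ s)).
Proof.
move=> n0; have [D hD] := lin_surj n0.
have Js := ideal_subspace Jid; have Rs := @homog_part_subspace K n.
have Cs := ideal_subspace (colon_lin_ideal 1).
have /choice[H hH] : forall k, exists m, has_quot_dim (R k) J m.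
  by move=> k; apply: (@homog_quot_dim K n k) => // p.
have step k : (D <= k)%N -> exists2 b,
    has_quot_dim (R k `&` colon_lin 1) (R k `&` J) b & H k = (H k.+1 + b)%N.
  move=> Dk; have RCs := subspaceI (Rs k) Cs; have RJs := subspaceI (Rs k) Js.
  have [|b hb] := @homog_quot_dim K n k _ _ RCs RJs; first by move=> p [].
  exists b => //; apply: (has_quot_dim_unique (Rs k) RJs).
    by apply: has_quot_dim_ext (hH k) => // u Ru; split=> [|[]].
  apply: has_quot_dim_add hb => //.
    by move=> p [Rp Jp]; split=> //; exact: (idealMr Jid).
  apply: (has_quot_dim_ext (W := colon_lin 1)) => //.
    by move=> u Ru; split=> [|[]].
  apply: (has_quot_dim_preimage (phi := fun p => p * l)) (hH k.+1) => //.
  - by move=> a u v; rewrite mulrDl scalerAl.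
  - by move=> u Ru; rewrite /homog_part /= -addn1; apply: dhomogM.
  - by move=> p /(hD _ Dk)[q Rq Jq]; exists q.
have exP : exists m, `[< exists2 k, (D <= k)%N & H k = m >].
  by exists (H D); apply/asboolP; exists D.
case: (ex_minnP exP) => tau /asboolP[k0 Dk0 Hk0] min.
have Hle k : (k0 <= k)%N -> H k = tau.
  elim: k => [|k IH]; first by rewrite leqn0 => /eqP k00; rewrite -k00.
  rewrite leq_eqVlt => /orP[/eqP<-//|kk]; apply/eqP; rewrite eqn_leq.
  have Dk := leq_trans Dk0 kk; have [b _ Hb] := step k Dk.
  rewrite -[X in (_ <= X)%N && _](IH kk) Hb leq_addr /= min //; apply/asboolP.
  by exists k.+1 => //; apply: leqW.
exists k0, tau; split=> [k kk|]; first by rewrite -(Hle k kk); apply: hH.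
split=> k s p kk; last first.
  elim: s p => [|s IH] p.
    by rewrite addn0 => Rp; exists p; rewrite // expr0 mulr1 subrr; apply: (ideal0 Jid).
  rewrite addnS => /(hD _ (leq_trans Dk0 (leq_trans kk (leq_addr s k))))[p' Rp' Jp'].
  have [q Rq Jq] := IH _ Rp'; exists q => //.
  have -> : p - q * l ^+ s.+1 = (p - p' * l) + (p' - q * l ^+ s) * l by rewrite exprSr; ring.
  by apply: (idealD Jid) => //; apply: (idealMr Jid).
elim: s k p kk => [|s IH] k p kk Rp; first by rewrite expr0 mulr1.
rewrite exprS mulrA => /IH hJ; have {hJ} Jpl : J (p * l).
  by apply: (hJ k.+1); [exact: leqW|rewrite /homog_part /= -addn1; apply: dhomogM].
have [b hb] := step k (leq_trans Dk0 kk).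
rewrite !Hle ?(leqW kk) // -[LHS]addn0 => /addnI b0; rewrite -b0 in hb.
have := has_quot_dim0_sub (subspaceI (Rs k) Cs) (subspaceI (Rs k) Js) hb.
by case/(_ p) => //; split=> //; rewrite /colon_lin /= expr1.
Qed.

End GeneralLinearForm.

(** * Formal Laurent series and the Koszul complex *)

Section Laurent.
Variables (K : fieldType) (n : nat).

(** No condition is put on the support: a polynomial has finitely many terms,
    hence still acts. *)
Definition laurent : Type := ('I_n -> int) -> K^o.
HB.instance Definition _ := GRing.Lmodule.on laurent.

Implicit Types (p q : {mpoly K[n]}) (u v : laurent) (a : 'I_n -> int).

Lemma laurentD u v a : (u + v) a = u a + v a :> K. Proof. by []. Qed.
Lemma laurentZ c u a : (c *: u) a = c * u a :> K. Proof. by []. Qed.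

Definition shift (m : 'X_{1..n}) a : 'I_n -> int := fun i => a i - (m i)%:Z.

Definition act p u : laurent :=
  fun a => \sum_(m <- msupp p) p@_m * u (shift m a).

Lemma actE k p u a : (msize p <= k)%N ->
  act p u a = \sum_(m : 'X_{1..n < k}) p@_m * u (shift m a).
Proof.
move=> le_pk; rewrite /act.
pose I : subFinType _ := 'X_{1..n < k}.
rewrite (big_mksub I) //=; first last.
- by move=> x /msize_mdeg_lt /leq_trans; apply.
- by rewrite msupp_uniq.
rewrite big_rmcond //= => i /memN_msupp_eq0 ->; by rewrite mul0r.
Qed.

Lemma act_is_linear p : linear (act p).
Proof.
move=> c u v; apply/funext => a; rewrite laurentD laurentZ /act.
rewrite mulr_sumr -big_split; apply: eq_bigr => m _ /=.
by rewrite laurentD laurentZ mulrDr mulrCA.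
Qed.
HB.instance Definition _ p :=
  GRing.isLinear.Build K laurent laurent _ (act p) (act_is_linear p).

Lemma actuZ p c u : act p (c *: u) = c *: act p u.
Proof. by rewrite -[c *: u]addr0 act_is_linear raddf0 addr0. Qed.

Lemma actD p q u : act (p + q) u = act p u + act q u.
Proof.
apply/funext => a; set k := maxn (msize (p + q)) (maxn (msize p) (msize q)).
rewrite laurentD !(@actE k) /k ?leq_max ?leqnn ?orbT //.
by rewrite -big_split; apply: eq_bigr => m _; rewrite mcoeffD mulrDl.
Qed.

Lemma act0 u : act 0 u = 0.
Proof. by apply/funext => a; rewrite /act msupp0 big_nil. Qed.

Lemma actZ c p u : act (c *: p) u = c *: act p u.
Proof.
apply/funext => a; set k := maxn (msize (c *: p)) (msize p).
rewrite laurentZ !(@actE k) /k ?leq_max ?leqnn ?orbT //.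
by rewrite mulr_sumr; apply: eq_bigr => m _; rewrite mcoeffZ mulrA.
Qed.

Lemma actX m u a : act 'X_[m] u a = u (shift m a).
Proof. by rewrite /act msuppX big_seq1 mcoeffX eqxx mul1r. Qed.

Lemma shiftD m m' a : shift m (shift m' a) = shift (m + m')%MM a.
Proof. by apply/funext => i; rewrite /shift mnmDE PoszD; ring. Qed.

Lemma actM p q u : act (p * q) u = act p (act q u).
Proof.
elim/mpolyind: p => [|c m p _ _ IH]; first by rewrite mul0r !act0.
rewrite mulrDl !actD IH -scalerAl !actZ; congr (_ *: _ + _).
elim/mpolyind: q {IH} => [|c' m' q _ _ IHq]; first by rewrite mulr0 !act0 raddf0.
rewrite mulrDr !actD raddfD /= IHq -scalerAr !actZ actuZ; congr (_ *: _ + _).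
by apply/funext => a; rewrite -mpolyXD !actX shiftD addmC.
Qed.

Lemma actC p q u : act p (act q u) = act q (act p u).
Proof. by rewrite -!actM mulrC. Qed.

Lemma act_sum (I : Type) (r : seq I) (P : pred I) (F : I -> {mpoly K[n]}) u :
  act (\sum_(i <- r | P i) F i) u = \sum_(i <- r | P i) act (F i) u.
Proof.
by elim/big_rec2: _ => [|i x y _ <-]; rewrite ?act0 ?actD.
Qed.

End Laurent.
Arguments act {K n} p u.

Section Unshift.
Variables (K : fieldType) (n : nat) (i : 'I_n) (N : nat).

Definition unshift (u : laurent K n) : laurent K n :=
  fun a => u (fun j => a j + ((U_(i) *+ N)%MM j)%:Z).

Lemma unshift_is_linear : linear unshift.
Proof. by []. Qed.
HB.instance Definition _ :=
  GRing.isLinear.Build K (laurent K n) (laurent K n) _ unshift unshift_is_linear.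

Lemma act_unshift p u : act p (unshift u) = unshift (act p u).
Proof.
apply/funext => a; rewrite /unshift /act; apply: eq_bigr => m _.
by congr (_ * u _); apply/funext => j; rewrite /shift addrAC.
Qed.

Lemma unshift_actX u : unshift (act ('X_i ^+ N) u) = u.
Proof.
apply/funext => a; rewrite /unshift mpolyXn actX; congr (u _).
by apply/funext => j; rewrite /shift addrK.
Qed.

End Unshift.
Arguments unshift {K n} i N u.

Section KoszulComplex.
Variables (K : fieldType) (n : nat) (g : 'I_n -> {mpoly K[n]}).
Local Notation E := (laurent K n).
Local Notation cochain := ({set 'I_n} -> E).
Implicit Types (w : cochain) (I D : {set 'I_n}) (i j : 'I_n).

(** The sign of moving dx_i past the dx_j with j in I and j < i. *)
Definition ksign i I : K := (-1) ^+ #|[set j in I | (j < i)%N]|.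

Definition koszul w : cochain :=
  fun D => \sum_(i in D) ksign i D *: act (g i) (w (D :\ i)%SET).

Definition contract i w : cochain :=
  fun I => if i \in I then 0 else ksign i I *: w (i |: I)%SET.

Lemma ksign_sqr i I : ksign i I * ksign i I = 1.
Proof. by rewrite /ksign -expr2 sqrr_sign. Qed.

Lemma ksign_self i I : ksign i (i |: I)%SET = ksign i I.
Proof.
congr (_ ^+ _); apply: eq_card => j; rewrite !inE.
by case: (eqVneq j i) => [->|//]; rewrite ltnn !andbF.
Qed.

Lemma ksignU i j I : j \notin I ->
  ksign i (j |: I)%SET = (if (j < i)%N then -1 else 1) * ksign i I.
Proof.
move=> jI; rewrite /ksign; case: ifP => ji; last first.
  rewrite mul1r; congr (_ ^+ _); apply: eq_card => k; rewrite !inE.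
  by case: (eqVneq k j) => [->|//]; rewrite ji !andbF.
rewrite -exprS; congr (_ ^+ _).
rewrite -(_ : (j |: [set k in I | (k < i)%N])%SET = [set k in (j |: I)%SET | (k < i)%N]).
  by rewrite cardsU1 inE (negPf jI).
apply/setP => k; rewrite !inE; by case: (eqVneq k j) => [->|//]; rewrite ji.
Qed.

Lemma ksign_swap i k D : i \notin D -> k \in D ->
  ksign i D * ksign k (i |: D)%SET = - (ksign k D * ksign i (D :\ k)%SET).
Proof.
move=> iD kD; rewrite ksignU //.
have {1}-> : D = (k |: (D :\ k))%SET by rewrite finset.setD1K.
rewrite ksignU ?finset.setD11 //.
have : i != k by apply: contraNneq iD => ->.
rewrite -val_eqE /= neq_ltn => /orP[lt|lt]; rewrite lt ltnNge (ltnW lt) /=; ring.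
Qed.

Lemma koszul_is_linear : linear koszul.
Proof.
move=> c w w'; apply/funext => D.
rewrite -[RHS]/(c *: koszul w D + koszul w' D) /koszul scaler_sumr -big_split.
apply: eq_bigr => i _ /=.
rewrite -[(c *: w + w') _]/(c *: w (D :\ i)%SET + w' (D :\ i)%SET) act_is_linear.
by rewrite scalerDr scalerA mulrC -scalerA.
Qed.
HB.instance Definition _ :=
  GRing.isLinear.Build K cochain cochain _ koszul koszul_is_linear.

Lemma contract_is_linear i : linear (contract i).
Proof.
move=> c w w'; apply/funext => D.
rewrite -[RHS]/(c *: contract i w D + contract i w' D) /contract.
case: ifP => _; first by rewrite scaler0 addr0.
rewrite -[(c *: w + w') _]/(c *: w (i |: D)%SET + w' (i |: D)%SET).
by rewrite scalerDr scalerA mulrC -scalerA.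
Qed.
HB.instance Definition _ i :=
  GRing.isLinear.Build K cochain cochain _ (contract i) (contract_is_linear i).

Lemma koszul_act p w D : koszul (fun I => act p (w I)) D = act p (koszul w D).
Proof.
rewrite /koszul raddf_sum; apply: eq_bigr => i _ /=.
by rewrite actuZ actC.
Qed.

(** Cartan's formula: on Koszul cohomology g i acts by zero. *)
Lemma koszul_homotopy i w D :
  koszul (contract i w) D + contract i (koszul w) D = act (g i) (w D).
Proof.
rewrite {2}/contract; case: ifPn => iD.
  rewrite addr0 /koszul (big_setD1 i) //= big1 ?addr0 => [|k].
    rewrite /contract finset.setD11 finset.setD1K // actuZ scalerA.
    rewrite -{1}(finset.setD1K iD) ksign_self.
    by rewrite ksign_sqr scale1r.
  by rewrite 2!inE => /andP[ki kD]; rewrite /contract !inE eq_sym ki iD raddf0 scaler0.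
rewrite {2}/koszul big_setU1 //= ksign_self finset.setU1K // scalerDr scalerA.
rewrite ksign_sqr scale1r addrCA /koszul scaler_sumr -big_split big1 ?addr0 //= => k kD.
have ik : i != k by apply: contraNneq iD => ->.
rewrite /contract !inE (negPf iD) andbF actuZ !scalerA.
have -> : ((i |: D) :\ k = i |: (D :\ k))%SET.
  by apply/setP => j; rewrite !inE; case: (eqVneq j i) => [->|]; rewrite ?ik.
by rewrite ksign_swap // scaleNr subrr.
Qed.

(** The square commutes with all contractions by Cartan's formula, and
    contracting with the elements of D one by one reaches the empty set. *)
Lemma koszulK w D : koszul (koszul w) D = 0.
Proof.
have [m] := ubnP #|D|; elim: m w D => // m IH w D mD.
have [->|[i iD]] := set_0Vmem D; first by rewrite /koszul big_set0.
have com : contract i (koszul (koszul w)) = koszul (koszul (contract i w)).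
  have h w' : koszul (contract i w') + contract i (koszul w')
      = (fun I => act (g i) (w' I)).
    by apply/funext => I; apply: koszul_homotopy.
  have := h (koszul w); have := congr1 koszul (h w); rewrite raddfD /=.
  have -> : koszul (fun I => act (g i) (w I)) = (fun I => act (g i) (koszul w I)).
    by apply/funext => I; apply: koszul_act.
  move=> <- /eqP; rewrite addrC (inj_eq (addIr _)) => /eqP //.
have := congr1 (fun w' => w' (D :\ i)%SET) com.
rewrite (IH (contract i w)); last by move: mD; rewrite (cardsD1 i) iD.
rewrite {1}/contract finset.setD11 finset.setD1K //.
by move/(congr1 (fun x => ksign i (D :\ i)%SET *: x));
  rewrite scalerA ksign_sqr scale1r scaler0.
Qed.

End KoszulComplex.

Section FunctionModules.
Variables (K : fieldType) (T : Type) (V : lmodType K).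
Implicit Types (f g : T -> V).

Lemma fctDE f g x : (f + g) x = f x + g x. Proof. by []. Qed.
Lemma fctNE f x : (- f) x = - f x. Proof. by []. Qed.
Lemma fctZE a f x : (a *: f) x = a *: f x. Proof. by []. Qed.

End FunctionModules.

Section Cone.
Variables (K : fieldType) (n : nat) (g : 'I_n -> {mpoly K[n]}) (q : {mpoly K[n]}).
Local Notation E := (laurent K n).
Local Notation cochain := ({set 'I_n} -> E).

(** Cochains of the Koszul complex of g together with q, built as the cone of
    multiplication by q.  The components at true involve one generator fewer of
    the exterior algebra: there the generator attached to q is present. *)
Definition cone : Type := bool -> {set 'I_n} -> laurent K n.
HB.instance Definition _ := GRing.Lmodule.on cone.
Implicit Types (w : cone).

Definition cdiff w : cone := fun b D =>
  if b then act q (w false D) - koszul g (w true) D else koszul g (w false) D.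

Lemma coneE a w w' b D : (a *: w + w') b D = a *: w b D + w' b D.
Proof. by []. Qed.

Lemma cone_slice a w w' b : (a *: w + w') b = a *: w b + w' b :> cochain.
Proof. by []. Qed.

Lemma cdiff_is_linear : linear cdiff.
Proof.
move=> c w w'; apply/funext => b; apply/funext => D; rewrite coneE /cdiff.
rewrite !cone_slice !koszul_is_linear !fctDE !fctZE act_is_linear.
by case: b => //; rewrite opprD addrACA scalerBr.
Qed.
HB.instance Definition _ :=
  GRing.isLinear.Build K cone cone _ cdiff cdiff_is_linear.

Lemma cdiffK w : cdiff (cdiff w) = 0.
Proof.
apply/funext => b; apply/funext => D; rewrite /cdiff.
case: b; last exact: koszulK.
have -> : (fun D0 => act q (w false D0) - koszul g (w true) D0)
        = (fun D0 => act q (w false D0)) - koszul g (w true) by [].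
by rewrite raddfB /= fctDE fctNE koszulK subr0 koszul_act subrr.
Qed.

Variables (c : 'I_n -> {mpoly K[n]}) (c0 : {mpoly K[n]}) (i0 : 'I_n) (N : nat).
Hypothesis XN : 'X_i0 ^+ N = \sum_i c i * g i + c0 * q.

(** By Cartan's formula the contractions with weights c i are a homotopy for
    multiplication by the sum of the c i * g i; dividing by the monomial and
    adding the contraction along q, weighted by c0, yields one for the identity. *)
Definition contract_all (w : cochain) : cochain :=
  fun D => unshift i0 N (\sum_i act (c i) (contract i w D)).

Definition chom w : cone := fun b D =>
  if b then - contract_all (w true) D
  else contract_all (w false) D + unshift i0 N (act c0 (w true D)).

Lemma contract_all_is_linear : linear contract_all.
Proof.
move=> a w w'; apply/funext => D; rewrite fctDE fctZE /contract_all.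
rewrite -unshift_is_linear; congr (unshift _ _ _).
rewrite scaler_sumr -big_split; apply: eq_bigr => i _ /=.
by rewrite contract_is_linear fctDE fctZE act_is_linear.
Qed.
HB.instance Definition _ :=
  GRing.isLinear.Build K cochain cochain _ contract_all contract_all_is_linear.

Lemma chom_is_linear : linear chom.
Proof.
move=> a w w'; apply/funext => b; apply/funext => D; rewrite coneE /chom.
rewrite !cone_slice !contract_all_is_linear !fctDE !fctZE act_is_linear.
rewrite unshift_is_linear; case: b; first by rewrite scalerN -opprD.
by rewrite scalerDr addrACA.
Qed.
HB.instance Definition _ :=
  GRing.isLinear.Build K cone cone _ chom chom_is_linear.

Lemma koszul_unshift (w : cochain) D :
  koszul g (fun I => unshift i0 N (w I)) D = unshift i0 N (koszul g w D).
Proof.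
rewrite /koszul raddf_sum; apply: eq_bigr => i _ /=.
by rewrite act_unshift.
Qed.

Lemma contract_all_homotopy (w : cochain) D :
  koszul g (contract_all w) D + contract_all (koszul g w) D
  = unshift i0 N (act (\sum_i c i * g i) (w D)).
Proof.
rewrite /contract_all koszul_unshift -raddfD; congr (unshift _ _ _).
have -> : (fun I => \sum_i act (c i) (contract i w I))
        = \sum_i (fun I => act (c i) (contract i w I)).
  by apply/funext => I; rewrite fct_sumE.
rewrite raddf_sum /= fct_sumE act_sum -big_split; apply: eq_bigr => i _.
by rewrite /= koszul_act -raddfD actM -koszul_homotopy.
Qed.

Lemma contract_all_act (w : cochain) p D :
  contract_all (fun I => act p (w I)) D = act p (contract_all w D).
Proof.
rewrite /contract_all act_unshift; congr (unshift _ _ _).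
rewrite raddf_sum; apply: eq_bigr => i _ /=; rewrite actC; congr (act _ _).
by rewrite /contract; case: ifP => _; rewrite ?raddf0 ?actuZ.
Qed.

(** Multiplication by a power of the variable i0, which is invertible on
    Laurent series, lies in the ideal and hence is null-homotopic. *)
Lemma chom_homotopy w : cdiff (chom w) + chom (cdiff w) = w.
Proof.
have key (u : E) : unshift i0 N (act (\sum_i c i * g i) u) +
    unshift i0 N (act c0 (act q u)) = u.
  by rewrite -raddfD /= -actM -actD -XN unshift_actX.
apply/funext => b; apply/funext => D; rewrite -[LHS]/(_ b D + _ b D) /cdiff /chom.
case: b.
  have -> : (fun I => - contract_all (w true) I) = - contract_all (w true) by [].
  have -> : (fun I => act q (w false I) - koszul g (w true) I)
          = (fun I => act q (w false I)) - koszul g (w true) by [].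
  rewrite !raddfN /= !raddfB /= contract_all_act raddfD /= !opprK.
  rewrite -[RHS](key (w true D)) -contract_all_homotopy act_unshift (actC q c0).
  by rewrite [LHS](AC (3*2) ((3*5*2)*(1*4))) /= subrr addr0.
have -> : (fun I => contract_all (w false) I + unshift i0 N (act c0 (w true I)))
   = contract_all (w false) + (fun I => unshift i0 N (act c0 (w true I))) by [].
rewrite raddfD /= fctDE koszul_unshift koszul_act !raddfB /= -[RHS](key (w false D)).
rewrite -contract_all_homotopy.
by rewrite [LHS](AC (2*(1*2)) ((1*3*4)*(2*5))) /= subrr addr0.
Qed.

End Cone.

(** * Dimension shifting along the variables *)

Section Graded.
Variables (K : fieldType) (n : nat).
Local Notation E := (laurent K n).
Implicit Types (u : E) (a : 'I_n -> int).

Definition homE (t : int) : set E := [set u | forall a, u a != 0 -> \sum_i a i = t].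

Lemma homE_subspace t : subspace (homE t).
Proof.
split=> [a|c u v hu hv a]; first by rewrite eqxx.
rewrite laurentD laurentZ; have [ua|ua] := eqVneq (u a) 0; last by rewrite hu.
by rewrite ua mulr0 add0r; apply: hv.
Qed.

Lemma act_neq0 p u a : act p u a != 0 ->
  exists2 m, m \in msupp p & u (shift m a) != 0.
Proof.
move=> h; apply: contrapT => nex; move: h; rewrite /act big_seq big1 ?eqxx // => m mp.
have [->|um] := eqVneq (u (shift m a)) 0; first by rewrite mulr0.
by case: nex; exists m.
Qed.

Lemma act_homE p k t u : p \is k.-homog -> homE t u -> homE (t + k%:Z) (act p u).
Proof.
move=> /dhomogP hp hu a /act_neq0[m mp /hu <-]; have /= <- := hp m mp.
rewrite mdegE -natz natr_sum -big_split; apply: eq_bigr => i _ /=.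
by rewrite /shift natz subrK.
Qed.

Lemma unshift_homE i N t u : homE t u -> homE (t - N%:Z) (unshift i N u).
Proof.
move=> hu a /hu <-; rewrite big_split /= -[LHS]addr0 -addrA; congr (_ + _).
rewrite (bigD1 i) //= big1 => [|j /negPf ji].
  by rewrite mulmnE mnm1E eqxx mul1n addr0 subrr.
by rewrite mulmnE mnm1E eq_sym ji mul0n.
Qed.

(** Modulo offneg m, defined next, tailreg m consists of the series with negative
    exponents in the first m variables and nonnegative ones in the others: the
    power series for m = 0, and the dual of the polynomial ring for m = n. *)
Definition tailreg (m : nat) : set E :=
  [set u | forall a, (exists2 i : 'I_n, (m <= i)%N & a i < 0) -> u a = 0].

Definition offneg (m : nat) : set E :=
  [set u | tailreg m.+1 u /\
     forall a, (forall i : 'I_n, (i < m)%N -> a i < 0) -> u a = 0].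

Definition act_closed (S : set E) : Prop := forall p u, S u -> S (act p u).

Lemma tailreg_subspace m : subspace (tailreg m).
Proof.
split=> [a //|c u v hu hv a ha]; rewrite laurentD laurentZ hu // hv //.
by rewrite mulr0 addr0.
Qed.

Lemma offneg_subspace m : subspace (offneg m).
Proof.
split=> [|c u v [tu hu] [tv hv]].
  by split=> //; apply: subspace0; apply: tailreg_subspace.
split=> [|a ha]; last by rewrite laurentD laurentZ hu // hv // mulr0 addr0.
by have [_ h] := tailreg_subspace m.+1; apply: h.
Qed.

Lemma shift_neg m a (i : 'I_n) : a i < 0 -> shift m a i < 0.
Proof. by rewrite /shift; lia. Qed.

Lemma tailreg_act m : act_closed (tailreg m).
Proof.
move=> p u hu a [i mi ai]; rewrite /act big1 // => c _.
by rewrite hu ?mulr0 //; exists i => //; apply: shift_neg.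
Qed.

Lemma offneg_act m : act_closed (offneg m).
Proof.
move=> p u [tu hu]; split=> [|a ha]; first exact: tailreg_act.
rewrite /act big1 // => c _; rewrite hu ?mulr0 // => i im.
exact/shift_neg/ha.
Qed.

Lemma unshift_other (i j : 'I_n) N (a : 'I_n -> int) : j != i ->
  a j + ((U_(i) *+ N)%MM j)%:Z = a j.
Proof. by move=> /negPf ji; rewrite mulmnE mnm1E eq_sym ji mul0n addr0. Qed.

Lemma tailreg_unshift (i : 'I_n) N u : tailreg i.+1 u -> tailreg i.+1 (unshift i N u).
Proof.
move=> hu a [j ij aj]; apply: hu; exists j => //.
by rewrite unshift_other // neq_ltn ij orbT.
Qed.

Lemma offneg_unshift (i : 'I_n) N u : offneg i u -> offneg i (unshift i N u).
Proof.
move=> [tu hu]; split=> [|a ha]; first exact: tailreg_unshift.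
apply: hu => j ji; rewrite unshift_other ?ha // neq_ltn ji //.
Qed.

Lemma tailregS m u : tailreg m u -> tailreg m.+1 u.
Proof. by move=> hu a [i mi ai]; apply: hu; exists i => //; apply: ltnW. Qed.

Lemma tailreg_offneg (i : 'I_n) u : tailreg i u -> offneg i.+1 u.
Proof.
move=> hu; split=> [|a ha]; first by do 2!apply: tailregS.
by apply: hu; exists i => //; apply: ha.
Qed.

Lemma offneg_offneg m u : offneg m u -> offneg m.+1 u.
Proof.
move=> [tu hu]; split=> [|a ha]; first exact: tailregS.
by apply: hu => i im; apply: ha; apply: leqW.
Qed.

Definition trunc (i : 'I_n) u : E := fun a => if a i < 0 then 0 else u a.

Lemma trunc_tailreg (i : 'I_n) u : tailreg i.+1 u -> tailreg i (trunc i u).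
Proof.
move=> hu a [j ij aj]; rewrite /trunc; case: ifPn => // ai; apply: hu; exists j => //.
by rewrite ltn_neqAle ij andbT; apply: contraNneq ai => /val_inj->.
Qed.

Lemma trunc_offneg (i : 'I_n) u :
  tailreg i.+1 u -> offneg i.+1 u -> offneg i (u - trunc i u).
Proof.
move=> tu [_ hu]; split=> [|a ha].
  apply: (subspaceB (tailreg_subspace i.+1)) => //.
  by apply: tailregS; apply: trunc_tailreg.
rewrite -[LHS]/(u a - trunc i u a) /trunc; case: ifPn => ai; last exact: subrr.
rewrite subr0 hu // => j; rewrite ltnS leq_eqVlt => /orP[/eqP/val_inj->//|].
exact: ha.
Qed.

Lemma trunc_homE i t u : homE t u -> homE t (trunc i u).
Proof. by move=> hu a; rewrite /trunc; case: ifP; rewrite ?eqxx // => _ /hu. Qed.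

End Graded.

Section ShiftStep.
Variables (K : fieldType) (n : nat) (g : 'I_n -> {mpoly K[n]}) (e : nat).
Variables (q : {mpoly K[n]}) (s : nat) (D0 : int).
Hypothesis ghom : forall i, g i \is e.-homog.
Hypothesis qhom : q \is s.-homog.
Local Notation E := (laurent K n).
Local Notation cone := (cone K n).
Local Notation kdiff := (cdiff g q).
Implicit Types (w : cone) (j : int).

Definition onall (S : set E) : set cone := [set w | forall b I, S (w b I)].

(** The internal degrees for which cdiff has degree 0; D0 is that of the
    component at the empty set. *)
Definition cdeg (b : bool) (I : {set 'I_n}) : int :=
  D0 + (#|I| * e)%:Z + (b * s)%:Z.

Definition graded (j : int) : set cone := [set w | forall b I,
  homE (cdeg b I) (w b I) /\ ((#|I| + b)%:Z <> j -> w b I = 0)].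

Lemma onall_subspace S : subspace S -> subspace (onall S).
Proof. by move=> [S0 Sl]; split=> [b I //|c w w' hw hw' b I]; apply: Sl. Qed.

Lemma onallS S S' w : S `<=` S' -> onall S w -> onall S' w.
Proof. by move=> SS hw b I; apply: SS. Qed.

Lemma graded_subspace j : subspace (graded j).
Proof.
split=> [b I|c w w' hw hw' b I]; first by split=> //; apply: subspace0; apply: (@homE_subspace K n).
have [h1 z1] := hw b I; have [h2 z2] := hw' b I; split=> [|nj].
  by have [_ h] := @homE_subspace K n (cdeg b I); apply: h.
by rewrite coneE z1 // z2 // scaler0 addr0.
Qed.

Lemma onall_koszul S (w : {set 'I_n} -> E) : subspace S -> act_closed S ->
  (forall I, S (w I)) -> forall D, S (koszul g w D).
Proof.
move=> Ss Sa hw D; apply: (subspace_sum Ss) => i _; apply: (subspaceZ Ss).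
exact: Sa.
Qed.

Lemma onall_cdiff S w : subspace S -> act_closed S -> onall S w -> onall S (kdiff w).
Proof.
move=> Ss Sa hw [] D; rewrite /cdiff; last exact: onall_koszul.
by apply: (subspaceB Ss); [exact: Sa|exact: onall_koszul].
Qed.

Lemma graded_cdiff j w : graded j w -> graded (j + 1) (kdiff w).
Proof.
move=> hw; have hk b D : homE (cdeg b D) (koszul g (w b) D) /\
    ((#|D| + b)%:Z <> j + 1 -> koszul g (w b) D = 0).
  split=> [|nj].
    apply: (subspace_sum (@homE_subspace K n _)) => i iD; apply: (subspaceZ (@homE_subspace K n _)).
    have -> : cdeg b D = cdeg b (D :\ i)%SET + e%:Z.
      by rewrite /cdeg (cardsD1 i) iD; lia.
    by apply: act_homE => //; case: (hw b (D :\ i)%SET).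
  rewrite /koszul big1 // => i iD; have [_ ->] := hw b (D :\ i)%SET.
    by rewrite raddf0 scaler0.
  by move: nj; rewrite (cardsD1 i) iD; lia.
move=> [] D; rewrite /cdiff; last exact: hk.
have [h z] := hk true D; have [h' z'] := hw false D; split=> [|nj].
  apply: (subspaceB (@homE_subspace K n _)) => //.
  have -> : cdeg true D = cdeg false D + s%:Z by rewrite /cdeg; lia.
  exact: act_homE.
by rewrite z // z' ?raddf0 ?subr0 ?addr0 //; move: nj; rewrite /= ?addn0 ?addn1; lia.
Qed.

(** Cocycles and coboundaries of the Koszul complex with values in tailreg m
    modulo offneg m, through their representatives in tailreg m. *)
Definition cocycles (j : int) (m : nat) : set cone :=
  [set w | [/\ graded j w, onall (tailreg m) w & onall (offneg m) (kdiff w)]].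

Definition coboundaries (j : int) (m : nat) : set cone :=
  [set w | exists u, [/\ graded (j - 1) u, onall (tailreg m) u &
                         onall (offneg m) (w - kdiff u)]].

Let tS m := onall_subspace (@tailreg_subspace K n m).
Let oS m := onall_subspace (@offneg_subspace K n m).

Let kdiff0 : kdiff 0 = 0. Proof. exact: raddf0. Qed.

Lemma cocycles_subspace j m : subspace (cocycles j m).
Proof.
split=> [|c w w' [g1 t1 o1] [g2 t2 o2]].
  by split; rewrite ?kdiff0; [exact: (subspace0 (graded_subspace _))|
    exact: (subspace0 (tS _))|exact: (subspace0 (oS _))].
split.
- by have [_ h] := graded_subspace j; apply: h.
- by have [_ h] := tS m; apply: h.
- by rewrite cdiff_is_linear; have [_ h] := oS m; apply: h.
Qed.

Lemma coboundaries_subspace j m : subspace (coboundaries j m).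
Proof.
split=> [|c w w' [u [g1 t1 o1]] [u' [g2 t2 o2]]].
  by exists 0; split; rewrite ?kdiff0 ?subr0; [exact: (subspace0 (graded_subspace _))|
    exact: (subspace0 (tS _))|exact: (subspace0 (oS _))].
exists (c *: u + u'); split.
- by have [_ h] := graded_subspace (j - 1); apply: h.
- by have [_ h] := tS m; apply: h.
- rewrite cdiff_is_linear opprD addrACA -scalerBr.
  by have [_ h] := oS m; apply: h.
Qed.

Variables (i0 : 'I_n) (N : nat) (c : 'I_n -> {mpoly K[n]}) (c0 : {mpoly K[n]}).
Hypothesis XN : 'X_i0 ^+ N = \sum_i c i * g i + c0 * q.
Hypotheses (eN : (e <= N)%N) (sN : (s <= N)%N).
Hypothesis chomog : forall i, c i \is (N - e).-homog.
Hypothesis c0homog : c0 \is (N - s).-homog.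

Local Notation khom := (chom c c0 i0 N).

Lemma onall_chom S w : subspace S -> act_closed S ->
  (forall u, S u -> S (unshift i0 N u)) -> onall S w -> onall S (khom w).
Proof.
move=> Ss Sa Su hw.
have hc b D : S (contract_all c i0 N (w b) D).
  apply: Su; apply: (subspace_sum Ss) => i _; apply: Sa; rewrite /contract.
  by case: ifP => _; [exact: subspace0|apply: subspaceZ].
move=> [] D; rewrite /chom; first exact: (subspaceN Ss).
by apply: (subspaceD Ss) => //; apply/Su/Sa.
Qed.

Lemma graded_chom j w : graded (j + 1) w -> graded j (khom w).
Proof.
move=> hw.
have hc b D : homE (cdeg b D) (contract_all c i0 N (w b) D) /\
    ((#|D| + b)%:Z <> j -> contract_all c i0 N (w b) D = 0).
  split=> [|nj].
    have -> : cdeg b D = cdeg b D + e%:Z + (N - e)%N%:Z - N%:Z by lia.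
    apply: unshift_homE; apply: (subspace_sum (@homE_subspace K n _)) => i _.
    apply: act_homE => //; rewrite /contract; case: ifPn => iD.
      exact: (subspace0 (@homE_subspace K n _)).
    apply: (subspaceZ (@homE_subspace K n _)).
    have -> : cdeg b D + e%:Z = cdeg b (i |: D)%SET.
      by rewrite /cdeg cardsU1 iD; lia.
    by case: (hw b (i |: D)%SET).
  rewrite /contract_all big1 ?raddf0 // => i _; rewrite /contract; case: ifPn => iD.
    exact: raddf0.
  have [_ ->] := hw b (i |: D)%SET; first by rewrite scaler0 raddf0.
  by move: nj; rewrite cardsU1 iD; lia.
move=> [] D; rewrite /chom; have [h z] := hc true D.
  split=> [|nj]; first exact: (subspaceN (@homE_subspace K n _)).
  by rewrite z ?oppr0.
have [h' z'] := hc false D; have [h'' z''] := hw true D; split=> [|nj].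
  apply: (subspaceD (@homE_subspace K n _)) => //.
  have -> : cdeg false D = cdeg true D + (N - s)%N%:Z - N%:Z by rewrite /cdeg; lia.
  by apply: unshift_homE; apply: act_homE.
by rewrite z' // z'' ?raddf0 ?addr0 //; move: nj; rewrite /= ?addn0 ?addn1; lia.
Qed.

Lemma trunc_split j w : graded j w -> onall (tailreg i0.+1) w ->
  onall (offneg i0.+1) w -> exists a, [/\ graded j a, onall (tailreg i0) a &
    onall (offneg i0) (w - a)].
Proof.
move=> gw tw ow; exists (fun b I => trunc i0 (w b I)); split=> b I.
- have [h z] := gw b I; split=> [|/z ->]; first exact: trunc_homE.
  by apply/funext => a; rewrite /trunc; case: ifP.
- exact: trunc_tailreg.
- exact: trunc_offneg.
Qed.

Let hom_t w : onall (tailreg i0.+1) w -> onall (tailreg i0.+1) (khom w).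
Proof.
apply: onall_chom; [exact: (@tailreg_subspace K n)|exact: tailreg_act|exact: tailreg_unshift].
Qed.

Let hom_o w : onall (offneg i0) w -> onall (offneg i0) (khom w).
Proof.
apply: onall_chom; [exact: (@offneg_subspace K n)|exact: offneg_act|exact: offneg_unshift].
Qed.

Let diff_t m w : onall (tailreg m) w -> onall (tailreg m) (kdiff w).
Proof. by apply: onall_cdiff; [exact: (@tailreg_subspace K n)|exact: tailreg_act]. Qed.

Let diff_o m w : onall (offneg m) w -> onall (offneg m) (kdiff w).
Proof. by apply: onall_cdiff; [exact: (@offneg_subspace K n)|exact: offneg_act]. Qed.

Let tS1 w : onall (tailreg i0) w -> onall (tailreg i0.+1) w.
Proof. by apply: onallS => u; apply: tailregS. Qed.
Let t_o w : onall (tailreg i0) w -> onall (offneg i0.+1) w.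
Proof. by apply: onallS => u; apply: tailreg_offneg. Qed.
Let o_o w : onall (offneg i0) w -> onall (offneg i0.+1) w.
Proof. by apply: onallS => u; apply: offneg_offneg. Qed.

Let homotopy := chom_homotopy XN.

(** Series with the variable i0 inverted form an acyclic complex, an extension
    of the two complexes below by each other; the homotopy realizes the
    connecting isomorphism. *)
Theorem shift_step j r :
  has_quot_dim (cocycles j i0.+1) (coboundaries j i0.+1) r ->
  has_quot_dim (cocycles (j + 1) i0) (coboundaries (j + 1) i0) r.
Proof.
apply: (has_quot_dim_preimage (phi := khom)).
- exact: cocycles_subspace.
- exact: coboundaries_subspace.
- exact: cocycles_subspace.
- exact: coboundaries_subspace.
- exact: chom_is_linear.
- move=> w [gw tw ow]; split; first exact: graded_chom.
    exact/hom_t/tS1.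
  rewrite -(addrK (khom (kdiff w)) (kdiff _)) homotopy.
  by apply: (subspaceB (oS _)); [exact: t_o|exact/o_o/hom_o].
- move=> w [gw tw ow]; split=> [[u [gu tu ou]]|[t [gt tt ot]]].
    rewrite addrK in gu; exists (- khom u); split.
    + apply: (subspaceN (graded_subspace _)); apply: graded_chom.
      by rewrite subrK.
    + exact/(subspaceN (tS _))/hom_t/tS1.
    + rewrite raddfN opprK; have -> : khom w + kdiff (khom u) = u + khom (w - kdiff u).
        by rewrite raddfB /= -{2}(homotopy u) [RHS](AC (2*2) ((3*1)*(2*4))) /= subrr addr0.
      by apply: (subspaceD (oS _)); [exact: t_o|exact/o_o/hom_o].
  have [||a [ga ta oa]] := trunc_split _ _ ot (j := j).
  + apply: (subspaceB (graded_subspace _)); first exact: graded_chom.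
    by have := graded_cdiff gt; rewrite subrK.
  + by apply: (subspaceB (tS _)); [exact/hom_t/tS1|exact: diff_t].
  exists a; rewrite addrK; split=> //.
  have -> : w - kdiff a = kdiff (khom w - kdiff t - a) + khom (kdiff w).
    by rewrite !raddfB /= cdiffK subr0 addrAC homotopy.
  by apply: (subspaceD (oS _)); [exact: diff_o|exact: hom_o].
- move=> v [gv tv ov].
  have [||a [ga ta oa]] := trunc_split _ _ ov (j := j + 1).
  + exact: graded_cdiff.
  + exact: diff_t.
  exists a.
    split=> //; have -> : kdiff a = - kdiff (kdiff v - a).
      by rewrite raddfB /= cdiffK sub0r opprK.
    exact/(subspaceN (oS _))/diff_o.
  exists (khom v); split.
  + by apply: graded_chom; rewrite subrK.
  + exact: hom_t.
  + have -> : v - khom a - kdiff (khom v) = khom (kdiff v - a).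
      by rewrite raddfB /= -{1}(homotopy v) addrAC [kdiff _ + _]addrC addrK.
    exact/o_o/hom_o.
Qed.

End ShiftStep.

(** * Macaulay's inverse system *)

Section InverseSystem.
Variables (K : closedFieldType) (n : nat) (g : 'I_n -> {mpoly K[n]}) (e : nat).
Hypothesis ghom : forall i, g i \is e.-homog.
Variables (l : {mpoly K[n]}) (s t : nat).
Hypothesis lhom : l \is 1.-homog.
Local Notation E := (laurent K n).
Local Notation cone := (cone K n).
Local Notation q := (l ^+ s).
Local Notation D0 := (- (n + t)%N%:Z).
Local Notation R := (@homog_part K n).
Local Notation slice := (slice_ideal g l s).

Definition neg_ones : 'I_n -> int := fun=> -1.

(** The residue pairing: the coefficient at 1 / (x_1 ... x_n) of p times the
    component of w at the empty set. *)
Definition evaluation (w : cone) (p : {mpoly K[n]}) : K :=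
  act p (w false finset.set0) neg_ones.

Lemma offneg_all (u : E) : offneg n u <-> forall a, (forall i, a i < 0) -> u a = 0.
Proof.
split=> [[_ hu] a ha|hu]; first by apply: hu.
split=> [a [i /ltnW]|a ha]; first by rewrite leqNgt ltn_ord.
by apply: hu => i; apply: ha.
Qed.

Definition depth (a : 'I_n -> int) : 'X_{1..n} := [multinom (absz (a i)).-1 | i < n].

Lemma depthE (a : 'I_n -> int) : (forall i, a i < 0) ->
  a = shift (depth a) neg_ones.
Proof.
by move=> ha; apply/funext => i; have := ha i; rewrite /shift mnmE /neg_ones; lia.
Qed.

Lemma sum_shift (m : 'X_{1..n}) (a : 'I_n -> int) :
  \sum_i shift m a i = \sum_i a i - (mdeg m)%:Z.
Proof.
by rewrite mdegE -[(\sum_i m i)%N%:Z]natz natr_sum -sumrB; apply: eq_bigr => i _; rewrite natz.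
Qed.

Lemma sum_neg_ones : \sum_i neg_ones i = - n%:Z.
Proof. by rewrite sumr_const card_ord mulNrn natz. Qed.

Lemma cocycle_evaluation w : cocycles g e q s D0 0 n w ->
  (forall i, offneg n (act (g i) (w false finset.set0))) /\ offneg n (act q (w false finset.set0)).
Proof.
move=> [gw _ ow]; split=> [i|].
  have := ow false [set i]%SET; rewrite /cdiff /koszul big_set1.
  rewrite finset.setDv /ksign; move/(subspaceZ (@offneg_subspace K n n) ((-1) ^+ _)) => h.
  by have := h #|[set j in [set i]%SET | (j < i)%N]|; rewrite scalerA -expr2 sqrr_sign scale1r.
by have := ow true finset.set0; rewrite /cdiff /koszul big_set0 subr0.
Qed.

Section Functional.
Variable lam : {mpoly K[n]} -> K.
Hypothesis lam_lin : forall a u v, R t u -> R t v -> lam (a *: u + v) = a * lam u + lam v.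
Hypothesis lam_slice : forall p, R t p -> slice p -> lam p = 0.

Definition functional_series : E := fun a =>
  if [forall i, a i < 0] && (\sum_i a i == D0) then lam 'X_[depth a] else 0.

Definition functional_cone : cone := fun b I =>
  if ~~ b && (I == finset.set0) then functional_series else 0.

Lemma lam_sum (I : eqType) (r : seq I) (c : I -> K) (x : I -> {mpoly K[n]}) :
  (forall i, i \in r -> R t (x i)) ->
  lam (\sum_(i <- r) c i *: x i) = \sum_(i <- r) c i * lam (x i).
Proof.
have lam0 : lam 0 = 0.
  by apply: lam_slice; [exact: rpred0|exact: (ideal0 (slice_ideal_ideal _ _ _))].
elim: r => [|i r IH] h; first by rewrite !big_nil lam0.
rewrite !big_cons lam_lin ?IH // => [j jr||]; first by apply: h; rewrite inE jr orbT.
  by apply: h; rewrite mem_head.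
rewrite big_seq; apply: (subspace_sum (@homog_part_subspace K n t)) => j jr.
by apply: (subspaceZ (@homog_part_subspace K n t)); apply: h; rewrite inE jr orbT.
Qed.

(** On negative exponents the action of R on the series of a functional is
    contragredient to multiplication. *)
Lemma functional_act p k a : p \is k.-homog -> (forall i, a i < 0) ->
  \sum_i a i - k%:Z = D0 -> act p functional_series a = lam ('X_[depth a] * p).
Proof.
move=> /dhomogP pk ha ak; rewrite {2}(mpolyE p) mulr_sumr.
under [in RHS]eq_bigr do rewrite -scalerAr -mpolyXD.
have dg m : m \in msupp p -> mdeg (depth a + m)%MM = t.
  move=> /pk /= mk; rewrite mdegD mk; move: ak.
  rewrite {1}(depthE ha) sum_shift sum_neg_ones; lia.
rewrite lam_sum => [|m mp]; last first.
  by rewrite /homog_part /= dhomogX; apply/eqP/dg.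
rewrite /act !big_seq; apply: eq_bigr => m mp; congr (_ * _).
have hs i : shift m a i < 0 by apply: shift_neg.
rewrite /functional_series; have -> : [forall i, shift m a i < 0] by apply/forallP.
rewrite sum_shift; have /= -> := pk m mp; rewrite ak eqxx; congr (lam 'X_[_]).
by apply/mnmP => i; rewrite mnmDE !mnmE /shift; have := ha i; lia.
Qed.

Lemma functional_offneg p k : p \is k.-homog -> slice p -> offneg n (act p functional_series).
Proof.
move=> pk sp; apply/offneg_all => a ha.
have [ak|nak] := eqVneq (\sum_i a i - k%:Z) D0.
  rewrite (functional_act pk ha ak); apply: lam_slice.
    have h : 'X_[K, depth a] \is (mdeg (depth a)).-homog by rewrite dhomogX; apply/eqP.
    have := dhomogM h pk; rewrite /homog_part /=.
    have -> // : (mdeg (depth a) + k)%N = t.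
    by move: ak; rewrite {1}(depthE ha) sum_shift sum_neg_ones; lia.
  exact: (idealM (slice_ideal_ideal _ _ _)).
rewrite /act big_seq big1 // => m mp; rewrite /functional_series sum_shift.
by have /dhomogP/(_ m mp)/= -> := pk; rewrite (negPf nak) andbF mulr0.
Qed.

End Functional.

(** Degree t functionals on R vanishing on the ideal are the 0-cocycles in the
    last complex: a series on negative exponents is read as a functional. *)
Lemma inverse_system_dim r : has_quot_dim (R t) slice r ->
  has_quot_dim (cocycles g e q s D0 0 n) (coboundaries g e q s D0 0 n) r.
Proof.
have qhom := lin_exp_homog lhom s.
have cob w : coboundaries g e q s D0 0 n w -> onall (offneg n) w.
  move=> [u [gu _ ou]]; have u0 : u = 0.
    by apply/funext => b; apply/funext => I; have [_ ->] := gu b I; last lia.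
  by move: ou; rewrite u0 raddf0 subr0.
apply: (has_quot_dim_dual (B := evaluation)).
- exact: homog_part_subspace.
- exact: (ideal_subspace (slice_ideal_ideal _ _ _)).
- exact: cocycles_subspace.
- exact: coboundaries_subspace.
- by move=> w c u v; rewrite /evaluation actD actZ.
- by move=> p c w w'; rewrite /evaluation coneE act_is_linear.
- move=> w p /cocycle_evaluation[gw qw] _ [h [h' hp]].
  have : offneg n (act p (w false finset.set0)).
    rewrite -(subrK (h * q) p) hp actD; apply: (subspaceD (@offneg_subspace K n n)).
      rewrite act_sum; apply: (subspace_sum (@offneg_subspace K n n)) => i _.
      by rewrite actM; apply: offneg_act.
    by rewrite actM; apply: offneg_act.
  by move/offneg_all; apply.
- move=> w [gw tw ow]; split=> [h|/cob hw p _]; last first.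
    by have /offneg_all := offneg_act p (hw false finset.set0); apply.
  exists 0; split.
  + exact: (subspace0 (graded_subspace K n e s _ _)).
  + exact: (subspace0 (onall_subspace (@tailreg_subspace K n n))).
  rewrite raddf0 subr0 => b I; apply/offneg_all => a ha.
  have [hI z] := gw b I; have [bI|nbI] := eqVneq (#|I| + b)%N 0%N; last first.
    by rewrite z //; case=> /eqP; rewrite (negPf nbI).
  have /andP[/eqP I0 b0] : (#|I| == 0%N) && (b == false).
    by move/eqP: bI; rewrite addn_eq0 => /andP[-> /=]; case: (b).
  move: hI; rewrite (cards0_eq I0) (eqP b0) => hI; apply: contrapT => /eqP ua.
  have := hI a ua; rewrite /cdeg cards0 (depthE ha) sum_shift sum_neg_ones => da.
  case/negP: ua; apply/eqP; have := h 'X_[depth a]; rewrite /evaluation actX -depthE //.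
  by apply; rewrite /homog_part /= dhomogX; apply/eqP => /=; lia.
- move=> lam lin ann; exists (functional_cone lam); last first.
    move=> p Rp; rewrite /evaluation /functional_cone eqxx /=.
    rewrite (@functional_act _ lin ann _ t) //.
      have -> : depth neg_ones = 0%MM by apply/mnmP => i; rewrite !mnmE.
      by rewrite mpolyX0 mul1r.
    by rewrite sum_neg_ones; lia.
  split.
  + move=> b I; rewrite /functional_cone; case: ifP => [/andP[/negPf-> /eqP->]|_].
      split=> [a|]; last by rewrite cards0.
      rewrite /functional_series; case: ifP => [/andP[_ /eqP-> _]|]; last by rewrite eqxx.
      by rewrite /cdeg cards0; lia.
    by split=> //; apply: (subspace0 (@homE_subspace K n _)).
  + by move=> b I a [ i ]; rewrite leqNgt ltn_ord.
  + have osub := @offneg_subspace K n n.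
    have Sg i : slice (g i) by apply/slice_ideal_sub/gen_ideal_gen.
    have Sq : slice q by have := slice_ideal_exp g l s 1; rewrite mul1r.
    have hk b D : offneg n (koszul g (functional_cone lam b) D).
      apply: (subspace_sum osub) => i _; apply: (subspaceZ osub).
      rewrite /functional_cone; case: ifP => _; first exact: functional_offneg.
      by rewrite raddf0; apply: subspace0 osub.
    move=> [] D; rewrite /cdiff; last exact: hk.
    apply: (subspaceB osub) => //; rewrite /functional_cone /=.
    case: ifP => _; first exact: (functional_offneg lin ann qhom).
    by rewrite raddf0; apply: subspace0 osub.
Qed.

End InverseSystem.

(** * Duality for the Koszul complex *)

Section KoszulDuality.
Variable K : closedFieldType.
Hypothesis Kunc : infinite_fiber K.
Variables (n : nat) (g : 'I_n -> {mpoly K[n]}) (e : nat).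
Hypothesis ghom : forall i, g i \is e.-homog.
Variable l : {mpoly K[n]}.
Hypothesis lhom : l \is 1.-homog.
Hypothesis lJ : forall v : 'rV[K]_n,
  (forall i, (g i).@[v ord0] = 0) -> l.@[v ord0] = 0 -> v = 0.

Local Notation pih k := (pihomog (@mdeg n) k).

(** The coefficients are replaced by their homogeneous components. *)
Lemma primary_homogeneous s (i0 : 'I_n) : exists N c c0,
  [/\ 'X_i0 ^+ N = \sum_i c i * g i + c0 * l ^+ s, (e <= N)%N, (s <= N)%N,
      forall i, c i \is (N - e).-homog & c0 \is (N - s).-homog].
Proof.
have [N0 hN0] := slice_primary Kunc lJ s; pose N := (N0 + e + s)%N.
have [h0 [h hh]] := ideal_exp_le (slice_ideal_ideal g l s)
  (leq_trans (leq_addr e N0) (leq_addr s _)) (hN0 i0).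
have eN : (e <= N)%N by rewrite /N; lia.
have sN : (s <= N)%N by rewrite /N; lia.
exists N, (fun i => pih (N - e) (h i)), (pih (N - s) h0); split=> //; last 2 first.
- by move=> i; apply: pihomogP.
- exact: pihomogP.
have XN : ('X_i0 ^+ N : {mpoly K[n]}) \is N.-homog.
  have := @dhomogMn _ K (@mdeg n) 1 'X_i0 N; rewrite mul1n; apply.
  by rewrite dhomogX; apply/eqP/mdeg1.
have e1 : 'X_i0 ^+ N = \sum_i h i * g i + h0 * l ^+ s by rewrite -hh subrK.
rewrite -(pihomog_dE XN) {1}e1 raddfD /= raddf_sum /=; congr (_ + _).
  by apply: eq_bigr => i _; rewrite -[in LHS](subnK eN) pihomog_homogM.
by rewrite -[in LHS](subnK sN) pihomog_homogM // lin_exp_homog.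
Qed.

(** R/(g, l^s) in degree t is dual to the cohomology in degree 0 of the last
    complex; each of the n shift steps raises the cohomological degree by one
    and trades one negative variable for a nonnegative one. *)
Theorem koszul_duality s t r :
  has_quot_dim (@homog_part K n t) (slice_ideal g l s) r ->
  has_quot_dim (cocycles g e (l ^+ s) s (- (n + t)%N%:Z) n 0)
               (coboundaries g e (l ^+ s) s (- (n + t)%N%:Z) n 0) r.
Proof.
move=> /(inverse_system_dim ghom lhom) h.
suff: forall m, (m <= n)%N -> has_quot_dim
    (cocycles g e (l ^+ s) s (- (n + t)%N%:Z) m%:Z (n - m))
    (coboundaries g e (l ^+ s) s (- (n + t)%N%:Z) m%:Z (n - m)) r.
  by move/(_ n (leqnn n)); rewrite subnn.
elim=> [|m IH] mn; first by rewrite subn0.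
have lt : (n - m.+1 < n)%N by rewrite ltn_subrL /=; case: (n) mn.
have [N [c [c0 [XN eN sN ch c0h]]]] := primary_homogeneous s (Ordinal lt).
have := @shift_step _ _ _ _ _ _ (- (n + t)%N%:Z) ghom (lin_exp_homog lhom s)
  _ _ _ _ XN eN sN ch c0h m%:Z r.
have -> : (m%:Z + 1) = m.+1 by lia.
apply; rewrite /= subnSK //; exact/IH/ltnW.
Qed.

End KoszulDuality.

(** * Differential forms as Koszul cochains *)

Section Forms.
Variables (K : fieldType) (n : nat) (f : {mpoly K[n]}).
Local Notation E := (laurent K n).
Local Notation g := (fun i : 'I_n => f^`M(i)).
Local Notation forms := (forms K n).
Implicit Types (w : forms) (p : {mpoly K[n]}).

Lemma inversions1 (i : 'I_n) (D : {set 'I_n}) :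
  inversions [set i] (D :\ i) = #|[set j in D | (j < i)%N]|.
Proof.
rewrite /inversions -(card_imset _ (f := fun j => (i, j))); last by move=> j k [].
apply: eq_card => -[a b]; rewrite [in LHS]inE /= finset.in_set1.
apply/idP/imsetP => [/and3P[/eqP-> hb lt]|[j]].
  by exists b => //; rewrite inE lt andbT; move: hb; rewrite finset.in_setD1 => /andP[].
rewrite inE => /andP[jD lt] [-> ->]; rewrite eqxx lt finset.in_setD1 jD !andbT /=.
by apply: contraTneq lt => ->; rewrite ltnn.
Qed.

Lemma wedge_differential w (D : {set 'I_n}) :
  wedge (differential f) w D = \sum_(i in D) ksign K i D *: (f^`M(i) * w (D :\ i)%SET).
Proof.
rewrite ffunE.
under eq_bigr => I _ do rewrite ffunE mulr_sumr mulr_suml.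
rewrite (exchange_big_dep (fun i => i \in D)) /=; last first.
  by move=> I i ID /eqP Ii; rewrite Ii finset.sub1set in ID.
apply: eq_bigr => i iD; rewrite (big_pred1 [set i]%SET) => [|I]; last first.
  by apply/andP/eqP => [[_ /eqP]//|->]; rewrite finset.sub1set iD.
rewrite inversions1 /ksign -mul_mpolyC mulrA; congr (_ * _ * _).
by rewrite rmorphXn /= rmorphN rmorph1.
Qed.

Definition delta0 : E := fun a => (a == (fun=> 0))%:R.

(** A polynomial as a Laurent series: the action on the constant 1. *)
Definition poly_series p : E := act p delta0.

Lemma poly_seriesE p (m : 'X_{1..n}) : poly_series p (fun i => (m i)%:Z) = p@_m.
Proof.
rewrite /poly_series /act (eq_bigr (fun m' => p@_m' * (m' == m)%:R)) => [|m' _].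
  have [mp|mp] := boolP (m \in msupp p); last first.
    rewrite (memN_msupp_eq0 mp) big_seq big1 // => m' mp'.
    by case: eqP mp => [<-|]; rewrite ?mp' // mulr0.
  rewrite (bigD1_seq m) //= ?msupp_uniq // eqxx mulr1 big1 ?addr0 // => m' /negPf->.
  by rewrite mulr0.
congr (_ * _%:R); congr (nat_of_bool _); apply/eqP/eqP => [h|->].
  by apply/mnmP => i; have := congr1 (fun a => a i) h; rewrite /shift; lia.
by apply/funext => i; rewrite /shift subrr.
Qed.

Lemma poly_series_tail p : tailreg 0 (poly_series p).
Proof.
apply: tailreg_act => a [i _ ai]; rewrite /delta0; case: eqP => // h.
by move: ai; rewrite h ltxx.
Qed.

Lemma tail_nonneg (u : E) a : tailreg 0 u -> u a != 0 ->
  exists m : 'X_{1..n}, a = fun i => (m i)%:Z.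
Proof.
move=> tu ua; exists [multinom absz (a i) | i < n]; apply/funext => i.
rewrite mnmE; have [ai|ai] := ltP (a i) 0; last by lia.
by move: ua; rewrite tu ?eqxx //; exists i.
Qed.

Lemma tail_ext (u v : E) : tailreg 0 u -> tailreg 0 v ->
  (forall m : 'X_{1..n}, u (fun i => (m i)%:Z) = v (fun i => (m i)%:Z)) -> u = v.
Proof.
move=> tu tv h; apply/funext => a; have [ua|ua] := eqVneq (u a) 0; last first.
  by have [m ->] := tail_nonneg tu ua.
have [va|va] := eqVneq (v a) 0; first by rewrite ua va.
by have [m ->] := tail_nonneg tv va.
Qed.

Lemma poly_series_inj p : poly_series p = 0 -> p = 0.
Proof. by move=> h; apply/mpolyP => m; rewrite -poly_seriesE h mcoeff0. Qed.

Lemma poly_series_linear : linear poly_series.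
Proof. by move=> c p p'; rewrite /poly_series actD actZ. Qed.

Lemma sum_mnm (m : 'X_{1..n}) : \sum_i (m i)%:Z = mdeg m.
Proof. by rewrite mdegE -[RHS]natz natr_sum; apply: eq_bigr => i _; rewrite natz. Qed.

Lemma poly_series_homE p (k : int) : homE k (poly_series p) <->
  (forall m, m \in msupp p -> (mdeg m)%:Z = k).
Proof.
split=> [h m|h a ua].
  by rewrite mcoeff_msupp -poly_seriesE => /h <-; rewrite sum_mnm.
have [m am] := tail_nonneg (@poly_series_tail p) ua.
by move: ua; rewrite am poly_seriesE -mcoeff_msupp => /h <-; rewrite sum_mnm.
Qed.

Lemma homE_neg (u : E) (k : int) : k < 0 -> tailreg 0 u -> homE k u -> u = 0.
Proof.
move=> k0 tu hu; apply/funext => a; have [//|ua] := eqVneq (u a) 0.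
have [m am] := tail_nonneg tu ua; have := hu a ua; rewrite am sum_mnm; lia.
Qed.

Lemma poly_series_surj (u : E) (k : int) : tailreg 0 u -> homE k u ->
  exists p, poly_series p = u.
Proof.
move=> tu hu; pose b := (absz k).+1.
exists (\sum_(m : 'X_{1..n < b}) u (fun i => (m i)%:Z) *: 'X_[m]).
apply: tail_ext => // [|m]; first exact: poly_series_tail.
rewrite poly_seriesE; have [mb|mb] := ltnP (mdeg m) b.
  exact: (@mcoeff_mpoly n K (fun m' => u (fun i => (m' i)%:Z))).
have -> : u (fun i => (m i)%:Z) = 0.
  apply: contrapT => /eqP um; have := hu _ um; rewrite sum_mnm.
  by move: mb; rewrite /b; lia.
rewrite raddf_sum big1 // => m' _; rewrite /= mcoeffZ mcoeffX.
case: eqP => [mm|]; last by rewrite mulr0.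
by move: mb; rewrite -mm leqNgt bmdeg.
Qed.

Variables (e s d : nat) (l : {mpoly K[n]}) (D0 kap : int).
Hypothesis ghom : forall i, g i \is e.-homog.
Hypothesis qhom : l ^+ s \is s.-homog.
Hypothesis n_gt1 : (1 < n)%N.
Hypothesis D0E : D0 = kap - n.-1%:Z - (n.-1 * e)%N%:Z - s%:Z.
Hypothesis s_large : kap - n.-1%:Z + e%:Z < s%:Z.

Local Notation q := (l ^+ s).
Local Notation kdiff := (cdiff g q).

Definition form_cone (w : forms) : cone K n :=
  fun b I => if b then poly_series (w I) else 0.

Lemma form_cone_linear : linear form_cone.
Proof.
move=> c w w'; apply/funext => b; apply/funext => I; rewrite coneE /form_cone.
by case: b; rewrite ?scaler0 ?addr0 // !ffunE poly_series_linear.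
Qed.

Lemma cdiff_form_cone w :
  kdiff (form_cone w) = - form_cone (wedge (differential f) w).
Proof.
apply/funext => b; apply/funext => D; rewrite !fctNE /cdiff /form_cone; case: b.
  rewrite raddf0 sub0r; congr (- _); rewrite wedge_differential /poly_series act_sum.
  by apply: eq_bigr => i _; rewrite actZ actM.
by rewrite oppr0 /koszul big1 // => i _; rewrite raddf0 scaler0.
Qed.

Lemma form_cone_inj w : form_cone w = 0 -> w = 0.
Proof.
move=> h; apply/ffunP => I; rewrite ffunE; apply: poly_series_inj.
by have := congr1 (fun c : cone K n => c true I) h.
Qed.

Definition homproj (k : int) (u : E) : E := fun a => if \sum_i a i == k then u a else 0.

Lemma homproj_homE k u : homE k (homproj k u).
Proof. by move=> a; rewrite /homproj; case: (_ =P k) => // _; rewrite eqxx. Qed.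

Lemma homproj_id k u : homE k u -> homproj k u = u.
Proof.
move=> hu; apply/funext => a; rewrite /homproj; case: (_ =P k) => // nk.
by apply/esym/eqP/negPn/negP => /hu.
Qed.

Lemma homproj_act k j p u : p \is j.-homog ->
  act p (homproj k u) = homproj (k + j%:Z) (act p u).
Proof.
move=> /dhomogP hp; apply/funext => a; rewrite /homproj /act.
case: (_ =P k + j%:Z) => ak; rewrite !big_seq; last first.
  rewrite big1 // => m /hp /= mj; rewrite sum_shift mj ifF ?mulr0 //.
  by apply/eqP; lia.
apply: eq_bigr => m /hp /= mj; rewrite sum_shift mj ifT //.
by apply/eqP; lia.
Qed.

Lemma homproj_linear k : linear (homproj k).
Proof.
move=> c u v; apply/funext => a; rewrite laurentD laurentZ /homproj.
by case: ifP; rewrite ?mulr0 ?addr0.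
Qed.
HB.instance Definition _ k :=
  GRing.isLinear.Build K E E _ (homproj k) (homproj_linear k).

Lemma homproj0 k : homproj k 0 = 0. Proof. exact: raddf0. Qed.

Lemma homprojZ k c u : homproj k (c *: u) = c *: homproj k u.
Proof. by rewrite -[c *: u]addr0 homproj_linear homproj0 addr0. Qed.

Lemma homproj_tail k u : tailreg 0 u -> tailreg 0 (homproj k u).
Proof. by move=> tu a ha; rewrite /homproj tu // if_same. Qed.

(** The differential commutes with the projection onto homogeneous components,
    so that a homogeneous exact form has a homogeneous primitive. *)
Definition gradeproj (c : cone K n) : cone K n :=
  fun b I => homproj (cdeg e s D0 b I) (c b I).

Lemma gradeproj_cdiff c : kdiff (gradeproj c) = gradeproj (kdiff c).
Proof.
have hk b D : koszul g (gradeproj c b) D = homproj (cdeg e s D0 b D) (koszul g (c b) D).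
  rewrite /koszul raddf_sum; apply: eq_bigr => i iD /=.
  rewrite (homproj_act _ _ (ghom i)) homprojZ.
  congr (_ *: homproj _ _); rewrite /cdeg [in RHS](cardsD1 i) iD; lia.
apply/funext => b; apply/funext => D; rewrite /cdiff hk.
case: b; last exact: hk.
rewrite [RHS]raddfB /=; congr (_ - _); rewrite (homproj_act _ _ qhom).
by congr homproj; rewrite /cdeg; lia.
Qed.

Definition closed_forms : set forms :=
  [set w | [/\ is_form n.-1 w, wedge (differential f) w = 0 & form_degree kap w]].

Lemma wedge_linear w0 : linear (wedge (K := K) (n := n) w0).
Proof.
move=> c w w'; apply/ffunP => D; rewrite !ffunE scaler_sumr -big_split.
by apply: eq_bigr => I _ /=; rewrite !ffunE mulrDr -scalerAr.
Qed.

Lemma wedge_form0 w0 : wedge w0 0 = 0 :> forms.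
Proof.
have := wedge_linear w0 (-1) 0 0; by rewrite scaler0 addr0 scaleN1r addNr.
Qed.

Lemma wedge_formN w0 w : wedge w0 (- w) = - wedge w0 w.
Proof.
by have := wedge_linear w0 (-1) w 0; rewrite !addr0 wedge_form0 addr0 !scaleN1r.
Qed.

Lemma is_form_subspace k : subspace [set w : forms | is_form k w].
Proof.
split=> [I|c w w' hw hw' I]; rewrite !ffunE ?eqxx //.
have [->|nw] := eqVneq (w I) 0; last by move=> _; apply: hw.
by rewrite scaler0 add0r; apply: hw'.
Qed.

Lemma form_degree_subspace k : subspace [set w : forms | form_degree k w].
Proof.
split=> [I m|c w w' hw hw' I m]; rewrite !ffunE; first by rewrite msupp0.
move/msuppD_le; rewrite mem_cat => /orP[/msuppZ_le|]; [exact: hw|exact: hw'].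
Qed.

Lemma closed_forms_subspace : subspace closed_forms.
Proof.
split=> [|c w w' [f1 z1 d1] [f2 z2 d2]].
  split; [exact: (subspace0 (is_form_subspace _))| |
    exact: (subspace0 (form_degree_subspace _))].
  exact: wedge_form0.
split.
- by have [_ h] := is_form_subspace n.-1; apply: h.
- by rewrite wedge_linear z1 z2 scaler0 addr0.
- by have [_ h] := form_degree_subspace kap; apply: h.
Qed.

Lemma df_image_subspace k : subspace (df_image f k).
Proof.
split=> [|c w w' [x fx ->] [y fy ->]].
  by exists 0; [exact: (subspace0 (is_form_subspace _))|rewrite wedge_form0].
exists (c *: x + y); last by rewrite wedge_linear.
by have [_ h] := is_form_subspace k; apply: h.
Qed.

(** In these degrees the components of a cochain that do not involve the power
    of the linear form have negative degree, hence vanish. *)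
Lemma forms_dim r :
  has_quot_dim (cocycles g e q s D0 n 0) (coboundaries g e q s D0 n 0) r ->
  has_quot_dim closed_forms (df_image f n.-2) r.
Proof.
have n2 := n_gt1.
have ne : (n * e = n.-1 * e + e)%N by rewrite -mulSnr prednK // ltnW.
have off0 (u : E) : offneg 0 u -> u = 0 by move=> [_ h]; apply/funext => a; apply: h.
have cone0 (c : cone K n) : onall (offneg 0) c -> c = 0.
  by move=> h; apply/funext => b; apply/funext => I; apply: off0.
have zer : onall (K := K) (n := n) (offneg 0) 0.
  exact: (subspace0 (onall_subspace (@offneg_subspace K n 0))).
have tl w : onall (tailreg 0) (form_cone w).
  move=> [] I; rewrite /form_cone; first exact: poly_series_tail.
  exact: (subspace0 (@tailreg_subspace K n 0)).
apply: (has_quot_dim_preimage (phi := form_cone)).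
- exact: closed_forms_subspace.
- exact: df_image_subspace.
- exact: cocycles_subspace.
- exact: coboundaries_subspace.
- exact: form_cone_linear.
- move=> w [fw zw dw]; split=> //; last first.
    rewrite cdiff_form_cone zw; have -> : form_cone 0 = 0.
      have := form_cone_linear (-1) 0 0.
      by rewrite scaler0 addr0 scaleN1r addNr.
    by rewrite oppr0.
  move=> [] I; rewrite /form_cone; last by split=> //; apply: (subspace0 (@homE_subspace K n _)).
  have [wI|wI] := eqVneq (w I) 0.
    rewrite wI; have -> : poly_series 0 = 0 by exact: act0.
    by split=> //; apply: (subspace0 (@homE_subspace K n _)).
  have cI := fw I wI; split=> [|]; last by rewrite cI /=; lia.
  apply/poly_series_homE => m /dw; rewrite /cdeg cI D0E; lia.
- move=> w [fw zw dw]; split=> [[eta feta we]|[u [gu tu ou]]].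
    exists (gradeproj (form_cone (- eta))); split.
    + move=> b I; split=> [|nb]; first exact: homproj_homE.
      rewrite /gradeproj /form_cone; case: b nb => [nb|_]; last exact: homproj0.
      have [eI|eI] := eqVneq (eta I) 0.
        by rewrite ffunE eI oppr0 /poly_series act0 homproj0.
      by case: nb; rewrite (feta I eI) /=; lia.
    + by move=> b I; apply/homproj_tail/tl.
    rewrite gradeproj_cdiff cdiff_form_cone.
    rewrite wedge_formN -we.
    have -> : gradeproj (- form_cone (- w)) = form_cone w; last by rewrite subrr.
    apply/funext => b; apply/funext => I; rewrite /gradeproj fctNE /form_cone.
    case: b; last by rewrite oppr0 homproj0.
    rewrite fctNE.
    have -> : - poly_series ((- w) I) = poly_series (w I).
      rewrite ffunE -[- w I]scaleN1r -[_ *: _]addr0 poly_series_linear /poly_series.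
      by rewrite act0 addr0 scaleN1r opprK.
    apply: homproj_id; have [wI|wI] := eqVneq (w I) 0.
      by rewrite wI /poly_series act0; apply: (subspace0 (@homE_subspace K n _)).
    by apply/poly_series_homE => m /dw; rewrite /cdeg (fw I wI) D0E; lia.
  have /cone0/eqP := ou; rewrite subr_eq0 => /eqP wu.
  have uf I : u false I = 0.
    have [h z] := gu false I; have [cI|cI] := eqVneq (#|I| : int) (n%:Z - 1); last first.
      by apply: z; rewrite addn0; apply/eqP.
    have cI' : #|I| = n.-1 by lia.
    apply: homE_neg h => //; rewrite /cdeg D0E cI' /=; move: s_large; lia.
  have /choice[eta heta] : forall I, exists p, poly_series p = - u true I.
    move=> I; have [h z] := gu true I.
    apply: (poly_series_surj (k := cdeg e s D0 true I)).
      exact: (subspaceN (@tailreg_subspace K n 0)).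
    exact: (subspaceN (@homE_subspace K n _)).
  exists (finfun eta).
    move=> I; rewrite ffunE => eI; have [h z] := gu true I.
    apply: contrapT => nI; move: eI; rewrite (poly_series_inj (p := eta I)) ?eqxx //.
    rewrite heta z ?oppr0 //; move: nI => /=; lia.
  apply/eqP; rewrite -subr_eq0; apply/eqP/form_cone_inj.
  rewrite addrC -scaleN1r form_cone_linear wu scaleN1r -cdiff_form_cone -raddfD /=.
  have -> : form_cone (finfun eta) + u = 0; last exact: raddf0.
  apply/funext => b; apply/funext => I; rewrite !fctDE /form_cone; case: b.
    by rewrite ffunE heta addNr.
  by rewrite add0r uf.
- move=> c [gc tc /cone0 oc].
  have cf I : c false I = 0.
    have [h z] := gc false I; have [cI|cI] := eqVneq #|I| n; last first.
      by apply: z; rewrite addn0; case=> /eqP; rewrite (negPf cI).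
    apply: homE_neg h => //; rewrite /cdeg D0E cI ne /=; move: s_large; lia.
  have /choice[w hw] : forall I, exists p, poly_series p = c true I.
    by move=> I; have [h z] := gc true I; apply: poly_series_surj h.
  have wc : form_cone (finfun w) = c.
    apply/funext => b; apply/funext => I; rewrite /form_cone; case: b.
      by rewrite ffunE hw.
    by rewrite cf.
  exists (finfun w); last first.
    by rewrite wc subrr; apply: (subspace0 (coboundaries_subspace _ _ _ _ _ _ _)).
  have nform : is_form n.-1 (finfun w).
    move=> I; rewrite ffunE => wI; have [h z] := gc true I.
    apply: contrapT => nI; move: wI; rewrite (poly_series_inj (p := w I)) ?eqxx //.
    by rewrite hw z //; move: nI => /=; lia.
  split=> //.
  + apply: form_cone_inj; apply/eqP; rewrite -oppr_eq0 -cdiff_form_cone wc.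
    exact/eqP.
  + move=> I m mI; have [h z] := gc true I.
    have cI : #|I| = n.-1 by apply: nform; apply: contraTneq mI => ->; rewrite msupp0.
    move: h; rewrite -hw => /poly_series_homE/(_ m); rewrite ffunE in mI.
    by move/(_ mI); rewrite /cdeg cI D0E; lia.
Qed.

End Forms.

(** * The torsion-free quotient of the Jacobian module *)

Section OrderOfVanishing.
Variables (K : fieldType) (n : nat).
Implicit Types (p q : {mpoly K[n]}).

Definition order_ge (k : nat) : set {mpoly K[n]} :=
  [set p | forall m, m \in msupp p -> (k <= mdeg m)%N].

Lemma order_geD k p q : order_ge k p -> order_ge k q -> order_ge k (p + q).
Proof.
move=> hp hq m /msuppD_le; rewrite mem_cat => /orP[]; [exact: hp|exact: hq].
Qed.

Lemma order_ge0 k : order_ge k 0. Proof. by move=> m; rewrite msupp0. Qed.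

Lemma order_geM k k' p q : order_ge k p -> order_ge k' q -> order_ge (k + k') (p * q).
Proof.
move=> hp hq m /msuppM_le /allpairsP[[a b] /= [ap bq ->]].
by rewrite mdegD leq_add ?hp ?hq.
Qed.

Lemma irrelevant_order p : @irrelevant_ideal K n p -> order_ge 1 p.
Proof.
move=> [r [hr ->]]; rewrite big_seq; elim/big_ind: _ => [||x /hr[i ->]].
- exact: order_ge0.
- exact: order_geD.
- rewrite -[1%N]add0n; apply: order_geM => // m; rewrite msuppX mem_seq1 => /eqP->.
  by rewrite mdeg1.
Qed.

Lemma ideal_pow_order j p : ideal_pow (@irrelevant_ideal K n) j p -> order_ge j p.
Proof.
move=> [r [hr ->]]; rewrite big_seq; elim/big_ind: _ => [||x /hr[u [hu ->]]].
- exact: order_ge0.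
- exact: order_geD.
- apply: (@order_geM 0 j) => //.
  elim: j u hu {hr} => [|j IH] u hu; first by rewrite big_ord0.
  rewrite big_ord_recl; apply: (@order_geM 1 j).
    exact: irrelevant_order.
  by apply: IH => i; apply: hu.
Qed.

Lemma lin_irrelevant l : l \is 1.-homog -> @irrelevant_ideal K n l.
Proof.
move=> /dhomogP hl.
exists [seq ((l@_m)%:MP, 'X_[m]) | m <- msupp l]; split=> [x|].
  move=> /mapP[m ml ->] /=; have /= /eqP/mdeg1P[i /eqP->] := hl m ml.
  by exists i.
by rewrite big_map {1}(mpolyE l); apply: eq_bigr => m _; rewrite mul_mpolyC.
Qed.

Lemma lin_ideal_pow l j : l \is 1.-homog -> ideal_pow (@irrelevant_ideal K n) j (l ^+ j).
Proof.
move=> hl; exists [:: (1, l ^+ j)]; split=> [x|]; last by rewrite big_seq1 mul1r.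
rewrite mem_seq1 => /eqP-> /=; exists (fun=> l); split=> [i|].
  exact: lin_irrelevant.
by rewrite prodr_const card_ord.
Qed.

End OrderOfVanishing.

Section MuNu.
Variable K : closedFieldType.
Hypothesis Kunc : infinite_fiber K.
Variables (n d : nat) (f : {mpoly K[n]}).
Hypothesis n_gt1 : (1 < n)%N.
Hypothesis d_gt0 : (0 < d)%N.
Hypothesis fhom : f \is d.-homog.
Local Notation g := (fun i : 'I_n => f^`M(i)).
Local Notation e := d.-1.
Local Notation J := (gen_ideal g).
Local Notation R := (@homog_part K n).

Let Jid := gen_ideal_ideal g.
Let ghom i : g i \is e.-homog. Proof. exact: dhomog_mderiv. Qed.

Variable l : {mpoly K[n]}.
Hypothesis lhom : l \is 1.-homog.
Hypothesis lJ : forall v : 'rV[K]_n,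
  (forall i, (g i).@[v ord0] = 0) -> l.@[v ord0] = 0 -> v = 0.

Lemma top_form (w : forms K n) D : is_form n w -> D != finset.setT -> w D = 0.
Proof.
move=> fw DT; apply/eqP/negPn/negP => /fw cD; move/negP: DT; apply.
by rewrite eqEcard finset.subsetT cardsT card_ord cD leqnn.
Qed.

(** The coefficients of an (n-1)-form are arbitrary, and up to sign its wedge
    product with df is their combination with the partial derivatives. *)
Lemma df_image_top (w : forms K n) p : is_form n w ->
  df_image f n.-1 (form_scale p w) <-> J (p * w finset.setT).
Proof.
move=> fw; split=> [[eta _ /ffunP/(_ finset.setT)]|[h hp]].
  rewrite wedge_differential ffunE => ->.
  apply: (ideal_sum Jid) => i _; rewrite -mul_mpolyC; apply: (idealM Jid).
  by apply: (idealMr Jid); apply: (gen_ideal_gen g i).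
pose T : {set 'I_n} := finset.setT.
exists [ffun I => \sum_(i | I == (T :\ i)%SET) ksign K i T *: h i].
  move=> I; rewrite ffunE => hI; have [i /eqP->|nI] := pickP (fun i => I == (T :\ i)%SET).
    by have := cardsD1 i T; rewrite cardsT card_ord finset.inE /=; lia.
  by move: hI; rewrite big_pred0 ?eqxx.
apply/ffunP => D; rewrite wedge_differential ffunE.
have [->|DT] := eqVneq D T.
  rewrite hp; apply: congr_big => // [i|i _]; first by rewrite finset.inE.
  rewrite ffunE (big_pred1 i) => [|j].
    by rewrite -scalerAr scalerA ksign_sqr scale1r mulrC.
  apply/eqP/eqP => [/finset.setP/(_ j)|->//].
  by rewrite !finset.inE eqxx andbT; case: eqP.
rewrite (top_form fw DT) mulr0 big1 // => i iD.
rewrite ffunE big_pred0 ?mulr0 ?scaler0 // => j; apply/negP => /eqP DTj.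
case/negP: DT; rewrite eqEcard finset.subsetT cardsT card_ord /=.
have := cardsD1 i D; have := cardsD1 j T; rewrite -DTj iD cardsT card_ord finset.inE /=.
by lia.
Qed.

Definition torsion : set {mpoly K[n]} := [set p | exists s, J (p * l ^+ s)].

Lemma torsion_ideal : is_ideal torsion.
Proof.
split=> [|p q [s hp] [s' hq]|a p [s hp]].
- by exists 0%N; rewrite mul0r; apply: (ideal0 Jid).
- exists (s + s')%N; have -> : (p + q) * l ^+ (s + s') =
      l ^+ s' * (p * l ^+ s) + l ^+ s * (q * l ^+ s') by rewrite exprD; ring.
  by apply: (idealD Jid); apply: (idealM Jid).
- by exists s; rewrite -mulrA; apply: (idealM Jid).
Qed.

(** Torsion with respect to the maximal ideal is torsion with respect to l,
    because a power of the maximal ideal lies in (J, l^s). *)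
Lemma torsion_formsP (w : forms K n) :
  torsion_forms f w <-> is_form n w /\ torsion (w finset.setT).
Proof.
split=> [[fw [j0 hj]]|[fw [s hs]]]; split=> //.
  exists j0; rewrite mulrC; apply/(df_image_top _ fw)/(hj j0 (leqnn _)).
  exact: lin_ideal_pow.
pose Q : set {mpoly K[n]} := [set p | J (p * w finset.setT)].
have Qid : is_ideal Q.
  split=> [|p q hp hq|a p hp]; rewrite /Q /=.
  - by rewrite mul0r; apply: (ideal0 Jid).
  - by rewrite mulrDl; apply: (idealD Jid).
  - by rewrite -mulrA; apply: (idealM Jid).
have [N hN] := slice_primary Kunc lJ s.
have QN i : Q ('X_i ^+ N).
  have [h hh] := hN i; rewrite -(subrK (h * l ^+ s) ('X_i ^+ N)).
  apply: (idealD Qid); first exact: (idealMr Jid).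
  by apply: (idealM Qid); rewrite /Q /= mulrC.
exists (n * N)%N => j jN p /ideal_pow_order hp; apply/(df_image_top _ fw).
apply: (primary_homog Qid QN) => [m /hp|]; last exact: ltnW.
exact: leq_trans.
Qed.

Definition homog_int (c : int) : set {mpoly K[n]} :=
  [set p | forall m, m \in msupp p -> (mdeg m)%:Z = c].

Lemma homog_int_subspace c : subspace (homog_int c).
Proof.
split=> [m|a u v hu hv m]; first by rewrite msupp0.
by move/msuppD_le; rewrite mem_cat => /orP[/msuppZ_le|]; [exact: hu|exact: hv].
Qed.

Lemma homog_int_shift c s t p : (t%:Z = s%:Z + c) -> homog_int c p -> R t (p * l ^+ s).
Proof.
move=> tc hp; have [->|p0] := eqVneq p 0; first by rewrite mul0r; apply: rpred0.
have /hp mc := mlead_supp p0.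
have -> : t = (mdeg (mlead p) + s)%N by lia.
apply: dhomogM; last exact: lin_exp_homog.
by apply/dhomogP => m /hp; rewrite -mc => -[].
Qed.

Lemma mu_dim k mu : has_quot_dim (homog_int (k - n%:Z)) torsion mu -> mu'' f k = mu.
Proof.
have Us : subspace [set w : forms K n | is_form n w /\ form_degree k w].
  by apply: subspaceI; [exact: is_form_subspace|exact: form_degree_subspace].
have Ts : subspace (torsion_forms f).
  have -> : torsion_forms f = [set w | is_form n w] `&` [set w | torsion (w finset.setT)].
    by apply/seteqP; split=> w /torsion_formsP.
  apply: subspaceI; first exact: is_form_subspace.
  split=> [|a u v hu hv]; rewrite /= !ffunE; first exact: (ideal0 torsion_ideal).
  apply: (idealD torsion_ideal) => //; rewrite -mul_mpolyC.
  exact: (idealM torsion_ideal).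
move=> h; apply: quot_dimE => //.
apply: (has_quot_dim_preimage (phi := fun w : forms K n => w finset.setT)) h => //.
- exact: homog_int_subspace.
- exact/ideal_subspace/torsion_ideal.
- by move=> a u v; rewrite !ffunE.
- by move=> w [fw dw] m /dw; rewrite cardsT card_ord; lia.
- by move=> w [fw _]; split=> [/torsion_formsP[]//|tw]; apply/torsion_formsP.
- move=> p hp; exists [ffun I => if I == finset.setT then p else 0].
    split=> [I|I m]; rewrite ffunE; case: (I =P finset.setT) => [->|_]; rewrite ?eqxx //.
    + by rewrite cardsT card_ord.
    + by move/hp; rewrite cardsT card_ord; lia.
    + by rewrite msupp0.
  by rewrite ffunE eqxx subrr; apply: (ideal0 torsion_ideal).
Qed.

Variables (k0 tau : nat).
Hypothesis tau_dim : forall k, (k0 <= k)%N -> has_quot_dim (R k) J tau.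
Hypothesis lin_inj : forall k s p, (k0 <= k)%N -> R k p -> J (p * l ^+ s) -> J p.

(** For s large, R/(J, l^s) in degree t = s + c has dimension tau minus that of
    the torsion-free quotient in degree c, and it is dual to N. *)
Theorem mu_nu_sum (k : int) : (mu'' f k + nu f d ((n * d)%N%:Z - k))%N = tau.
Proof.
pose c : int := k - n%:Z; pose kap : int := (n * d)%N%:Z - k - d%:Z.
(* s makes t at least k0, and is large enough for forms_dim. *)
pose s := (k0 + absz c + absz (kap - n.-1%:Z + e%:Z)).+1.
pose t := absz (s%:Z + c).
have tE : t%:Z = s%:Z + c by rewrite /t /s; lia.
have tk : (k0 <= t)%N by move: tE; rewrite /s; lia.
have Js := ideal_subspace Jid; have Rs := @homog_part_subspace K n.
have Sid := slice_ideal_ideal g l s; have Ss := ideal_subspace Sid.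
have [|r hr] := homog_quot_dim (Rs t) Ss (k := t); first by [].
have RSs := subspaceI (Rs t) Ss; have RJs := subspaceI (Rs t) Js.
have [|mu hmu] := homog_quot_dim RSs RJs (k := t); first by move=> p [].
have JS : J `<=` slice_ideal g l s by apply: slice_ideal_sub.
have -> : tau = (mu + r)%N.
  rewrite addnC; apply: (has_quot_dim_unique (Rs t) RJs).
    by apply: has_quot_dim_ext (tau_dim tk) => // u Ru; split=> [|[]].
  apply: has_quot_dim_add hmu => //.
  - by move=> p [Rp Jp]; split=> //; apply: JS.
  - by apply: has_quot_dim_ext hr => // u Ru; split=> [|[]].
congr (_ + _)%N.
  apply: mu_dim; apply: (has_quot_dim_preimage (phi := fun p => p * l ^+ s)) hmu => //.
  - exact: homog_int_subspace.
  - exact/ideal_subspace/torsion_ideal.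
  - by move=> a u v; rewrite mulrDl scalerAl.
  - move=> p hp; split; first exact: (homog_int_shift tE hp).
    exact: slice_ideal_exp.
  - move=> p hp; have Rp := homog_int_shift tE hp; split=> [[s' hs']|[_ Jp]]; last by exists s.
    split=> //; have [ss'|s's] := leqP s s'.
      by apply: (lin_inj (s := (s' - s)%N) tk Rp); rewrite -mulrA -exprD subnKC.
    by rewrite -(subnK (ltnW s's)) addnC exprD mulrA; apply: (idealMr Jid).
  - move=> p [Rp [h /(gen_ideal_pihomog ghom t)]]; rewrite raddfB /= pihomog_dE //.
    have [c0|c0] := leP 0 c.
      have -> : pihomog (@mdeg n) t (h * l ^+ s) = pihomog (@mdeg n) (absz c) h * l ^+ s.
        by rewrite -(pihomog_homogM _ _ (lin_exp_homog lhom s)); congr pihomog; lia.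
      move=> hJ.
      exists (pihomog (@mdeg n) (absz c) h).
        by move=> m; have /dhomogP/(_ m) := pihomogP (@mdeg n) (absz c) h => hm /hm /= ->; lia.
      split=> //; apply: (subspaceB (Rs t)) => //; apply: (homog_int_shift tE) => m.
      by have /dhomogP/(_ m) := pihomogP (@mdeg n) (absz c) h => hm /hm /= ->; lia.
    rewrite (pihomog_homogM_lt (e := s)) ?lin_exp_homog //; last by lia.
    rewrite subr0 => Jp; exists 0; first exact: (subspace0 (homog_int_subspace _)).
    by rewrite mul0r subr0.
apply: quot_dimE; [exact: closed_forms_subspace|exact: df_image_subspace|].
have ne : (n * d = n.-1 * e + n.-1 + e + 1)%N.
  by rewrite -{1}(prednK (ltnW n_gt1)) -{1}(prednK d_gt0) mulSn mulnS; lia.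
apply: (@forms_dim _ _ _ e s l (- (n + t)%N%:Z)) => //.
- exact: lin_exp_homog.
- rewrite -/kap /kap ne; move: tE n_gt1 d_gt0; rewrite /c; lia.
- by rewrite -/kap /s; lia.
exact: koszul_duality.
Qed.

End MuNu.

(** * Dehomogenization *)

Section Euler.
Variables (K : fieldType) (n : nat).
Implicit Types (f p : {mpoly K[n]}).

Lemma mderivXU (i j : 'I_n) : ('X_j : {mpoly K[n]})^`M(i) = (j == i)%:R.
Proof.
rewrite mderivX mnm1E; case: eqP => [->|_]; last by rewrite scale0r.
have -> : (U_(i) - U_(i) = 0 :> 'X_{1..n})%MM by apply/mnmP => k; rewrite mnmBE subnn mnm0E.
by rewrite mpolyX0 scale1r.
Qed.

Lemma euler d f : f \is d.-homog -> \sum_i 'X_i * f^`M(i) = d%:R *: f.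
Proof.
move=> /dhomogP hf; under eq_bigr do rewrite {1}(mpolyE f) raddf_sum mulr_sumr.
rewrite exchange_big [in RHS](mpolyE f) scaler_sumr !big_seq; apply: eq_bigr => m mf /=.
under eq_bigr do rewrite mderivZ mderivX -!scalerAr.
rewrite (eq_bigr (fun i => (m i)%:R *: (f@_m *: 'X_[m]))) => [|i _].
  by rewrite -scaler_suml -natr_sum -mdegE; have /= -> := hf m mf.
rewrite !scalerA mulrC; have [->|mi] := eqVneq (m i) 0%N; first by rewrite mul0r !scale0r.
rewrite -mpolyXD; congr (_ *: 'X_[_]); apply/mnmP => k.
by rewrite mnmDE mnmBE mnm1E; case: eqP => [<-|]; lia.
Qed.

End Euler.

Lemma varX_homog (K : fieldType) n (j : 'I_n) k :
  ('X_j : {mpoly K[n]}) ^+ k \is k.-homog.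
Proof.
have := @dhomogMn _ K (@mdeg n) 1 'X_j k; rewrite mul1n; apply.
by rewrite dhomogX; apply/eqP/mdeg1.
Qed.

Section Dehomogenize.
Variables (K : closedFieldType) (n : nat) (i : 'I_n).
Hypothesis Kunc : infinite_fiber K.
Implicit Types (p : {mpoly K[n]}) (a : {mpoly K[n.-1]}).

Local Notation deh := (dehomogenize (K := K) i).

Let chart_coords : n.-tuple {mpoly K[n.-1]} :=
  [tuple if unlift i j is Some k then 'X_k else 1 | j < n].
HB.instance Definition _ := GRing.RMorphism.copy deh (comp_mpoly chart_coords).
HB.instance Definition _ := GRing.Linear.copy deh (comp_mpoly chart_coords).

Lemma dehZ c p : deh (c *: p) = c *: deh p.
Proof. exact: comp_mpolyZ. Qed.

Lemma deh_var : deh 'X_i = 1.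
Proof. by rewrite /dehomogenize comp_mpolyXU -tnth_nth tnth_mktuple unlift_none. Qed.

Lemma deh_lift k : deh 'X_(lift i k) = 'X_k.
Proof. by rewrite /dehomogenize comp_mpolyXU -tnth_nth tnth_mktuple liftK. Qed.

Lemma deh_mderiv p k : (deh p)^`M(k) = deh (p^`M(lift i k)).
Proof.
elim/mpolyind: p => [|c m p _ _ IH]; first by rewrite raddf0 !mderiv0 raddf0.
rewrite raddfD /= !mderivD IH raddfD /=; congr (_ + _).
rewrite dehZ !mderivZ dehZ; congr (_ *: _) => {c p IH}.
rewrite mpolyXE_id; elim/big_ind: _ => [|p q hp hq|j _].
- by rewrite rmorph1 -[1]/(1%:MP) -[X in X^`M(_)]/(1%:MP) !mderivC raddf0.
- by rewrite rmorphM !mderivM rmorphD !rmorphM hp hq.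
- elim: (m j) => [|e IH].
    by rewrite !expr0 rmorph1 -[1]/(1%:MP) -[X in X^`M(_)]/(1%:MP) !mderivC raddf0.
  rewrite exprS rmorphM !mderivM rmorphD !rmorphM /= IH; congr (_ * _ + _).
  case: (unliftP i j) => [k' ->|->].
    by rewrite deh_lift !mderivXU (inj_eq lift_inj) rmorph_nat.
  rewrite deh_var -[1]/(1%:MP) mderivC mderivXU (negPf (neq_lift _ _)).
  by rewrite rmorph_nat.
Qed.

Lemma meval_deh e p (v : 'rV[K]_n) : v ord0 i != 0 -> p \is e.-homog ->
  p.@[v ord0] = v ord0 i ^+ e * (deh p).@[chart_point i v].
Proof.
move=> vi pe; rewrite comp_mpoly_meval -(meval_homog _ _ pe); apply: meval_eq => j.
rewrite tnth_mktuple; case: (unliftP i j) => [k ->|->].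
  by rewrite mevalXU /chart_point mulrCA mulfV // mulr1.
by rewrite rmorph1 mulr1.
Qed.

(** By homogeneity p vanishes wherever x_i does not, so x_i p vanishes
    everywhere; the Nullstellensatz for the zero ideal concludes. *)
Lemma deh_inj e p : p \is e.-homog -> deh p = 0 -> p = 0.
Proof.
move=> pe p0.
have id0 : is_ideal [set (0 : {mpoly K[n]})].
  by split=> //= [x y -> ->|a x ->]; rewrite ?addr0 ?mulr0.
have [|N] := nullstellensatz (g := 'X_i * p) Kunc id0.
  move=> v _; have ev : v =1 (\row_j v j) ord0 by move=> j; rewrite mxE.
  rewrite mevalM mevalXU; have [->|vi] := eqVneq (v i) 0; first by rewrite mul0r.
  rewrite (meval_eq _ ev) (meval_deh _ pe) ?p0 ?meval0 ?mulr0 //.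
  by rewrite -ev.
move/eqP; rewrite expf_eq0 mulf_eq0 => /andP[_ /orP[/eqP h|/eqP//]].
by have := mcoeffXU K i i; rewrite h mcoeff0 eqxx => /esym/eqP; rewrite oner_eq0.
Qed.

Lemma homogenize a : exists M0, forall M, (M0 <= M)%N ->
  exists2 A : {mpoly K[n]}, A \is M.-homog & deh A = a.
Proof.
elim/mpolyind: a => [|c m a _ _ [M0 IH]].
  by exists 0%N => M _; exists 0; [exact: rpred0|exact: raddf0].
exists (maxn (mdeg m) M0) => M; rewrite geq_max => /andP[mM M0M].
have [A Ah Ad] := IH M M0M.
pose X := \prod_k ('X_(lift i k) : {mpoly K[n]}) ^+ m k.
have Xh : X \is (mdeg m).-homog.
  rewrite /X mdegE; elim/big_rec2: _ => [|k x y _ xy]; first exact: dhomog1.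
  by apply: dhomogM => //; apply: varX_homog.
exists (c *: (X * 'X_i ^+ (M - mdeg m)) + A).
  apply: rpredD => //; apply: rpredZ.
  by have := dhomogM Xh (varX_homog K i (M - mdeg m)); rewrite subnKC.
rewrite raddfD /= Ad dehZ rmorphM rmorphXn /= deh_var expr1n mulr1.
congr (_ *: _ + _); rewrite /X rmorph_prod mpolyXE_id; apply: eq_bigr => k _.
by rewrite rmorphXn /= deh_lift.
Qed.

End Dehomogenize.

(** * Tjurina algebras as localizations of the Jacobian algebra *)

Section LocalRing.
Variables (K : fieldType) (m : nat) (q : 'I_m -> K).
Local Notation rat := (@rat_of_poly K m).
Local Notation L := (local_ring q).

HB.instance Definition _ := GRing.RMorphism.copy rat (@tofrac {mpoly K[m]}).

Lemma rat_inj : injective rat.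
Proof. by move=> a b /eqP; rewrite tofrac_eq => /eqP. Qed.

Lemma rat_neq0 b : b.@[q] <> 0 -> rat b != 0.
Proof.
move=> bq; rewrite /rat_of_poly tofrac_eq0; apply/eqP => b0.
by apply: bq; rewrite b0 meval0.
Qed.

Lemma local_ring_frac a b : b.@[q] <> 0 -> L (rat a / rat b).
Proof. by move=> bq; exists a, b. Qed.

Lemma local_ring_poly a : L (rat a).
Proof.
exists a, 1; split; first by rewrite meval1; apply/eqP/oner_neq0.
by rewrite rmorph1 divr1.
Qed.

Lemma local_ringD x y : L x -> L y -> L (x + y).
Proof.
move=> [a [b [bq ->]]] [c [d [dq ->]]]; exists (a * d + c * b), (b * d); split.
  by rewrite mevalM => /eqP; rewrite mulf_eq0 => /orP[/eqP|/eqP].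
by rewrite addf_div ?rat_neq0 // -!rmorphM -rmorphD.
Qed.

Lemma local_ringM x y : L x -> L y -> L (x * y).
Proof.
move=> [a [b [bq ->]]] [c [d [dq ->]]]; exists (a * c), (b * d); split.
  by rewrite mevalM => /eqP; rewrite mulf_eq0 => /orP[/eqP|/eqP].
by rewrite mulf_div -!rmorphM.
Qed.

Lemma local_ring_subspace : subspace L.
Proof.
split=> [|c x y Lx Ly].
  by have := local_ring_poly 0; rewrite rmorph0.
by apply: local_ringD => //; apply: local_ringM => //; apply: local_ring_poly.
Qed.

Lemma common_denominator (I : finType) (x : I -> ratfun K m) :
  (forall i, L (x i)) -> exists (b : {mpoly K[m]}) (a : I -> {mpoly K[m]}),
    b.@[q] <> 0 /\ forall i, rat b * x i = rat (a i).
Proof.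
move=> Lx.
have /choice[ab hab] : forall i, exists ab : {mpoly K[m]} * {mpoly K[m]},
    ab.2.@[q] <> 0 /\ x i = rat ab.1 / rat ab.2.
  by move=> i; have [a [b h]] := Lx i; exists (a, b).
exists (\prod_i (ab i).2), (fun i => (ab i).1 * \prod_(j | j != i) (ab j).2).
split=> [|i].
  rewrite rmorph_prod => /eqP; rewrite prodf_seq_eq0 => /hasP[j _ /= /eqP].
  by case: (hab j).
have [bi ->] := hab i; rewrite (bigD1 i) //= !rmorphM.
by rewrite mulrAC [_ * (_ / _)]mulrCA divff ?mulr1 // rat_neq0.
Qed.

Variable h : {mpoly K[m]}.
Local Notation T := (tjurina_ideal h q).

Lemma tjurinaD x y : T x -> T y -> T (x + y).
Proof.
move=> [a [b [La Lb ->]]] [c [d [Lc Ld ->]]]; exists (a + c), (fun j => b j + d j).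
split=> [|j|]; [exact: local_ringD|exact: local_ringD|].
rewrite mulrDl addrACA -big_split; congr (_ + _); apply: eq_bigr => j _.
by rewrite mulrDl.
Qed.

Lemma tjurinaM x y : L x -> T y -> T (x * y).
Proof.
move=> Lx [a [b [La Lb ->]]]; exists (x * a), (fun j => x * b j).
split=> [|j|]; [exact: local_ringM|exact: local_ringM|].
rewrite mulrDr mulrA mulr_sumr; congr (_ + _); apply: eq_bigr => j _.
by rewrite mulrA.
Qed.

Lemma tjurina0 : T 0.
Proof.
exists 0, (fun=> 0); split; [exact: subspace0 local_ring_subspace|
  by move=> _; exact: subspace0 local_ring_subspace|].
by rewrite mul0r big1 ?addr0 // => j _; rewrite mul0r.
Qed.

Lemma tjurina_h : T (rat h).
Proof.
exists 1, (fun=> 0); split.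
- by have := local_ring_poly 1; rewrite rmorph1.
- by move=> _; exact: subspace0 local_ring_subspace.
- by rewrite mul1r big1 ?addr0 // => j _; rewrite mul0r.
Qed.

Lemma tjurina_dh k : T (rat h^`M(k)).
Proof.
exists 0, (fun j => (j == k)%:R); split.
- exact: subspace0 local_ring_subspace.
- move=> j; case: eqP => _; last exact: subspace0 local_ring_subspace.
  by have := local_ring_poly 1; rewrite rmorph1.
- rewrite mul0r add0r (bigD1 k) //= eqxx mul1r big1 ?addr0 // => j /negPf->.
  by rewrite mul0r.
Qed.

Lemma tjurina_subspace : subspace T.
Proof.
split=> [|c x y Tx Ty]; first exact: tjurina0.
by apply: tjurinaD => //; apply: tjurinaM => //; apply: local_ring_poly.
Qed.

Lemma tjurina_unit b x : b.@[q] <> 0 -> T (rat b * x) -> T x.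
Proof.
move=> bq Tx; have := tjurinaM (local_ring_frac 1 bq) Tx.
by rewrite rmorph1 div1r mulKf // rat_neq0.
Qed.

End LocalRing.

Section LocalAtPoint.
Variable K : closedFieldType.
Hypothesis Kunc : infinite_fiber K.
Variables (n d : nat) (f : {mpoly K[n]}).
Hypothesis d_unit : d%:R != 0 :> K.
Hypothesis fhom : f \is d.-homog.
Local Notation g := (fun j : 'I_n => f^`M(j)).
Local Notation J := (gen_ideal g).
Let Jid := gen_ideal_ideal g.
Implicit Types (p : {mpoly K[n]}) (v w : 'rV[K]_n).

(** The contraction to R of the extension of J to the homogeneous localization
    at the line through v. *)
Definition germ_ideal v : set {mpoly K[n]} :=
  [set p | exists b m, [/\ b \is m.-homog, b.@[v ord0] != 0 & J (b * p)]].

Lemma germ_ideal_ideal v : is_ideal (germ_ideal v).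
Proof.
split=> [|p p' [b [m [bh bv Jp]]] [b' [m' [bh' bv' Jp']]]|a p [b [m [bh bv Jp]]]].
- exists 1, 0%N; split; [exact: dhomog1|by rewrite meval1 oner_neq0|].
  by rewrite mulr0; apply: (ideal0 Jid).
- exists (b * b'), (m + m')%N; split; [exact: dhomogM|by rewrite mevalM mulf_neq0|].
  have -> : b * b' * (p + p') = b' * (b * p) + b * (b' * p') by ring.
  by apply: (idealD Jid); apply: (idealM Jid).
- exists b, m; split=> //; rewrite mulrCA; exact: (idealM Jid).
Qed.

Lemma germ_ideal_sub v : J `<=` germ_ideal v.
Proof.
move=> p Jp; exists 1, 0%N; split; [exact: dhomog1|by rewrite meval1 oner_neq0|].
by rewrite mul1r.
Qed.

Lemma germ_ideal_unit v b m p : b \is m.-homog -> b.@[v ord0] != 0 ->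
  germ_ideal v (b * p) -> germ_ideal v p.
Proof.
move=> bh bv [b' [m' [bh' bv' Jp]]]; exists (b' * b), (m' + m)%N.
by split; [exact: dhomogM|rewrite mevalM mulf_neq0|rewrite -mulrA].
Qed.

Lemma germ_ideal_pihomog v k p : germ_ideal v p -> germ_ideal v (pihomog (@mdeg n) k p).
Proof.
move=> [b [m [bh bv Jp]]]; exists b, m; split=> //.
rewrite mulrC -(pihomog_homogM _ _ bh) mulrC.
by apply: gen_ideal_pihomog Jp => i; apply: dhomog_mderiv fhom.
Qed.

Lemma jacobian_euler : J f.
Proof.
have Jx : J (\sum_i 'X_i * f^`M(i)).
  by apply: (ideal_sum Jid) => i _; apply: (idealM Jid); apply: (gen_ideal_gen g i).
have := idealM Jid (d%:R^-1)%:MP Jx.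
by rewrite (euler fhom) mul_mpolyC scalerA mulVf ?scale1r.
Qed.

Variables (i : 'I_n) (v : 'rV[K]_n).
Hypothesis vi : v ord0 i != 0.
Local Notation deh := (dehomogenize (K := K) i).
Local Notation cp := (chart_point i v).
Local Notation rat := (@rat_of_poly K n.-1).
Local Notation T := (tjurina_ideal (deh f) cp).

Lemma deh_neq0 e p : p \is e.-homog -> p.@[v ord0] != 0 -> (deh p).@[cp] <> 0.
Proof. by move=> pe; rewrite (meval_deh vi pe) mulf_eq0 negb_or => /andP[_ /eqP]. Qed.

Lemma deh_neq0_inv e p : p \is e.-homog -> (deh p).@[cp] <> 0 -> p.@[v ord0] != 0.
Proof.
by move=> pe /eqP h; rewrite (meval_deh vi pe) mulf_neq0 // expf_neq0.
Qed.

(** The partial derivative in the direction of the chart variable is expressed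
    through h and the other ones by Euler's formula. *)
Lemma tjurina_partial j : T (rat (deh f^`M(j))).
Proof.
case: (unliftP i j) => [k ->|->].
  by rewrite -deh_mderiv; apply: tjurina_dh.
have := congr1 deh (euler fhom); rewrite rmorph_sum /= (bigD1 i) //= rmorphM /=.
rewrite deh_var mul1r => /eqP; rewrite eq_sym -subr_eq => /eqP <-.
rewrite dehZ rmorphB /= -mul_mpolyC rmorphM /=.
have Ts := tjurina_subspace cp (deh f); apply: (subspaceB Ts).
  by apply: tjurinaM; [exact: local_ring_poly|exact: tjurina_h].
rewrite rmorph_sum; apply: (subspace_sum Ts) => j' ji.
case: (unliftP i j') ji => [k ->|->]; last by rewrite eqxx.
rewrite !rmorphM /= -deh_mderiv => _.
by apply: tjurinaM; [exact: local_ring_poly|exact: tjurina_dh].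
Qed.

(** Clear denominators in one direction, and homogenize the resulting identity
    in the chart in a common large degree for the other. *)
Lemma tjurina_germ e p : p \is e.-homog -> germ_ideal v p <-> T (rat (deh p)).
Proof.
move=> pe; split=> [[b [m [bh bv [c bp]]]]|[g0 [g' [Lg0 Lg' pE]]]].
  apply: (tjurina_unit (b := deh b)); first exact: deh_neq0 bh bv.
  rewrite -!rmorphM /= bp (raddf_sum deh) (raddf_sum rat) /=.
  apply: (subspace_sum (tjurina_subspace _ _)) => j _; rewrite !rmorphM /=.
  by apply: tjurinaM; [exact: local_ring_poly|exact: tjurina_partial].
pose x (o : option 'I_n.-1) := if o is Some k then g' k else g0.
have [B [A [Bq hA]]] : exists (b : {mpoly K[n.-1]}) (a : option 'I_n.-1 -> {mpoly K[n.-1]}),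
    b.@[cp] <> 0 /\ forall o, rat b * x o = rat (a o).
  by apply: common_denominator; case.
have BE : B * deh p = A None * deh f + \sum_k A (Some k) * deh f^`M(lift i k).
  apply: rat_inj; rewrite rmorphM /= pE mulrDr mulrA (hA None) rmorphD rmorphM /=.
  congr (_ + _); rewrite mulr_sumr rmorph_sum; apply: eq_bigr => k _.
  by rewrite mulrA (hA (Some k)) rmorphM /= deh_mderiv.
have [M0 hB] := homogenize i B.
have /choice[M1 hA1] := fun o => homogenize i (A o).
(* Every summand below then has a multiplier of degree at least its bound. *)
pose M := (M0 + \sum_o M1 o + d)%N.
have leM o : (M1 o <= \sum_o M1 o)%N by rewrite (bigD1 o) //= leq_addr.
have [b bh bd] := hB M (leq_trans (leq_addr _ M0) (leq_addr _ _)).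
have [a0 a0h a0d] : exists2 a0 : {mpoly K[n]}, a0 \is (M + e - d).-homog & deh a0 = A None.
  by apply: hA1; have := leM None; rewrite /M; lia.
have /choice[a1 ha1] : forall k, exists a : {mpoly K[n]},
    a \is (M + e - d.-1).-homog /\ deh a = A (Some k).
  move=> k; have [|a ah ad] := hA1 (Some k) (M + e - d.-1)%N; last by exists a.
  by have := leM (Some k); rewrite /M; lia.
exists b, M; split=> //; first by apply: (deh_neq0_inv bh); rewrite bd.
have -> : b * p = a0 * f + \sum_k a1 k * f^`M(lift i k).
  apply/eqP; rewrite -subr_eq0; apply/eqP/(deh_inj Kunc (i := i) (e := (M + e)%N)).
    apply: rpredB; first exact: dhomogM.
    apply: rpredD.
      have -> : (M + e = (M + e - d) + d)%N by rewrite /M; lia.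
      exact: dhomogM.
    apply: rpred_sum => k _; have -> : (M + e = (M + e - d.-1) + d.-1)%N by rewrite /M; lia.
    by apply: dhomogM; [case: (ha1 k)|exact: dhomog_mderiv].
  rewrite rmorphB rmorphD !rmorphM /= a0d bd BE rmorph_sum /=; apply/eqP.
  rewrite subr_eq0; apply/eqP; congr (_ + _); apply: eq_bigr => k _.
  by rewrite rmorphM /=; case: (ha1 k) => _ ->.
apply: (idealD Jid); first exact/(idealM Jid)/jacobian_euler.
by apply: (ideal_sum Jid) => k _; apply: (idealM Jid); apply: (gen_ideal_gen g _).
Qed.

End LocalAtPoint.

(** * The Hilbert function of the Jacobian algebra in high degrees *)

Section Global.
Variable K : closedFieldType.
Hypothesis Kunc : infinite_fiber K.
Variables (n d : nat) (f : {mpoly K[n]}).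
Hypothesis d_unit : d%:R != 0 :> K.
Hypothesis fhom : f \is d.-homog.
Local Notation g := (fun j : 'I_n => f^`M(j)).
Local Notation J := (gen_ideal g).
Local Notation R := (@homog_part K n).
Let Jid := gen_ideal_ideal g.
Let ghom j : g j \is d.-1.-homog. Proof. exact: dhomog_mderiv. Qed.
Implicit Types (p : {mpoly K[n]}) (v w : 'rV[K]_n).

Variable l : {mpoly K[n]}.
Hypothesis lhom : l \is 1.-homog.
Variable vs : seq 'rV[K]_n.
Hypothesis vs_neq0 : forall v, v \in vs -> v != 0.
Hypothesis vs_uniq : uniq vs.
Hypothesis vs_distinct : forall v w t, v \in vs -> w \in vs -> w = t *: v -> w = v.
Hypothesis vs_all : forall v, sing_locus f v -> v != 0 ->
  exists2 w, w \in vs & exists t, v = t *: w.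
Hypothesis l_vs : forall v, v \in vs -> l.@[v ord0] != 0.

Local Notation germ := (germ_ideal f).

Lemma meval_scale e p v t : p \is e.-homog -> p.@[(t *: v) ord0] = t ^+ e * p.@[v ord0].
Proof. by move=> pe; rewrite (meval_eq _ (row_scale v t)) (meval_homog _ _ pe). Qed.

Lemma J_sing (Q : set {mpoly K[n]}) v : J `<=` Q ->
  (forall p, Q p -> p.@[v ord0] = 0) -> sing_locus f v.
Proof. by move=> JQ hv j; apply/hv/JQ/(gen_ideal_gen g j). Qed.

Lemma row_of (v : 'I_n -> K) : v =1 (\row_j v j) ord0.
Proof. by move=> j; rewrite mxE. Qed.

Lemma nullstellensatz_row (I : set {mpoly K[n]}) p : is_ideal I ->
  (forall v : 'rV[K]_n, (forall q, I q -> q.@[v ord0] = 0) -> p.@[v ord0] = 0) ->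
  exists N, I (p ^+ N).
Proof.
move=> Iid h; apply: nullstellensatz => // v hv.
rewrite (meval_eq _ (row_of v)); apply: h => q /hv.
by rewrite (meval_eq _ (row_of v)).
Qed.

(** A zero of Q is singular, and the b exclude the points other than 0 of the
    singular lines; so the only possible zero is 0, where l vanishes. *)
Lemma lin_power_in (Q : set {mpoly K[n]}) : is_ideal Q -> J `<=` Q ->
  (forall w, w \in vs -> exists b m, [/\ b \is m.-homog, b.@[w ord0] != 0 & Q b]) ->
  exists N, Q (l ^+ N).
Proof.
move=> Qid JQ hQ; apply: nullstellensatz_row => // v hv.
have [->|v0] := eqVneq v 0.
  by rewrite -(scale0r 0) (meval_scale _ _ lhom) expr1 mul0r.
have [w wvs [t vt]] := vs_all (J_sing JQ hv) v0.
have [b [m [bh bw Qb]]] := hQ w wvs; have := hv b Qb.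
rewrite vt (meval_scale _ _ bh) => /eqP; rewrite mulf_eq0 (negPf bw) orbF.
by rewrite expf_eq0 => /andP[_ /eqP t0]; move: v0; rewrite vt t0 scale0r eqxx.
Qed.

Lemma separating_form v w : v \in vs -> w \in vs -> w != v ->
  exists a, [/\ a \is 1.-homog, a.@[w ord0] != 0 & forall t, a.@[(t *: v) ord0] = 0].
Proof.
move=> vvs wvs wv.
have [j [k h]] : exists j k, (minor2 (v ord0) j k).@[w ord0] <> 0.
  apply: contrapT => h; have [|t wt] := @minor2_zero _ _ v w (vs_neq0 vvs).
    by move=> j k; apply: contrapT => hjk; apply: h; exists j, k.
  by move/eqP: wv; apply; apply: vs_distinct wt.
exists (minor2 (v ord0) j k); split; [exact: minor2_homog|exact/eqP|].
by move=> t; rewrite (meval_eq _ (row_scale v t)) minor2_line.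
Qed.

(** The germ ideals at two singular lines are comaximal: a form vanishing at v,
    times forms vanishing at all other lines, has a power in J. *)
Lemma germ_separate v w : v \in vs -> w \in vs -> w != v ->
  exists F m, [/\ F \is m.-homog, F.@[w ord0] != 0 & germ v F].
Proof.
move=> vvs wvs wv; have [a [ah aw av]] := separating_form vvs wvs wv.
have /choice[c hc] : forall u : 'rV[K]_n, exists c : {mpoly K[n]},
    u \in vs -> v != u ->
    [/\ c \is 1.-homog, c.@[v ord0] != 0 & forall t, c.@[(t *: u) ord0] = 0].
  move=> u; have [uvs|nu] := boolP ((u \in vs) && (v != u)); last first.
    by exists 0 => uvs vu; move: nu; rewrite uvs vu.
  by case/andP: uvs => uvs vu; have [c h] := separating_form uvs vvs vu; exists c.
pose C := \prod_(u <- vs | v != u) c u.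
have [m Ch] : exists m, C \is m.-homog.
  rewrite /C big_seq_cond; elim/big_ind: _ => [|x y [k xk] [k' yk]|u /andP[uvs vu]].
  - by exists 0%N; apply: dhomog1.
  - by exists (k + k')%N; apply: dhomogM.
  - by exists 1%N; case: (hc u uvs vu).
have Cv : C.@[v ord0] != 0.
  rewrite /C rmorph_prod prodf_seq_neq0; apply/allP => u uvs; apply/implyP => vu.
  by case: (hc u uvs vu).
have [N JN] : exists N, J ((a * C) ^+ N).
  apply: nullstellensatz_row => // u hu; rewrite mevalM.
  have [->|u0] := eqVneq u 0.
    by rewrite -(scale0r 0) (meval_scale _ _ ah) expr1 !mul0r.
  have [u' u'vs [t ut]] := vs_all (J_sing (fun _ => id) hu) u0.
  rewrite ut; have [<-|vu] := eqVneq v u'; first by rewrite av mul0r.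
  rewrite /C rmorph_prod (big_rem u') //= vu.
  by case: (hc u' u'vs vu) => _ _ ->; rewrite mul0r mulr0.
exists (a ^+ N), (1 * N)%N; split; first exact: dhomogMn.
  by rewrite rmorphXn expf_neq0.
exists (C ^+ N), (m * N)%N; split; first exact: dhomogMn.
  by rewrite rmorphXn expf_neq0.
by rewrite -exprMn mulrC.
Qed.

Let Gid := germ_ideal_ideal f.
Let GJ := @germ_ideal_sub K n f.

(** The product of the elements that separate the other lines from v. *)
Lemma germ_avoid v : v \in vs -> exists E m, [/\ E \is m.-homog, E.@[v ord0] != 0 &
  forall w, w \in vs -> w != v -> germ w E].
Proof.
move=> vvs; have /choice[F hF] : forall w : 'rV[K]_n, exists F : {mpoly K[n]},
    w \in vs -> v != w -> exists m, [/\ F \is m.-homog, F.@[v ord0] != 0 & germ w F].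
  move=> w; have [/andP[wvs vw]|nw] := boolP ((w \in vs) && (v != w)); last first.
    by exists 0 => wvs vw; move: nw; rewrite wvs vw.
  by have [F [m h]] := germ_separate wvs vvs vw; exists F => _ _; exists m.
exists (\prod_(w <- vs | v != w) F w).
have [m Eh] : exists m, \prod_(w <- vs | v != w) F w \is m.-homog.
  rewrite big_seq_cond; elim/big_ind: _ => [|x y [k xk] [k' yk]|u /andP[uvs vu]].
  - by exists 0%N; apply: dhomog1.
  - by exists (k + k')%N; apply: dhomogM.
  - by have [m [h _ _]] := hF u uvs vu; exists m.
exists m; split=> //.
  rewrite rmorph_prod prodf_seq_neq0; apply/allP => u uvs; apply/implyP => vu.
  by have [? [_ h _]] := hF u uvs vu.
move=> w wvs wv; rewrite (big_rem w) //= eq_sym wv; apply: (idealMr (Gid w)).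
by have [|? []] := hF w wvs; first by rewrite eq_sym.
Qed.

(** Chinese remainder: p / l^N is congruent to A / B at v and to 0 at the other
    lines.  By germ_avoid there is E that is 0 at the other lines and a unit at v.
    The germ ideal at v and B E have no common zero off the origin, so a power of
    l is a multiple of B E modulo that germ ideal. *)
Lemma germ_chinese v A B M N0 : v \in vs -> A \is M.-homog -> B \is M.-homog ->
  B.@[v ord0] != 0 -> exists N p, [/\ (N0 <= N)%N, p \is N.-homog,
    germ v (l ^+ N * A - p * B) & forall w, w \in vs -> w != v -> germ w p].
Proof.
move=> vvs Ah Bh Bv; have [E [m [Eh Ev EG]]] := germ_avoid vvs.
pose Q : set {mpoly K[n]} := [set x | exists a, germ v (x - a * (B * E))].
have Qid : is_ideal Q.
  split=> [|x y [a ha] [b hb]|c x [a ha]].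
  - by exists 0; rewrite mul0r subr0; apply: (ideal0 (Gid v)).
  - exists (a + b); have -> : x + y - (a + b) * (B * E)
      = (x - a * (B * E)) + (y - b * (B * E)) by ring.
    exact: (idealD (Gid v)).
  - by exists (c * a); rewrite -mulrA -mulrBr; apply: (idealM (Gid v)).
have GQ : germ v `<=` Q by move=> x Gx; exists 0; rewrite mul0r subr0.
have [|w wvs|N1 QN1] := lin_power_in Qid.
- by move=> x /GJ/GQ.
- have [->|wv] := eqVneq w v; last first.
    by have [F [k [Fh Fw /GQ QF]]] := germ_separate vvs wvs wv; exists F, k.
  exists (B * E), (M + m)%N; split; [exact: dhomogM|by rewrite mevalM mulf_neq0|].
  by exists 1; rewrite mul1r subrr; apply: (ideal0 (Gid v)).
pose N := (N0 + N1 + (M + m))%N.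
have [a] : Q (l ^+ N).
  by apply: (ideal_exp_le Qid _ QN1); rewrite /N; lia.
move/(germ_ideal_pihomog fhom N); rewrite raddfB /= pihomog_dE ?lin_exp_homog //.
have -> : pihomog (@mdeg n) N (a * (B * E)) = pihomog (@mdeg n) (N0 + N1)%N a * (B * E).
  by rewrite /N pihomog_homogM // dhomogM.
set a' := pihomog _ _ a => ha.
exists N, (a' * (A * E)); split.
- by rewrite /N; lia.
- by apply: dhomogM; [exact: pihomogP|exact: dhomogM].
- have -> : l ^+ N * A - a' * (A * E) * B = A * (l ^+ N - a' * (B * E)) by ring.
  exact: (idealM (Gid v)).
- by move=> w wvs wv; do 2!apply: (idealM (Gid w)); apply: EG.
Qed.

Variables (k0 t : nat).
Hypothesis k0t : (k0 <= t)%N.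
Hypothesis lin_inj : forall k s p, (k0 <= k)%N -> R k p -> J (p * l ^+ s) -> J p.
Hypothesis lin_surj : forall k s p, (k0 <= k)%N -> R (k + s) p ->
  exists2 q, R k q & J (p - q * l ^+ s).

(** The remainder theorem yields some degree N; division by l^(N - t), bijective
    on R/J in these degrees, brings it down to the prescribed t. *)
Lemma germ_local_surj v (i : 'I_n) x : v \in vs -> v ord0 i != 0 ->
  local_ring (chart_point i v) x -> exists p, [/\ R t p,
    tjurina_ideal (dehomogenize i f) (chart_point i v)
      (x - rat_of_poly (dehomogenize i p)) &
    forall w, w \in vs -> w != v -> germ w p].
Proof.
move=> vvs vi [a [b [bq ->]]].
have [Ma hA] := homogenize i a; have [Mb hB] := homogenize i b.
have [A Ah Ad] := hA _ (leq_maxl Ma Mb); have [B Bh Bd] := hB _ (leq_maxr Ma Mb).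
set M := maxn Ma Mb in Ah Bh.
have Bv : B.@[v ord0] != 0 by apply: (deh_neq0_inv vi Bh); rewrite Bd.
have Xt := varX_homog K i t; have lt := lin_exp_homog lhom t.
have [|N [p' [tN ph' G' Gw']]] := germ_chinese t vvs (dhomogM Ah Xt) (dhomogM Bh lt).
  by rewrite mevalM mulf_neq0 // rmorphXn expf_neq0 // l_vs.
have [|p Rp Jp] := @lin_surj t (N - t)%N p' k0t; first by rewrite subnKC.
have lv w k : w \in vs -> (l ^+ k).@[w ord0] != 0.
  by move=> wvs; rewrite rmorphXn expf_neq0 // l_vs.
exists p; split=> //; last first.
  move=> w wvs wv; apply: (germ_ideal_unit (lin_exp_homog lhom (N - t)) (lv w _ wvs)).
  rewrite mulrC -(subKr p' (p * _)); apply: (idealB (Gid w)); first exact: Gw'.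
  exact: GJ.
have Ts := tjurina_subspace (chart_point i v) (dehomogenize i f).
have key : germ v (A * 'X_i ^+ t - p * B).
  apply: (germ_ideal_unit (lin_exp_homog lhom N) (lv v _ vvs)).
  have -> : l ^+ N * (A * 'X_i ^+ t - p * B) =
      (l ^+ N * (A * 'X_i ^+ t) - p' * (B * l ^+ t)) +
      (B * l ^+ t) * (p' - p * l ^+ (N - t)).
    have -> : l ^+ N = l ^+ (N - t) * l ^+ t by rewrite -exprD subnK.
    by ring.
  by apply: (idealD (Gid v)) => //; apply: (idealM (Gid v)); apply: GJ.
have kh : A * 'X_i ^+ t - p * B \is (M + t).-homog.
  by apply: rpredB; [exact: dhomogM|rewrite addnC; exact: dhomogM].
move: key; rewrite (tjurina_germ Kunc d_unit fhom vi kh) rmorphB !rmorphM rmorphXn /=.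
rewrite deh_var expr1n Ad Bd mulr1 rmorphB rmorphM /= => Tk.
apply: (tjurina_unit bq); rewrite mulrBr mulrCA divff ?mulr1 ?(rat_neq0 bq) //.
by rewrite [rat_of_poly b * _]mulrC.
Qed.

(** By lin_power_in for the ideal (J : p) some power of l multiplies p into J, and
    l is injective on R/J in degrees from k0 on. *)
Lemma germ_all_jacobian p : R t p -> (forall v, v \in vs -> germ v p) -> J p.
Proof.
move=> Rp hp; pose Q : set {mpoly K[n]} := [set x | J (x * p)].
have [||w wvs|N] := @lin_power_in Q.
- split=> [|x y hx hy|a x hx]; rewrite /Q /=.
  + by rewrite mul0r; apply: (ideal0 Jid).
  + by rewrite mulrDl; apply: (idealD Jid).
  + by rewrite -mulrA; apply: (idealM Jid).
- by move=> x Jx; apply: (idealMr Jid).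
- by have [b [m [bh bw Jb]]] := hp w wvs; exists b, m.
by rewrite /Q /= mulrC => /(lin_inj k0t Rp).
Qed.

Variable idx : 'rV[K]_n -> 'I_n.
Hypothesis idx_neq0 : forall v, v \in vs -> v ord0 (idx v) != 0.

Definition tau_at v := tjurina_number (dehomogenize (idx v) f) (chart_point (idx v) v).

Definition vanishing_on (us : seq 'rV[K]_n) : set {mpoly K[n]} :=
  [set p | R t p /\ forall v, v \in us -> germ v p].

Lemma vanishing_on_subspace us : subspace (vanishing_on us).
Proof.
split=> [|a p p' [Rp hp] [Rp' hp']].
  by split=> [|v _]; [exact: rpred0|exact: (ideal0 (Gid v))].
split=> [|v vus]; first by apply: rpredD => //; apply: rpredZ.
by apply: (idealD (Gid v)); [rewrite -mul_mpolyC; apply: (idealM (Gid v)); apply: hp|apply: hp'].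
Qed.

(** The germ at v maps the forms of degree t that vanish at other singular
    lines onto the Tjurina algebra of v. *)
Lemma vanishing_step us v : v \in vs -> v \notin us -> {subset us <= vs} ->
  has_quot_dim (vanishing_on us) (vanishing_on (v :: us)) (tau_at v).
Proof.
move=> vvs vus usvs.
have [|r hr] := homog_quot_dim (vanishing_on_subspace us)
  (vanishing_on_subspace (v :: us)) (k := t); first by move=> p [].
suff -> : tau_at v = r by [].
apply: quot_dimE; [exact: local_ring_subspace|exact: tjurina_subspace|].
apply: (has_quot_dim_image (phi := fun p => rat_of_poly (dehomogenize (idx v) p))) hr.
- exact: vanishing_on_subspace.
- exact: vanishing_on_subspace.
- exact: local_ring_subspace.
- exact: tjurina_subspace.
- move=> a p p'; rewrite raddfD /= dehZ -mul_mpolyC rmorphD rmorphM /=.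
  by [].
- by move=> p _; apply: local_ring_poly.
- move=> p [Rp hp]; rewrite -(tjurina_germ Kunc d_unit fhom (idx_neq0 vvs) Rp).
  split=> [[_ h]|h]; first by apply: h; rewrite mem_head.
  by split=> // w; rewrite inE => /orP[/eqP->|/hp].
- move=> x Lx; have [p [Rp Tp Gp]] := germ_local_surj vvs (idx_neq0 vvs) Lx.
  exists p => //; split=> // w wus; apply: Gp; first exact: usvs.
  by apply: contraNneq vus => <-.
Qed.

(** Imposing vanishing at one line after the other, the dimension drops by the
    Tjurina numbers, until only J is left. *)
Theorem hilbert_tjurina : has_quot_dim (R t) J (\sum_(v <- vs) tau_at v)%N.
Proof.
have claim us : uniq us -> {subset us <= vs} ->
    has_quot_dim (R t) (vanishing_on us) (\sum_(v <- us) tau_at v)%N.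
  elim: us => [|v us IH] /= uus usvs.
    rewrite big_nil; apply: has_quot_dim0; [exact: homog_part_subspace|
      exact: vanishing_on_subspace|by move=> p Rp; split].
  case/andP: uus => vus uus; rewrite big_cons addnC.
  have us' : {subset us <= vs} by move=> w wus; apply: usvs; rewrite inE wus orbT.
  apply: (has_quot_dim_add (X := vanishing_on us)); last first.
  - by apply: vanishing_step => //; apply: usvs; rewrite mem_head.
  - exact: IH.
  - by move=> p [].
  - by move=> p [Rp hp]; split=> // w wus; apply: hp; rewrite inE wus orbT.
  - exact: vanishing_on_subspace.
  - exact: vanishing_on_subspace.
  - exact: homog_part_subspace.
apply: (has_quot_dim_ext _ _ _ _ (claim vs vs_uniq (fun _ => id))).
- exact: homog_part_subspace.
- exact: vanishing_on_subspace.
- exact: ideal_subspace.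
- move=> p Rp; split=> [[_]|Jp]; first exact: germ_all_jacobian.
  by split=> // v _; apply: GJ.
Qed.

End Global.

(** * The symmetry *)

Section LinearForms.
Variables (K : fieldType) (n : nat).

Lemma lin_form_eval (l : {mpoly K[n]}) a (u v : 'rV[K]_n) : l \is 1.-homog ->
  l.@[(a *: u + v) ord0] = a * l.@[u ord0] + l.@[v ord0].
Proof.
move=> /dhomogP hl; rewrite (mpolyE l) !raddf_sum mulr_sumr -big_split !big_seq.
apply: eq_bigr => m ml; have /= /eqP/mdeg1P[i /eqP->] := hl m ml.
by rewrite /= !mevalZ !mevalXU !mxE; ring.
Qed.

Lemma lin_form_root (l : {mpoly K[n]}) : (1 < n)%N -> l \is 1.-homog ->
  exists2 v : 'rV[K]_n, v != 0 & l.@[v ord0] = 0.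
Proof.
move=> n1 hl; pose i0 := Ordinal (ltnW n1); pose i1 := Ordinal n1.
pose u : 'rV[K]_n := delta_mx 0 i0; pose w : 'rV[K]_n := delta_mx 0 i1.
have [l0|l0] := eqVneq (l.@[u ord0]) 0.
  exists u => //; apply/eqP => /rowP/(_ i0)/eqP.
  by rewrite !mxE !eqxx oner_eq0.
exists (- (l.@[w ord0] / l.@[u ord0]) *: u + w).
  apply/eqP => /rowP/(_ i1)/eqP; rewrite !mxE !eqxx /= mulr0 add0r.
  by rewrite oner_eq0.
by rewrite lin_form_eval // mulNr mulfVK // addNr.
Qed.

End LinearForms.

Section Symmetry.
Variable K : closedFieldType.
Hypothesis Kunc : infinite_fiber K.
Hypothesis char0 : forall d, (0 < d)%N -> d%:R != 0 :> K.
Variables (n d : nat) (f : {mpoly K[n]}).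
Hypothesis n_gt1 : (1 < n)%N.
Hypothesis fhom : f \is d.-homog.
Hypothesis dim_sing : zariski_dim_le (sing_locus f) 1.

Lemma vline_scale (v : 'rV[K]_n) t : t != 0 -> <[t *: v]>%VS = <[v]>%VS.
Proof.
move=> t0; apply/eqP; rewrite eqEsubv -!memvE; apply/andP; split; apply/vlineP.
  by exists t.
by exists t^-1; rewrite scalerA mulVf // scale1r.
Qed.

Lemma proj_sing_pick z : proj_sing f z ->
  [/\ vpick z != 0, sing_locus f (vpick z) & <[vpick z]>%VS = z].
Proof.
move=> [v [fv v0] <-]; have /vlineP[t vt] := memv_pick <[v]>%VS.
have z0 : vpick <[v]>%VS != 0.
  rewrite vpick0; apply/eqP => z0; apply: v0; apply/eqP.
  by rewrite -memv0 -z0 memv_line.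
have t0 : t != 0 by apply: contraNneq z0 => t0; rewrite vt t0 scale0r.
by split=> //; rewrite vt ?vline_scale //; apply: (sing_locus_scale fhom).
Qed.

Definition nonzero_coord (v : 'rV[K]_n) : 'I_n :=
  if [pick i | v ord0 i != 0] is Some i then i else Ordinal (ltnW n_gt1).

(** Once the degree is positive, a linear form avoiding the finitely many
    singular lines reduces the claim to mu_nu_sum and hilbert_tjurina. *)
Theorem mu_nu_tjurina (k : int) :
  (mu'' f k + nu f d ((n * d)%N%:Z - k))%N = total_tjurina f.
Proof.
have /finite_seqP[zs0 zs0E] := finite_proj_sing Kunc fhom dim_sing.
pose zs := undup zs0.
have zsE z : z \in zs <-> proj_sing f z by rewrite zs0E /= mem_undup.
pose vs := [seq vpick z | z <- zs].
have vs_line v : v \in vs -> exists2 z, z \in zs & v = vpick z.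
  by move=> /mapP[z zz ->]; exists z.
have vs_neq0 v : v \in vs -> v != 0.
  by move=> /vs_line[z /zsE/proj_sing_pick[? _ _] ->].
have vs_uniq : uniq vs.
  rewrite map_inj_in_uniq ?undup_uniq // => z z' /zsE/proj_sing_pick[_ _ hz].
  by move=> /zsE/proj_sing_pick[_ _ hz'] e; rewrite -hz e.
have vs_distinct v w t : v \in vs -> w \in vs -> w = t *: v -> w = v.
  move=> /vs_line[z /zsE/proj_sing_pick[v0 _ hz] ->].
  move=> /vs_line[z' /zsE/proj_sing_pick[w0 _ hz'] ->] e.
  have t0 : t != 0 by apply: contraNneq w0 => t0; rewrite e t0 scale0r.
  by congr vpick; rewrite -hz' e vline_scale.
have vs_all v : sing_locus f v -> v != 0 -> exists2 w, w \in vs & exists t, v = t *: w.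
  move=> fv v0; have zv : proj_sing f <[v]>%VS by exists v => //; split=> //; apply/eqP.
  have [p0 _ hp] := proj_sing_pick zv; exists (vpick <[v]>%VS).
    by apply: map_f; apply/zsE.
  by apply/vlineP; rewrite hp memv_line.
have [l lhom l_vs] := avoiding_linear_form Kunc vs_neq0.
have lJ (v : 'rV[K]_n) : (forall i, (f^`M(i)).@[v ord0] = 0) -> l.@[v ord0] = 0 -> v = 0.
  move=> fv lv; apply/eqP/negPn/negP => v0; have [w wvs [t vt]] := vs_all v fv v0.
  move/eqP: lv; rewrite vt (meval_scale _ _ lhom) expr1 mulf_eq0 (negPf (l_vs w wvs)).
  by rewrite orbF => /eqP t0; move: v0; rewrite vt t0 scale0r eqxx.
(* For constant f the hyperplane l = 0 would consist of singular points. *)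
have d_gt0 : (0 < d)%N.
  rewrite lt0n; apply/eqP => d0; have [v v0 lv] := lin_form_root n_gt1 lhom.
  move/eqP: v0; apply; apply: lJ lv => i; have /dhomogP hf := fhom.
  have -> : f = (f@_0)%:MP.
    apply: msize1_polyC; rewrite msizeE big_seq; elim/big_ind: _ => //.
      by move=> x y hx hy; rewrite geq_max hx.
    by move=> m /hf /= ->; rewrite d0.
  by rewrite mderivC meval0.
have ghom i : f^`M(i) \is d.-1.-homog by apply: dhomog_mderiv.
have [k0 [tau [tau_dim [lin_inj lin_surj]]]] :=
  lin_eventually_bij Kunc ghom lhom lJ (ltnW n_gt1).
rewrite (mu_nu_sum Kunc n_gt1 d_gt0 fhom lhom lJ tau_dim lin_inj).
have idx0 v : v \in vs -> v ord0 (nonzero_coord v) != 0.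
  move=> /vs_neq0/rV_neq0[i vi]; rewrite /nonzero_coord; case: pickP => [//|h].
  by move: (h i); rewrite vi.
have dims := hilbert_tjurina Kunc (char0 d_gt0) fhom lhom vs_neq0 vs_uniq
  vs_distinct vs_all l_vs (leqnn k0) lin_inj lin_surj idx0.
rewrite (has_quot_dim_unique (homog_part_subspace _ _ k0)
  (ideal_subspace (gen_ideal_ideal _)) (tau_dim k0 (leqnn k0)) dims).
rewrite /total_tjurina; have -> : proj_sing f = [set` zs].
  by apply/seteqP; split=> z /zsE.
rewrite -fsbig_seq ?undup_uniq // big_map big_seq [RHS]big_seq.
apply: eq_bigr => z /zsE/proj_sing_pick[z0 _ _].
rewrite /tau_at /local_tjurina /nonzero_coord; case: pickP => [//|h].
by have [i zi] := rV_neq0 z0; move: (h i); rewrite zi.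
Qed.

End Symmetry.

(** Both sides equal tau minus the two values of nu that the reflection
    exchanges. *)
Lemma delta_symmetric (mu nu : int -> nat) (tau n d : nat) : (0 < n)%N ->
  (forall k, (mu k + nu ((n * d)%N%:Z - k)%R)%N = tau) -> forall k : int,
  (mu k)%:Z - (nu (k + d%:Z))%:Z =
  (mu ((n.-1 * d)%N%:Z - k))%:Z - (nu ((n.-1 * d)%N%:Z - k + d%:Z))%:Z.
Proof.
move=> n_gt0 main k; have h := main k; have := main ((n.-1 * d)%N%:Z - k).
have nd : (n * d)%N%:Z = (n.-1 * d)%N%:Z + d%:Z.
  by rewrite -PoszD addnC -mulSn prednK.
have -> : (n * d)%N%:Z - ((n.-1 * d)%N%:Z - k) = k + d%:Z by rewrite nd; ring.
have -> : (n.-1 * d)%N%:Z - k + d%:Z = (n * d)%N%:Z - k by rewrite nd; ring.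
by move: h; lia.
Qed.

Theorem corollary2 (R : realType) (n d : nat) (f : {mpoly R[i][n]})
    (n_ge2 : (2 <= n)%N)
    (f_homog : f \is d.-homog)
    (dim_sing : zariski_dim_le (sing_locus f) 1)
    (f_nvars : ~ poly_of_fewer_variables f) :
  (forall k : int,
     (mu'' f k + nu f d ((n * d)%:Z - k))%N = total_tjurina f) /\
  (forall k : int,
     delta'' f d k = delta'' f d ((n.-1 * d)%:Z - k)).
Proof.
have char0 m : (0 < m)%N -> m%:R != 0 :> R[i] by rewrite pnatr_eq0 lt0n.
have main := mu_nu_tjurina (@infinite_fiber_complex R) char0 n_ge2 f_homog dim_sing.
by split=> // k; apply: delta_symmetric main k; apply: ltnW.
Qed.
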